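(* Let $\mathbf F,\mathbf G\in L^2_c(Q;\mathbb{R}^3)$ and define $$\mathbf U_0:=\boldsymbol\Gamma_0*\mathbf G,\qquad \mathbf U_1:=\boldsymbol\Gamma_0*\mathbf F-\gamma_1\int_Q\mathbf G(y)\,dy.$$ Suppose that for some $c\in\mathbb{R}$, some $\mathbf M\in\mathbb{R}^3\setminus\{0\}$ and some scalar distribution $\chi\in\mathcal D'(I)$, $$\mathbf U_1(x)-c\,\mathbf U_0(x)=\mathbf M\,\chi(x_3)\qquad\text{in }\mathcal D'(Q)^3.$$ Then $$\mathbf F=c\,\mathbf G\quad\text{a.e. in }Q,$$ and $$\mathbf U_1-c\,\mathbf U_0=-\gamma_1\int_Q\mathbf G(y)\,dy\qquad\text{in }Q.$$ If $\mathbf M\chi\not\equiv0$ in $Q$, then $\int_Q\mathbf G(y)\,dy\ne0$.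
   Context: Fixed real constants $\lambda,\mu$ with $\mu>0$, $\lambda+2\mu>0$, and a constant $\rho_0>0$. $Q=D\times I\subset\mathbb{R}^3$ with $D\subset\mathbb{R}^2$ bounded and open and $I=(t_-,t_+)$ a bounded open interval; $x=(x',x_3)$. $L^2_c(Q;\mathbb{R}^3)$ denotes the elements of $L^2(\mathbb{R}^3;\mathbb{R}^3)$ whose essential support is compactly contained in $Q$. Kelvin tensor: $\boldsymbol\Gamma_0(x)=\frac{\lambda+3\mu}{8\pi\mu(\lambda+2\mu)}\frac{I_3}{|x|}+\frac{\lambda+\mu}{8\pi\mu(\lambda+2\mu)}\frac{xx^\top}{|x|^3}$, $x\ne0$. Constant: $\gamma_1=\frac{\sqrt{\rho_0}}{12\pi}[2\mu^{-3/2}+(\lambda+2\mu)^{-3/2}]>0$. For $\chi\in\mathcal D'(I)$, $\chi(x_3)$ denotes the distribution $1\otimes\chi$ on $Q=D\times I$. *)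

(* Defs.v *)
From HB Require Import structures.
From mathcomp Require Import all_boot all_order all_algebra.
From mathcomp Require Import all_classical all_reals all_analysis.

Set Implicit Arguments.
Unset Strict Implicit.
Unset Printing Implicit Defensive.

Import Order.TTheory GRing.Theory Num.Theory.
Import numFieldNormedType.Exports.

Local Open Scope classical_set_scope.
Local Open Scope ring_scope.

(* The canonical sigma-finite instance of [m1 \x m2] only covers
   (sub)probabilities, whereas Fubini on R^3 needs it for Lebesgue measures. *)
Lemma sigma_finite_prod d1 d2 (T1 : measurableType d1) (T2 : measurableType d2)
    (R : realType) (m1 : {sigma_finite_measure set T1 -> \bar R})
    (m2 : {sigma_finite_measure set T2 -> \bar R}) :
  sigma_finite setT (m1 \x m2)%E.
Proof.
have /sigma_finiteP[F [TF ndF Foo]] := sigma_finiteT m1.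
have /sigma_finiteP[G [TG ndG Goo]] := sigma_finiteT m2.
exists (fun n => F n `*` G n).
  rewrite -setXTT TF TG predeqE => -[x y]; split.
    move=> [/= [n _ Fnx] [k _ Gky]]; exists (maxn n k) => //; split.
    - by move: x Fnx; exact/subsetPset/ndF/leq_maxl.
    - by move: y Gky; exact/subsetPset/ndG/leq_maxr.
  by move=> [n _ []/= ? ?]; split; exists n.
move=> k; have [? ?] := Foo k; have [? ?] := Goo k.
split; first exact: measurableX.
by rewrite product_measure1E// lte_mul_pinfty// ge0_fin_numE.
Qed.

Definition lebesgue2 {R : realType} := (@lebesgue_measure R \x @lebesgue_measure R)%E.
HB.instance Definition _ (R : realType) := Measure.on (@lebesgue2 R).
HB.instance Definition _ (R : realType) :=
  @Measure_isSigmaFinite.Build _ _ _ (@lebesgue2 R)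
    (sigma_finite_prod (@lebesgue_measure R) (@lebesgue_measure R)).

(* R^3 is [R * R * R], that is, [(R * R) * R]: for [x] in R^3, [x.1] is x' and
   [x.2] is x_3. *)
Definition lebesgue3 {R : realType} := (@lebesgue2 R \x @lebesgue_measure R)%E.
HB.instance Definition _ (R : realType) := Measure.on (@lebesgue3 R).
HB.instance Definition _ (R : realType) :=
  @Measure_isSigmaFinite.Build _ _ _ (@lebesgue3 R)
    (sigma_finite_prod (@lebesgue2 R) (@lebesgue_measure R)).

Section distributions.
Context {R : realType} {V : normedModType R}.
Implicit Types (Omega K : set V) (f g phi : V -> R) (T S : (V -> R) -> R).

Definition iter_derive (vs : seq V) f : V -> R :=
  foldr (fun v g => 'D_v g) f vs.

(* On a finite-dimensional [V] this is C^infinity: ranging over directions in a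
   basis gives the iterated partial derivatives, and conversely continuity of
   these yields all the directional derivatives. *)
Definition smooth f : Prop :=
  forall vs : seq V, continuous (iter_derive vs f) /\
    forall x v, derivable (iter_derive vs f) x v.

Definition tsupport f : set V := closure [set x | f x != 0].

(* C_c^infinity(Omega), as functions on [V] vanishing outside Omega *)
Definition test_function Omega phi : Prop :=
  [/\ smooth phi, compact (tsupport phi) & tsupport phi `<=` Omega].

(* An element of D'(Omega) is a functional on [V -> R] of which only the
   values at test functions matter. *)
Definition is_distribution Omega T : Prop :=
  (forall (a : R) phi psi, test_function Omega phi -> test_function Omega psi ->
     T (fun x => a * phi x + psi x) = a * T phi + T psi) /\
  (forall K, compact K -> K `<=` Omega ->
     exists (C : R) (s : seq (seq V)),
       forall phi, test_function Omega phi -> tsupport phi `<=` K ->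
         `|T phi| <= C * \sum_(vs <- s) sup (range (fun x => `|iter_derive vs phi x|))).

Definition eq_distribution Omega S T : Prop :=
  forall phi, test_function Omega phi -> S phi = T phi.

End distributions.

Section distributions_on_the_cylinder.
Context {R : realType}.

Definition regular_distribution (Q : set (R * R * R)) (u phi : R * R * R -> R) : R :=
  \int[lebesgue3]_(x in Q) (u x * phi x).

(* the distribution 1 (x) chi on D x I *)
Definition tensor1 (D : set (R * R)) (chi : (R -> R) -> R)
    (phi : R * R * R -> R) : R :=
  chi (fun t => \int[lebesgue2]_(x' in D) phi (x', t)).

End distributions_on_the_cylinder.

Section Kelvin.
Context {R : realType}.
Implicit Types (x y : R * R * R) (F G : R * R * R -> 'cV[R]_3).

Definition coords x : 'cV[R]_3 := \col_(i < 3) [:: x.1.1; x.1.2; x.2]`_i.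

(* Not the norm [`|x|] of the product type, which is the sup norm. *)
Definition euclid_norm x : R := Num.sqrt (\sum_(i < 3) coords x i 0 ^+ 2).

Definition vector_integral (A : set (R * R * R)) F : 'cV[R]_3 :=
  \col_i \int[lebesgue3]_(y in A) F y i 0.

Definition convolution (K : R * R * R -> 'M[R]_3) G x : 'cV[R]_3 :=
  vector_integral setT (fun y => K (x - y) *m G y).

(* takes the value 0 at the origin, as [0^-1 = 0] *)
Definition Kelvin (lambda mu : R) x : 'M[R]_3 :=
  ((lambda + 3 * mu) / (8 * pi * mu * (lambda + 2 * mu)) / euclid_norm x)%:M +
  ((lambda + mu) / (8 * pi * mu * (lambda + 2 * mu)) / euclid_norm x ^+ 3)
    *: (coords x *m (coords x)^T).

Definition gamma1 (lambda mu rho0 : R) : R :=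
  Num.sqrt rho0 / (12 * pi) *
  (2 * mu `^ (- (3 / 2)) + (lambda + 2 * mu) `^ (- (3 / 2))).

Definition ess_support F : set (R * R * R) :=
  [set x | forall U, nbhs x U ->
     ~ lebesgue3.-negligible (U `&` [set y | F y != 0])].

Definition L2c (Q : set (R * R * R)) F : Prop :=
  [/\ forall i, (fun x => F x i 0) \in Lfun lebesgue3 2%:E,
      compact (ess_support F) & ess_support F `<=` Q].

End Kelvin.

(* Main.v *)
(* Put H = F - c G. The first task is to get rid of the distribution chi: the equation
   is tested with the vector field L(d_1 eta e_j), where L is the Lame operator and eta
   is a product of three smooth functions of one variable supported in a box contained
   in Q. The integral of each component over every horizontal slice vanishes, because
   it contains the derivative d_1, so that neither chi nor a constant vector
   contributes. By Fubini and the fundamental solution property of the Kelvin tensor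
   what remains is that the integral of H_j d_1 eta is 0. The fundamental solution
   property is obtained by replacing |x - y| with sqrt (|x - y|^2 + e^2), integrating by
   parts one variable at a time, and letting e tend to 0.

   As the difference of a product function and its translate along x_1 is of the form
   d_1 eta, the integral of H_j against a product function supported in a small box
   does not change when that function is translated by a small amount along x_1, even
   where the box meets the complement of Q, because H vanishes there. Translating the
   box out of the support of H shows that the integral is 0. Hence H_j = 0 a.e., and
   the other two claims follow. *)

Require Import Defs.
From mathcomp Require Import all_boot all_order all_algebra.
From mathcomp Require Import all_classical all_reals all_analysis.
From mathcomp Require Import ring lra measurable_realfun.

Set Implicit Arguments.
Unset Strict Implicit.
Unset Printing Implicit Defensive.

Import Order.TTheory GRing.Theory Num.Theory.
Import numFieldNormedType.Exports.

Local Open Scope classical_set_scope.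
Local Open Scope ring_scope.

(** With s = sqrt (|x - y|^2 + e^2), the regularized Kelvin tensor is (al + be) delta_ki / s - be
    d_k d_i s, and the Laplacians of s and 1 / s are 2 / s + e^2 / s^3 and -3 e^2 / s^5. Under the
    Lame operator the terms d_j d_k (1 / s) cancel exactly because of the ratio of the two Kelvin
    coefficients. There remain a multiple of 3 e^2 / s^5, which is an approximate identity, and
    second derivatives of e^2 / s^3, which tend to 0. The same two Laplacians, paired with a cutoff,
    also give the uniform local integrability of 1 / |x - y| and the integrability of the limit
    profile, so that no polar coordinates are involved. Products of functions of one variable are
    used throughout because a partial derivative of such a product only raises one index, and each
    integration by parts is then the fundamental theorem of calculus on a line. *)

(** * Functions with continuous directional derivatives up to a given order *)

Section Ck.
Context {R : realType} {V : normedModType R}.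
Implicit Types f g : V -> R.

(** [smooth] speaks of all iterated directional derivatives at once and is awkward to build up; here
    the derivatives are existential witnesses, so that closure under products is an induction on
    n. *)
Fixpoint Ck (n : nat) f : Prop :=
  continuous f /\
  if n is m.+1 then
    forall v, exists2 g, (forall x, is_derive x v f (g x)) & Ck m g
  else True.

Lemma Ck_continuous n f : Ck n f -> continuous f.
Proof. by case: n => [|n] []. Qed.

Lemma CkW n f : Ck n.+1 f -> Ck n f.
Proof.
elim: n f => [|n IH] f; first by case.
move=> [cf df]; split=> // v; have [g fg Cg] := df v.
by exists g => //; exact: IH.
Qed.

Lemma CkD n f g : Ck n f -> Ck n g -> Ck n (fun x => f x + g x).
Proof.
elim: n f g => [|n IH] f g [cf df] [cg dg].
  by split => // x; exact: (continuousD (cf x) (cg x)).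
split; first by move=> x; exact: (continuousD (cf x) (cg x)).
move=> v; have [f' ff' Cf'] := df v; have [g' gg' Cg'] := dg v.
exists (fun x => f' x + g' x); last exact: IH.
by move=> x; exact: is_deriveD.
Qed.

Lemma CkM n f g : Ck n f -> Ck n g -> Ck n (fun x => f x * g x).
Proof.
elim: n f g => [|n IH] f g [cf df] [cg dg].
  by split => // x; exact: (continuousM (cf x) (cg x)).
split; first by move=> x; exact: (continuousM (cf x) (cg x)).
move=> v; have [f' ff' Cf'] := df v; have [g' gg' Cg'] := dg v.
exists (fun x => f x * g' x + g x * f' x).
  by move=> x; exact: is_deriveM.
by apply: CkD; apply: IH => //; apply: CkW.
Qed.

Lemma Ck_cst n (k : R) : Ck n (fun=> k).
Proof.
elim: n k => [|n IH] k; first by split => // x; exact: cvg_cst.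
split; first by move=> x; exact: cvg_cst.
by move=> v; exists (fun=> 0) => // x; exact: is_derive_cst.
Qed.

Lemma Ck_smooth f : (forall n, Ck n f) -> smooth f.
Proof.
move=> Cf vs; suff CD n : Ck n (iter_derive vs f).
  split; first exact: Ck_continuous (CD 0%N).
  by move=> x v; have [_ /(_ v)[g fg _]] := CD 1%N; exact: ex_derive.
elim: vs n => //= v vs IH n; have [_ /(_ v)[g fg Cg]] := IH n.+1.
rewrite (_ : 'D_v _ = g)//; apply/funext => x.
exact: derive_val.
Qed.

End Ck.

(** * Functions of one variable together with all their derivatives *)

Section jets.
Context {R : realType}.
Implicit Types (a b : nat -> R -> R) (f g : R -> R).

Definition jet a := forall n (x : R), is_derive x 1 (a n) (a n.+1 x).

Definition vanishes_off (l r : R) a := forall n x, (x < l) || (r < x) -> a n x = 0.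

Lemma jet_continuous a n : jet a -> continuous (a n).
Proof.
move=> ja x; apply: differentiable_continuous; apply/derivable1_diffP.
exact: ex_derive.
Qed.

Lemma is_deriveZdir f (x v l : R) : is_derive x 1 f l -> is_derive x v f (v * l).
Proof.
move=> fl; have df : differentiable f x.
  by apply/derivable1_diffP; exact: ex_derive.
split; first exact: diff_derivable.
by rewrite deriveE// -[v in LHS]mulr1 -[v * 1]/(v *: 1) linearZ/= -deriveE// derive_val.
Qed.

Lemma Ck_jet a n k : jet a -> Ck n (a k).
Proof.
move=> ja; elim: n k => [|n IH] k; first by split => //; exact: jet_continuous.
split; first exact: jet_continuous.
move=> v; exists (fun x => v * a k.+1 x).
  by move=> x; exact: is_deriveZdir.
by apply: CkM => //; exact: Ck_cst.
Qed.

Lemma jet_Ck f : (forall n, Ck n f) -> exists2 a, jet a & a 0%N = f.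
Proof.
move=> Cf; exists (fun n => derive1n n f) => //.
suff CD n : forall m, Ck m (derive1n n f).
  move=> n x; have [_ /(_ 1)[g fg _]] := CD n 1%N.
  by rewrite derive1nS derive1E; exact: derivableP.
elim: n => // n IH m; have [_ /(_ 1)[g fg Cg]] := IH m.+1.
rewrite derive1nS (_ : derive1 (derive1n n f) = g)//; apply/funext => x.
by rewrite derive1E; exact: derive_val.
Qed.

(** The complement of [l, r] is open, so f is 0 near x. *)
Lemma derive_vanishes_off f (f' l r x : R) :
  (forall t, (t < l) || (r < t) -> f t = 0) -> is_derive x (1 : R) f f' ->
  (x < l) || (r < x) -> f' = 0.
Proof.
move=> f0 df xlr.
have d0 : is_derive x 1 (cst 0 : R -> R) 0 by exact: is_derive_cst.
rewrite -(@derive_val _ _ _ _ _ _ _ df).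
apply: (@derive_val _ _ _ _ _ _ _ (near_eq_is_derive _ d0)).
have : \forall y \near x, (y < l) || (r < y).
  case/orP: xlr => [xl|rx].
    have o : open_nbhs x [set y | y < l] by split => //; exact: open_lt.
    by apply: filterS (open_nbhs_nbhs o) => y /= ->.
  have o : open_nbhs x [set y | r < y] by split => //; exact: open_gt.
  by apply: filterS (open_nbhs_nbhs o) => y /= ->; rewrite orbT.
by apply: filterS => y /f0 ->.
Qed.

Lemma jet_vanishes a l r : jet a -> (forall x, (x < l) || (r < x) -> a 0%N x = 0) ->
  vanishes_off l r a.
Proof.
by move=> ja a0; elim=> // n IH x; exact: derive_vanishes_off IH (ja n x).
Qed.

(** The factor [n ^+ k] is what the chain rule contributes after k derivatives. *)
Lemma jet_affine a (n p : R) : jet a -> jet (fun k x => n ^+ k * a k (n * (x - p))).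
Proof.
move=> ja k x.
have h : is_derive x 1 (fun x => n * (x - p)) n.
  by apply: is_derive_eq; rewrite subr0 -[_ *: _]/(_ * _) mulr1.
have h1 := @is_derive1_comp _ (a k) (fun x => n * (x - p)) x _ _ (ja k _) h.
have h2 := is_deriveZ (n ^+ k) h1.
apply: (is_derive_eq h2).
by rewrite -[_ *: _]/(_ * _) exprSr; ring.
Qed.

Lemma jetB a b : jet a -> jet b -> jet (fun k x => a k x - b k x).
Proof. by move=> ja jb k x; apply: is_deriveB. Qed.

Lemma jetZ a (k : R) : jet a -> jet (fun n x => k * a n x).
Proof. by move=> ja n x; exact: is_deriveZ. Qed.

End jets.

(** * Construction of a smooth step function *)

Section flat.
Context {R : realType}.
Implicit Types p q : {poly R}.

(* The derivatives of [exp (-1 / x)], extended by 0 to [x <= 0], have this shape. *)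
Definition flat p (x : R) : R := if 0 < x then p.[x^-1] * expR (- x^-1) else 0.

(** For k > 0, raise exp (u / k) >= u / k to the power k. *)
Lemma expR_dominates_expn (k : nat) (u : R) : 0 < u -> u ^+ k <= k%:R ^+ k * expR u.
Proof.
move=> u0; case: k => [|k]; first by rewrite !expr0 mul1r ltW// expR_gt1.
have -> : expR u = expR (u / k.+1%:R) ^+ k.+1.
  by rewrite -expRM_natl mulrC divfK// pnatr_eq0.
rewrite -exprMn lerXn2r ?nnegrE ?mulr_ge0 ?expR_ge0// ?(ltW u0)//.
rewrite -ler_pdivrMl// mulrC (le_trans _ (expR_ge1Dx _))//.
by rewrite lerDr ler01.
Qed.

(** The quadratic bound lets the difference quotient at 0 tend to 0 in [is_derive_flat]. With u = 1
    / x, the exponential beats u^(i + 2) for each monomial u^i of p. *)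
Lemma flat_bound p : exists2 C : R, 0 <= C & forall x, `|flat p x| <= C * x ^+ 2.
Proof.
have [K K0 HK] : exists2 K : nat -> R, (forall i, 0 <= K i) &
    forall i u, 0 < u -> u ^+ i * u ^+ 2 <= K i * expR u.
  exists (fun i => i.+2%:R ^+ i.+2) => [i|i u u0]; first by rewrite exprn_ge0.
  by rewrite -exprD addn2; exact: expR_dominates_expn.
exists (\sum_(i < size p) `|p`_i| * K i).
  by apply: sumr_ge0 => i _; rewrite mulr_ge0.
move=> x; rewrite /flat; case: ifPn => x0; last first.
  by rewrite normr0 mulr_ge0 ?sqr_ge0// sumr_ge0// => i _; rewrite mulr_ge0.
have u0 : 0 < x^-1 by rewrite invr_gt0.
rewrite normrM (ger0_norm (expR_ge0 _)) horner_coef.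
rewrite (le_trans (ler_wpM2r (expR_ge0 _) (ler_norm_sum _ _ _)))//.
rewrite !mulr_suml ler_sum// => i _.
rewrite normrM -2!(mulrA `|_|) ler_wpM2l// ger0_norm ?exprn_ge0 ?(ltW u0)//.
have := HK i _ u0; rewrite expRN ler_pdivrMr ?expR_gt0//.
rewrite -ler_pdivlMr ?exprn_gt0// => h.
by rewrite (le_trans h)// exprVn invrK mulrAC.
Qed.

(** For x > 0 the chain rule gives x^-2 (p - p')(1 / x) exp (-1 / x), whence the polynomial X^2 (p -
    p'). At 0 the derivative is 0 by [flat_bound]. *)
Lemma is_derive_flat p x : is_derive x (1 : R) (flat p) (flat ('X^2 * (p - p^`())) x).
Proof.
have [x0|x0|->] := ltgtP x 0.
- rewrite /flat ltNge (ltW x0)/=.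
  have d0 : is_derive x 1 (cst 0 : R -> R) 0 by exact: is_derive_cst.
  apply: near_eq_is_derive d0.
  have o : open_nbhs x [set y | y < 0] by split => //; exact: open_lt.
  by apply: filterS (open_nbhs_nbhs o) => y /= y0; rewrite ltNge (ltW y0).
- have dV : is_derive x 1 (fun y : R => y^-1) (- x ^- 2).
    have := @is_deriveV _ id x 1 1 (lt0r_neq0 x0) (is_derive_id _ _).
    by rewrite -[_ *: _]/(_ * _) mulr1.
  have dp := @is_derive1_comp _ (fun y => p.[y]) (fun y => y^-1) x _ _ (is_derive_poly _ _) dV.
  have de := @is_derive1_comp _ expR (fun y => - y^-1) x _ _ (is_derive_expR _) (is_deriveN dV).
  have d := is_deriveM dp de.
  have E : \forall y \near x, p.[y^-1] * expR (- y^-1) = flat p y.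
    have o : open_nbhs x [set y | 0 < y] by split => //; exact: open_gt.
    by apply: filterS (open_nbhs_nbhs o) => y /= y0; rewrite /flat y0.
  have d1 := near_eq_is_derive E d.
  apply: (is_derive_eq d1).
  rewrite /flat x0 !hornerE /= -![_ *: _]/(_ * _) exprVn; ring.
- rewrite {2}/flat ltxx.
  have [C C0 HC] := flat_bound p.
  suff h : (fun h : R => h^-1 *: (flat p (h *: 1 + 0) - flat p 0)) @ 0^' --> (0 : R).
    by split; [apply/cvg_ex; exists 0|exact/cvg_lim].
  apply/cvgr0Pnorm_lt => e e0.
  near=> h.
  rewrite /flat ltxx subr0 addr0 -[h *: 1]/(h * 1) mulr1 -/(flat p h).
  rewrite -[_ *: _]/(_ * _) normrM normfV.
  have h0 : h != 0 by near: h; exact: nbhs_dnbhs_neq.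
  rewrite mulrC ltr_pdivrMr ?normr_gt0//.
  rewrite (le_lt_trans (HC h))// -real_normK ?num_real// expr2 mulrA.
  rewrite ltr_pM2r ?normr_gt0//.
  rewrite (@le_lt_trans _ _ ((C + 1) * `|h|))//; first by rewrite ler_wpM2r// lerDl.
  rewrite mulrC -ltr_pdivlMr; last by rewrite ltr_wpDl.
  by near: h; apply: dnbhs0_lt; rewrite divr_gt0// ltr_wpDl.
Unshelve. all: by end_near. Qed.

Lemma flat_jet : exists2 a : nat -> R -> R, jet a & a 0%N = flat 1.
Proof.
exists (fun n => flat (iter n (fun p => 'X^2 * (p - p^`())) 1)) => //.
by move=> n x; exact: is_derive_flat.
Qed.

End flat.

Section primitive.
Context {R : realType}.
Implicit Types (b : nat -> R -> R) (f : R -> R).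
Local Notation mu := (@lebesgue_measure R).

Lemma integrable_continuous_vanishing f (l r : R) : continuous f ->
  (forall x, (x < l) || (r < x) -> f x = 0) -> mu.-integrable setT (EFin \o f).
Proof.
move=> cf f0; have -> : EFin \o f = (EFin \o f) \_ `[l, r].
  apply/funext => x; rewrite /patch; case: ifPn => //.
  rewrite notin_setE /= in_itv/= => /negP; rewrite negb_and -!ltNge => /f0 -> //.
apply/integrable_restrict => //; rewrite setTI.
apply: continuous_compact_integrable; first exact: segment_compact.
exact: continuous_subspaceT.
Qed.

Lemma Rintegral0_eq d (T : measurableType d) (m : {measure set T -> \bar R})
    (D : set T) (f : T -> R) : (forall x, D x -> f x = 0) -> \int[m]_(x in D) f x = 0.
Proof. by move=> f0; rewrite /Rintegral integral0_eq// => x /f0 ->. Qed.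

Definition primitive f (x : R) : R := \int[mu]_(t in `]-oo, x]) f t.

Lemma is_derive_primitive f (x : R) : continuous f -> mu.-integrable setT (EFin \o f) ->
  is_derive x (1 : R) (primitive f) (f x).
Proof.
move=> cf fi; have xx : x < x + 1 by rewrite ltrDl.
have fi' : mu.-integrable `]-oo, x + 1] (EFin \o f) by apply: integrableS fi.
have [d e] := continuous_FTC1 xx fi' (ltNyr _) (cf x).
by split => //; rewrite -derive1E.
Qed.

Lemma primitive_vanish f (l x : R) : (forall x, x < l -> f x = 0) -> x < l ->
  primitive f x = 0.
Proof.
move=> f0 xl; apply: Rintegral0_eq => t /=; rewrite in_itv/= => tx.
by rewrite f0// (le_lt_trans tx).
Qed.

Lemma primitive_cst f (r x : R) : mu.-integrable setT (EFin \o f) ->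
  (forall x, r < x -> f x = 0) -> r < x -> primitive f x = primitive f r.
Proof.
move=> fi f0 rx; apply/eqP; rewrite -subr_eq0 /primitive Rintegral_itvB//=.
- apply/eqP; apply: Rintegral0_eq => t /=.
  by rewrite in_itv/= => /andP[rt _]; rewrite f0.
- by apply: integrableS fi.
- by rewrite bnd_simp ltW.
Qed.

Lemma primitive_ge0 f (x : R) : (forall x, 0 <= f x) -> 0 <= primitive f x.
Proof. by move=> f0; exact: Rintegral_ge0. Qed.

Lemma primitive_mono f (x y : R) : mu.-integrable setT (EFin \o f) ->
  (forall x, 0 <= f x) -> x <= y -> primitive f x <= primitive f y.
Proof.
move=> fi f0 xy; rewrite -subr_ge0 /primitive Rintegral_itvB//=.
- exact: Rintegral_ge0.
- by apply: integrableS fi.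
Qed.

Lemma jet_primitive b l r : jet b -> vanishes_off l r b ->
  jet (fun n => if n is m.+1 then b m else primitive (b 0%N)).
Proof.
move=> jb b0 [|n] x /=; last exact: jb.
have c : continuous (b 0%N) by exact: jet_continuous.
by apply: is_derive_primitive => //; apply: integrable_continuous_vanishing c (b0 _).
Qed.

End primitive.

Section step.
Context {R : realType}.
Local Notation mu := (@lebesgue_measure R).

(** The step is the normalized primitive of [flat 1 x * flat 1 (1 - x)], which is smooth and
    positive exactly on ]0, 1[. *)
Lemma smooth_step : exists a : nat -> R -> R,
  [/\ jet a, forall x, x <= 0 -> a 0%N x = 0, forall x, 1 <= x -> a 0%N x = 1,
      {homo a 0%N : x y / x <= y} &  forall x, 0 <= a 0%N x <= 1].
Proof.
have [g jg g0] := @flat_jet R.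
have [b jb b0] : exists2 b, jet b & b 0%N = fun x : R => flat 1 x * flat 1 (1 - x).
  apply: jet_Ck => n; apply: CkM; first by rewrite -g0; exact: Ck_jet.
  have jg' := jet_affine (-1) 1 jg.
  have -> : (fun x : R => flat 1 (1 - x)) =
            (fun x => (-1) ^+ 0 * g 0%N (-1 * (x - 1))).
    by apply/funext => x; rewrite expr0 mul1r g0 mulN1r opprB.
  exact: (Ck_jet n 0 jg').
have fp (x : R) : 0 < x -> 0 < flat 1 x.
  by move=> x0; rewrite /flat x0 hornerE mul1r expR_gt0.
have fn (x : R) : x <= 0 -> flat 1 x = 0 by move=> x0; rewrite /flat ltNge x0.
have fnn (x : R) : 0 <= flat 1 x.
  by have [/fn ->|/fp/ltW] := leP x 0.
have off : vanishes_off 0 1 b.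
  apply: jet_vanishes => // x; rewrite b0 => /orP[x0|x1].
    by rewrite fn ?mul0r// ltW.
  by rewrite [X in _ * X]fn ?mulr0// subr_le0 ltW.
have bnn x : 0 <= b 0%N x by rewrite b0 mulr_ge0.
have cb : continuous (b 0%N) by exact: jet_continuous.
have bi : mu.-integrable setT (EFin \o b 0%N).
  exact: integrable_continuous_vanishing cb (off 0%N).
have jp := jet_primitive jb off.
set p := primitive (b 0%N) in jp.
have pmono : {homo p : x y / x <= y} by move=> x y xy; exact: primitive_mono.
have p0 x : x < 0 -> p x = 0.
  by apply: primitive_vanish => y y0; apply: off; rewrite y0.
have p1 x : 1 < x -> p x = p 1.
  by apply: primitive_cst => // y y1; apply: off; rewrite y1 orbT.
have c0 : continuous p by exact: (jet_continuous (n := 0%N) jp).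
(* [primitive_vanish] covers x < 0 only; the endpoint is reached by continuity. *)
have p00 : p 0 = 0.
  apply/eqP; rewrite eq_le primitive_ge0// andbT.
  have h : p x @[x --> (0:R)^'-] --> p 0 by apply: cvg_at_left_filter; exact: c0.
  rewrite -(cvg_lim _ h)//; apply: limr_le; first by apply/cvg_ex; exists (p 0).
  by near=> x; rewrite p0//; near: x; exact: nbhs_left_lt.
(* Were p 1 equal to 0, monotonicity would make p vanish on ]0, 1[ and its derivative at 1 / 2 would
   be 0, whereas the integrand is positive there. *)
have p1_gt0 : 0 < p 1.
  rewrite lt_neqAle primitive_ge0// andbT; apply/negP => /eqP p10.
  have pz (x : R) : 0 < x < 1 -> p x = 0.
    case/andP=> _ /ltW/pmono; rewrite -p10 => px0.
    by apply/eqP; rewrite eq_le px0 primitive_ge0.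
  have : b 0%N 2^-1 = 0.
    have d0 : is_derive (2^-1 : R) 1 (cst 0 : R -> R) 0 by exact: is_derive_cst.
    have E : \forall y \near (2^-1 : R), cst 0 y = p y.
      have o : open_nbhs (2^-1 : R) `]0, 1[.
        by split; [exact: itv_open|rewrite /= in_itv/=; lra].
      by apply: filterS (open_nbhs_nbhs o) => y /=; rewrite in_itv/= => /pz ->.
    have dp := jp 0%N 2^-1.
    rewrite -(@derive_val _ _ _ _ _ _ _ dp).
    exact: (@derive_val _ _ _ _ _ _ _ (near_eq_is_derive E d0)).
  rewrite b0 => /eqP; rewrite mulf_eq0.
  by rewrite !gt_eqF//; apply: fp; lra.
exists (fun n x => (p 1)^-1 * (if n is m.+1 then b m else p) x); split.
- exact: jetZ.
- move=> x x0; have -> : p x = 0; last by rewrite mulr0.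
  apply/eqP; rewrite eq_le primitive_ge0// andbT.
  by rewrite -p00; exact: pmono.
- move=> x; rewrite le_eqVlt => /predU1P[<-|/p1 ->]; by rewrite mulVf// gt_eqF.
- by move=> x y xy; rewrite ler_wpM2l ?invr_ge0 ?(ltW p1_gt0)//; exact: pmono.
- move=> x; rewrite mulr_ge0 ?primitive_ge0// ?invr_ge0 ?(ltW p1_gt0)//=.
  rewrite -ler_pdivlMl ?invr_gt0// invrK mulr1.
  have [/pmono//|/p1 -> //] := leP x 1.
Unshelve. all: by end_near. Qed.

End step.

(** * Coordinates, boxes and integration by parts along lines *)

Section coordinates.
Context {R : realType}.
Implicit Types (x y : R * R * R) (i k : 'I_3).
Local Notation leb := (@lebesgue_measure R).
Local Notation leb2 := (@lebesgue2 R).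
Local Notation leb3 := (@lebesgue3 R).

Definition co i x : R := [:: x.1.1; x.1.2; x.2]`_i.

Definition upd i x (t : R) : R * R * R :=
  match val i with 0%N => (t, x.1.2, x.2) | 1%N => (x.1.1, t, x.2) | _ => (x.1, t) end.

Lemma ord3P (P : 'I_3 -> Prop) : P ord0 -> P (@Ordinal 3 1 isT) -> P (@Ordinal 3 2 isT) ->
  forall i, P i.
Proof.
move=> P0 P1 P2 [[|[|[|//]]] lt3].
- by rewrite (_ : Ordinal lt3 = ord0)//; exact: val_inj.
- by rewrite (_ : Ordinal lt3 = Ordinal (isT : 1 < 3)%N)//; exact: val_inj.
- by rewrite (_ : Ordinal lt3 = Ordinal (isT : 2 < 3)%N)//; exact: val_inj.
Qed.

Lemma coordsE x i : coords x i 0 = co i x. Proof. by rewrite mxE. Qed.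

Lemma co_upd i k x t : co k (upd i x t) = if k == i then t else co k x.
Proof. by move: k; elim/ord3P: i => k; elim/ord3P: k. Qed.

Lemma coB i x y : co i (x - y) = co i x - co i y.
Proof. by elim/ord3P: i. Qed.

Lemma measurable_co i : measurable_fun setT (co i).
Proof.
elim/ord3P: i.
- by apply: measurableT_comp; exact: measurable_fst.
- by apply: measurableT_comp; [exact: measurable_snd|exact: measurable_fst].
- exact: measurable_snd.
Qed.

Definition box3 (l r : 'I_3 -> R) : set (R * R * R) :=
  [set x | forall i, l i <= co i x <= r i].

Lemma box3E l r : box3 l r = (`[l ord0, r ord0] `*` `[l (@Ordinal 3 1 isT), r (@Ordinal 3 1 isT)])
   `*` `[l (@Ordinal 3 2 isT), r (@Ordinal 3 2 isT)].
Proof.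
apply/seteqP; split=> [x bx|x [[]]] /=.
  by split; [split|]; exact: bx.
by move=> x0 x1; rewrite in_itv/= => x2; elim/ord3P.
Qed.

Lemma measurable_box3 l r : measurable (box3 l r).
Proof. by rewrite box3E; apply: measurableX => //; exact: measurableX. Qed.

Lemma lebesgue2X (A B : set R) : measurable A -> measurable B ->
  leb2 (A `*` B) = (leb A * leb B)%E.
Proof. by move=> mA mB; exact: product_measure1E. Qed.

Lemma lebesgue3X (A : set (R * R)) (B : set R) : measurable A -> measurable B ->
  leb3 (A `*` B) = (leb2 A * leb B)%E.
Proof. by move=> mA mB; exact: product_measure1E. Qed.

Lemma itv_lty (a b : R) : (leb `[a, b] < +oo)%E.
Proof. by rewrite lebesgue_measure_itv/= -EFinB; case: ifP => _; rewrite ltry. Qed.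

Lemma box2_lty (a b c d : R) : (leb2 (`[a, b] `*` `[c, d]) < +oo)%E.
Proof.
by rewrite lebesgue2X// lte_mul_pinfty ?itv_lty// ge0_fin_numE// itv_lty.
Qed.

Lemma box3_lty l r : (leb3 (box3 l r) < +oo)%E.
Proof.
rewrite box3E lebesgue3X//; last exact: measurableX.
by rewrite lte_mul_pinfty ?itv_lty// ge0_fin_numE ?box2_lty.
Qed.

Lemma integrable_bounded d (T : measurableType d) (m : {measure set T -> \bar R})
    (B : set T) (f : T -> R) (C : R) : measurable B -> (m B < +oo)%E ->
  measurable_fun setT f -> (forall t : T, `|f t| <= C) ->
  (forall t : T, ~ B t -> f t = 0) -> m.-integrable setT (EFin \o f).
Proof.
move=> mB Bfin mf fC f0; have -> : EFin \o f = (EFin \o f) \_ B.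
  by apply/funext => x; rewrite /patch; case: ifPn => //; rewrite notin_setE => /f0 /= ->.
apply/integrable_restrict => //; rewrite setTI.
apply: measurable_bounded_integrable => //; first exact: measurable_funTS.
exists C; split; first exact: num_real.
by move=> M CM x Bx; apply: (le_trans (fC x)); exact: ltW.
Qed.

Lemma integrable_box3 l r (f : R * R * R -> R) C : measurable_fun setT f ->
  (forall x, `|f x| <= C) -> (forall x, ~ box3 l r x -> f x = 0) ->
  leb3.-integrable setT (EFin \o f).
Proof.
exact: (@integrable_bounded _ _ leb3 _ f C (measurable_box3 l r) (box3_lty l r)).
Qed.

(** Fubini, with the i-th variable integrated first. Boundedness and support in a box make f
    integrable on the space, on horizontal planes and on lines, so that any order is available. *)
Lemma Rintegral_slice0 l r (f : R * R * R -> R) (C : R) i : measurable_fun setT f ->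
  (forall x, `|f x| <= C) -> (forall x, ~ box3 l r x -> f x = 0) ->
  (forall x, \int[leb]_t f (upd i x t) = 0) ->
  \int[leb3]_x f x = 0.
Proof.
move=> mf fC f0; have fi := integrable_box3 mf fC f0.
move=> h; rewrite /Rintegral; apply: (congr1 fine (y := 0%E)).
(* Integrability on lines turns the vanishing of the real-valued integral into that of the extended
   one, of which [Rintegral] is only the [fine] part. *)
have {}h x : (\int[leb]_t (f (upd i x t))%:E)%E = 0%E.
  have fxi : leb.-integrable setT (fun t => (f (upd i x t))%:E).
    have mu : measurable_fun setT (upd i x).
      by elim/ord3P: i {h} => /=; apply: measurable_fun_pair => //; exact: measurable_fun_pair.
    apply: (@integrable_bounded _ _ leb `[l i, r i] _ C) => //.
    - exact: itv_lty.
    - exact: measurableT_comp.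
    - move=> t; rewrite /= in_itv/= => nt; apply: f0 => /(_ i); rewrite co_upd eqxx.
      exact: nt.
  by rewrite -[LHS]fineK ?integrable_fin_num//= -[fine _]/(\int[leb]_t f (upd i x t)) h.
have i12 t : leb2.-integrable setT (fun z => (f (z, t))%:E).
  apply: (@integrable_bounded _ _ leb2 (`[l ord0, r ord0] `*` `[l (@Ordinal 3 1 isT), r (@Ordinal 3 1 isT)]) _ C) => //.
  - exact: measurableX.
  - exact: box2_lty.
  - by apply: measurableT_comp => //; exact: measurable_fun_pair.
  - move=> z nx; apply: f0; rewrite box3E => -[h12 _]; exact: nx h12.
have F21 : (\int[leb3]_x (f x)%:E = \int[leb]_t \int[leb2]_z (f (z, t))%:E)%E.
  exact/esym/(@integral21_prod_meas1 _ _ _ _ R leb2 leb (EFin \o f) fi).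
elim/ord3P: i h => h.
- rewrite F21 integral0_eq// => t _.
  rewrite -(@integral21_prod_meas1 _ _ _ _ R leb leb _ (i12 t)).
  by rewrite integral0_eq// => s _; exact: (h (0, s, t)).
- rewrite F21 integral0_eq// => t _.
  rewrite -(@integral12_prod_meas1 _ _ _ _ R leb leb _ (i12 t)).
  by rewrite integral0_eq// => s _; exact: (h (s, 0, t)).
- rewrite -(@integral12_prod_meas1 _ _ _ _ R leb2 leb _ fi).
  by rewrite integral0_eq// => z _; exact: (h (z, 0)).
Qed.

Lemma Rintegral_derive0 (g g' : R -> R) (l r : R) : continuous g' ->
  (forall t, is_derive t (1 : R) g (g' t)) ->
  (forall t, (t < l) || (r < t) -> g t = 0) -> \int[leb]_t g' t = 0.
Proof.
move=> cg' dg g0.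
have g'0 t : (t < l) || (r < t) -> g' t = 0 by exact: derive_vanishes_off (dg t).
have [lr|rl] := leP l r; last first.
  by apply: Rintegral0_eq => t _; apply: g'0; have [//|lt] := ltP t l; rewrite (lt_le_trans rl).
have cg : continuous g.
  by move=> t; apply: differentiable_continuous; apply/derivable1_diffP; exact: ex_derive.
rewrite /Rintegral.
(* Enlarging [l, r] by 1 puts both endpoints where g is known to be 0. *)
have -> : (\int[leb]_t (g' t)%:E = \int[leb]_(t in `[(l - 1)%R, (r + 1)%R]) (g' t)%:E)%E.
  rewrite [RHS]integral_mkcond; apply: eq_integral => t _; rewrite patchE.
  case: ifPn => //; rewrite notin_setE /= in_itv/= => /negP; rewrite negb_and -!ltNge => tlr.
  by rewrite g'0//; apply/orP; case/orP: tlr => ?; [left|right]; lra.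
rewrite (@continuous_FTC2 _ g' g)//.
- have -> : g (r + 1) = 0 by apply: g0; apply/orP; right; lra.
  have -> : g (l - 1) = 0 by apply: g0; apply/orP; left; lra.
  by rewrite subee.
- lra.
- exact: continuous_subspaceT.
- split => //.
  + by apply: cvg_at_right_filter; exact: cg.
  + by apply: cvg_at_left_filter; exact: cg.
- by move=> t _; rewrite derive1E; exact: derive_val.
Qed.

Lemma integrable_Rsum d (S : measurableType d) (m : {measure set S -> \bar R}) n
    (f : 'I_n -> S -> R) : (forall p, m.-integrable setT (EFin \o f p)) ->
  m.-integrable setT (EFin \o (fun s : S => \sum_(p < n) f p s)).
Proof.
move=> fi; have -> : EFin \o (fun s : S => \sum_(p < n) f p s) =
    (fun s => \sum_(p < n) (f p s)%:E)%E by apply/funext => s /=; rewrite sumEFin.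
by apply: integrable_sum => // p _; exact: fi.
Qed.

Lemma Rintegral_sum d (S : measurableType d) (m : {measure set S -> \bar R}) n
    (f : 'I_n -> S -> R) : (forall p, m.-integrable setT (EFin \o f p)) ->
  \int[m]_s (\sum_(p < n) f p s) = \sum_(p < n) \int[m]_s f p s.
Proof.
elim: n f => [|n IH] f fi.
  by rewrite big_ord0; apply: Rintegral0_eq => s _; rewrite big_ord0.
rewrite big_ord_recl -IH// -RintegralD//; last exact: integrable_Rsum.
by apply: eq_Rintegral => s _; rewrite big_ord_recl.
Qed.

Section tensor.
Variables (a : 'I_3 -> nat -> R -> R) (l r : 'I_3 -> R).
Hypothesis ja : forall i, jet (a i).
Hypothesis va : forall i, vanishes_off (l i) (r i) (a i).
Implicit Types m : 'I_3 -> nat.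

(** For jets, the partial derivative of multi-index m of the product of the functions [a i 0];
    [bump_index m i] below raises its order in the i-th variable by one. *)
Definition tensor m x := \prod_(i < 3) a i (m i) (co i x).

Definition bump_index m i : 'I_3 -> nat := fun k => (m k + (k == i))%N.

Lemma tensor_upd m i x t : tensor m (upd i x t) =
  a i (m i) t * \prod_(k < 3 | k != i) a k (m k) (co k x).
Proof.
rewrite /tensor (bigD1 i)//= co_upd eqxx; congr (_ * _).
by apply: eq_bigr => k /negPf ki; rewrite co_upd ki.
Qed.

Lemma is_derive_tensor m i x t :
  is_derive t (1 : R) (fun t => tensor m (upd i x t)) (tensor (bump_index m i) (upd i x t)).
Proof.
have -> : (fun t => tensor m (upd i x t)) =
  (fun t => (\prod_(k < 3 | k != i) a k (m k) (co k x)) * a i (m i) t).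
  by apply/funext => s; rewrite tensor_upd mulrC.
apply: (is_derive_eq (is_deriveZ _ (ja i (m i) t))).
rewrite tensor_upd /bump_index eqxx addn1 mulrC; congr (_ * _).
by apply: eq_bigr => k /negPf ->; rewrite addn0.
Qed.

Lemma measurable_tensor m : measurable_fun setT (tensor m).
Proof.
rewrite /tensor; apply: measurable_prod => i _.
apply: measurableT_comp; last exact: measurable_co.
by apply: continuous_measurable_fun; exact: jet_continuous.
Qed.

Lemma tensor_off m x : ~ box3 l r x -> tensor m x = 0.
Proof.
move=> /existsNP[i /negP]; rewrite negb_and -!ltNge => h.
by rewrite /tensor (bigD1 i)//= va// mul0r.
Qed.

Lemma jet_bounded i n : exists2 C : R, 0 <= C & forall t, `|a i n t| <= C.
Proof.
have : compact (a i n @` `[l i, r i]).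
  apply: continuous_compact; last exact: segment_compact.
  by apply: continuous_subspaceT => t; exact: jet_continuous.
move=> /compact_bounded[C [_ HC]].
exists (`|C| + 1); first by rewrite addr_ge0.
move=> t; have [tlr|/negP] := pselect (l i <= t <= r i).
  apply: (HC (`|C| + 1)); first by rewrite (le_lt_trans (ler_norm _))// ltrDl.
  by exists t => //; rewrite /= in_itv.
by rewrite negb_and -!ltNge => /va ->; rewrite normr0 addr_ge0.
Qed.

Lemma tensor_bounded m : exists2 C : R, 0 <= C & forall x, `|tensor m x| <= C.
Proof.
have /boolp.choice[C HC] : forall i, exists C : R, 0 <= C /\ forall t, `|a i (m i) t| <= C.
  by move=> i; have [C ? ?] := jet_bounded i (m i); exists C.
exists (\prod_(i < 3) C i); first by apply: prodr_ge0 => i _; have [] := HC i.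
move=> x; rewrite /tensor normr_prod; apply: ler_prod => i _.
by rewrite normr_ge0/=; have [_] := HC i.
Qed.

Lemma integrable_tensorM m (K : R * R * R -> R) : measurable_fun setT K ->
  (exists C, forall x, box3 l r x -> `|K x| <= C) ->
  leb3.-integrable setT (fun x => (K x * tensor m x)%:E).
Proof.
move=> mK [C KC]; have [C' C'0 TC'] := tensor_bounded m.
apply: (@integrable_box3 l r _ (`|C| * C')).
- by apply: measurable_funM => //; exact: measurable_tensor.
- move=> x; have [bx|bx] := pselect (box3 l r x); last first.
    by rewrite tensor_off// mulr0 normr0 mulr_ge0.
  by rewrite normrM ler_pM// (le_trans (KC x bx))// ler_norm.
- by move=> x /tensor_off ->; rewrite mulr0.
Qed.

(** The sum of the two integrands is the i-th partial derivative of K times the tensor, whose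
    integral over each line parallel to the i-th axis is 0. *)
Lemma Rintegral_tensor_by_parts m i (K K' : R * R * R -> R) :
  measurable_fun setT K -> measurable_fun setT K' ->
  (exists C, forall x, box3 l r x -> `|K x| <= C) ->
  (exists C, forall x, box3 l r x -> `|K' x| <= C) ->
  (forall x, continuous (fun t => K' (upd i x t))) ->
  (forall x t, is_derive t (1 : R) (fun t => K (upd i x t)) (K' (upd i x t))) ->
  \int[leb3]_x (K' x * tensor m x) = - \int[leb3]_x (K x * tensor (bump_index m i) x).
Proof.
move=> mK mK' bK bK' cK' dK.
have i1 := integrable_tensorM m mK' bK'.
have i2 := integrable_tensorM (bump_index m i) mK bK.
apply/eqP; rewrite -subr_eq0 opprK -RintegralD//; apply/eqP.
have [C KC] := bK; have [C' KC'] := bK'.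
have [D D0 TD] := tensor_bounded m.
have [D' D'0 TD'] := tensor_bounded (bump_index m i).
apply: (@Rintegral_slice0 l r _ (`|C'| * D + `|C| * D') i).
- apply: measurable_funD; apply: measurable_funM => //; exact: measurable_tensor.
- move=> x; have [bx|bx] := pselect (box3 l r x); last first.
    by rewrite !tensor_off// !mulr0 addr0 normr0 addr_ge0// mulr_ge0.
  rewrite (le_trans (ler_normD _ _))// !normrM lerD// ler_pM//.
    by rewrite (le_trans (KC' x bx))// ler_norm.
  by rewrite (le_trans (KC x bx))// ler_norm.
- by move=> x bx; rewrite !tensor_off// !mulr0 addr0.
move=> x; apply: (@Rintegral_derive0 (fun t => K (upd i x t) * tensor m (upd i x t)) _ (l i) (r i)).
- have cT m' : continuous (fun t => tensor m' (upd i x t)).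
    move=> t; apply: differentiable_continuous; apply/derivable1_diffP.
    exact: (@ex_derive _ _ _ _ _ _ _ (is_derive_tensor m' i x t)).
  have cK : continuous (fun t => K (upd i x t)).
    move=> t; apply: differentiable_continuous; apply/derivable1_diffP.
    exact: (@ex_derive _ _ _ _ _ _ _ (dK x t)).
  move=> t.
  exact: (continuousD (continuousM (cK' x t) (cT m t)) (continuousM (cK t) (cT _ t))).
- move=> t; apply: (is_derive_eq (is_deriveM (dK x t) (is_derive_tensor m i x t))).
  by rewrite -![_ *: _]/(_ * _) addrC [X in X + _]mulrC.
- move=> t tlr; rewrite tensor_off ?mulr0// => /(_ i).
  by rewrite co_upd eqxx; apply/negP; rewrite negb_and -!ltNge.
Qed.

End tensor.
End coordinates.

(** * Regularized distance and its derivatives *)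

Section regular.
Context {R : realType}.
Implicit Types (K : R * R * R -> R).

(** Conditions of integration by parts on a kernel, in a form stable under sums and products.
    Continuity is asked along the axes, where the fundamental theorem of calculus is applied. *)
Definition regular K := [/\ measurable_fun setT K,
  forall l r, exists C, forall x, box3 l r x -> `|K x| <= C &
  forall i x, continuous (fun t => K (upd i x t))].

Lemma regularD K K' : regular K -> regular K' -> regular (fun x => K x + K' x).
Proof.
move=> [mK bK cK] [mK' bK' cK']; split.
- exact: measurable_funD.
- move=> l r; have [C HC] := bK l r; have [C' HC'] := bK' l r.
  exists (C + C') => x bx; rewrite (le_trans (ler_normD _ _))// lerD//; first exact: HC.
  exact: HC'.
- by move=> i x t; exact: (continuousD (cK i x t) (cK' i x t)).
Qed.

Lemma regularM K K' : regular K -> regular K' -> regular (fun x => K x * K' x).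
Proof.
move=> [mK bK cK] [mK' bK' cK']; split.
- exact: measurable_funM.
- move=> l r; have [C HC] := bK l r; have [C' HC'] := bK' l r.
  exists (C * C') => x bx; rewrite normrM ler_pM//; first exact: HC.
  exact: HC'.
- by move=> i x t; exact: (continuousM (cK i x t) (cK' i x t)).
Qed.

Lemma regular_cst (k : R) : regular (fun=> k).
Proof. by split => // [l r|i x t]; [exists (`|k|) | exact: cvg_cst]. Qed.

Lemma regularZ (k : R) K : regular K -> regular (fun x => k * K x).
Proof. by move=> rK; apply: regularM => //; exact: regular_cst. Qed.

Lemma regularX n K : regular K -> regular (fun x => K x ^+ n).
Proof.
move=> rK; elim: n => [|n IH]; first exact: regular_cst.
have -> : (fun x => K x ^+ n.+1) = (fun x => K x * K x ^+ n).
  by apply/funext => x; rewrite exprS.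
exact: regularM.
Qed.

Lemma regular_sum n (K : 'I_n -> R * R * R -> R) : (forall k, regular (K k)) ->
  regular (fun x => \sum_(k < n) K k x).
Proof.
move=> rK; elim: n K rK => [|n IH] K rK.
  by under eq_fun do rewrite big_ord0; exact: regular_cst.
by under eq_fun do rewrite big_ord_recl; apply: regularD => //; exact: IH.
Qed.

End regular.

Section regularized_distance.
Context {R : realType}.
Variables (y : R * R * R) (e : R).
Hypothesis e0 : 0 < e.
Implicit Types (x : R * R * R) (i k : 'I_3).

Definition off k x : R := co k x - co k y.
Definition qd x : R := \sum_(k < 3) off k x ^+ 2 + e ^+ 2.
Definition rd x : R := Num.sqrt (qd x).
Definition ri x : R := (rd x)^-1.

Lemma qd_gt0 x : 0 < qd x.
Proof. by rewrite /qd ltr_wpDl ?exprn_gt0// sumr_ge0// => k _; rewrite sqr_ge0. Qed.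

Lemma rd_gt0 x : 0 < rd x. Proof. by rewrite sqrtr_gt0 qd_gt0. Qed.

Lemma ri_gt0 x : 0 < ri x. Proof. by rewrite invr_gt0 rd_gt0. Qed.

Lemma sqr_ri x : ri x ^+ 2 = (qd x)^-1.
Proof. by rewrite /ri exprVn sqr_sqrtr// ltW// qd_gt0. Qed.

Lemma qdri2 x : qd x * ri x ^+ 2 = 1.
Proof. by rewrite sqr_ri divff// gt_eqF// qd_gt0. Qed.

Lemma ri_le x : ri x <= e^-1.
Proof.
rewrite /ri lef_pV2 ?posrE ?rd_gt0// -[leLHS]ger0_norm ?(ltW e0)// -sqrtr_sqr.
by rewrite ler_wsqrtr// lerDr sumr_ge0// => k _; rewrite sqr_ge0.
Qed.

(** [off k x * ri x] is the k-th partial derivative of [rd], so this bounds its gradient uniformly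
    in y and e. *)
Lemma norm_offri k x : `|off k x * ri x| <= 1.
Proof.
rewrite -sqrtr_sqr -[leRHS]sqrtr1 ler_wsqrtr// exprMn sqr_ri ler_pdivrMr ?qd_gt0// mul1r.
rewrite /qd (bigD1 k)//= -addrA lerDl addr_ge0 ?sqr_ge0// sumr_ge0// => j _.
by rewrite sqr_ge0.
Qed.

Lemma is_derive_off i k x t :
  is_derive t (1 : R) (fun t => off k (upd i x t)) (k == i)%:R.
Proof.
rewrite /off; under eq_fun do rewrite co_upd.
case: (k == i) => /=.
  by apply: is_derive_eq; rewrite subr0.
by apply: is_derive_eq.
Qed.

Lemma is_derive_qd i x t :
  is_derive t (1 : R) (fun t => qd (upd i x t)) (2 * off i (upd i x t)).
Proof.
pose S := \sum_(k < 3 | k != i) off k x ^+ 2 + e ^+ 2.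
have E s : qd (upd i x s) = off i (upd i x s) ^+ 2 + S.
  rewrite /qd (bigD1 i)//= -addrA; congr (_ + (_ + _)).
  by apply: eq_bigr => k /negPf ki; rewrite /off co_upd ki.
under eq_fun do rewrite E.
have d := is_deriveX 2 (is_derive_off i i x t).
apply: (is_derive_eq (is_deriveD d (is_derive_cst S t 1))).
by rewrite addr0 eqxx -![_ *: _]/(_ * _) expr1 mulr1 mulr_natl.
Qed.

Lemma is_derive_rd i x t :
  is_derive t (1 : R) (fun t => rd (upd i x t)) (off i (upd i x t) * ri (upd i x t)).
Proof.
have ds := is_derive1_sqrt (qd_gt0 (upd i x t)).
have d := @is_derive1_comp _ Num.sqrt (fun t => qd (upd i x t)) t _ _ ds (is_derive_qd i x t).
apply: (is_derive_eq d); rewrite -/(rd _) /ri invfM.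
by rewrite mulrACA mulVf ?pnatr_eq0// mul1r mulrC.
Qed.

Lemma is_derive_ri i x t :
  is_derive t (1 : R) (fun t => ri (upd i x t)) (- (off i (upd i x t) * ri (upd i x t) ^+ 3)).
Proof.
have d := @is_deriveV _ (fun t => rd (upd i x t)) t _ _ (lt0r_neq0 (rd_gt0 _)) (is_derive_rd i x t).
apply: (is_derive_eq d).
rewrite -[_ *: _]/(_ * _) mulNr -exprVn -/(ri _); ring.
Qed.

Lemma is_derive_offri i k x t :
  is_derive t (1 : R) (fun t => off k (upd i x t) * ri (upd i x t))
   ((k == i)%:R * ri (upd i x t) - off k (upd i x t) * off i (upd i x t) * ri (upd i x t) ^+ 3).
Proof.
apply: (is_derive_eq (is_deriveM (is_derive_off i k x t) (is_derive_ri i x t))).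
rewrite -![_ *: _]/(_ * _); ring.
Qed.

Lemma is_derive_offri3 i x t :
  is_derive t (1 : R) (fun t => off i (upd i x t) * ri (upd i x t) ^+ 3)
   (ri (upd i x t) ^+ 3 - 3 * (off i (upd i x t) ^+ 2 * ri (upd i x t) ^+ 5)).
Proof.
apply: (is_derive_eq (is_deriveM (is_derive_off i i x t) (is_deriveX 3 (is_derive_ri i x t)))).
rewrite eqxx -![_ *: _]/(_ * _) /=.
have -> : ((fun s : R => ri (upd i x s)) ^+ 3) t = ri (upd i x t) ^+ 3 by [].
ring.
Qed.

Lemma derive_continuous (f f' : R -> R) : (forall t, is_derive t (1 : R) f (f' t)) ->
  continuous f.
Proof.
move=> df t; apply: differentiable_continuous; apply/derivable1_diffP.
exact: (@ex_derive _ _ _ _ _ _ _ (df t)).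
Qed.

Lemma measurable_off k : measurable_fun setT (off k).
Proof. by apply: measurable_funB => //; exact: measurable_co. Qed.

Lemma measurable_qd : measurable_fun setT qd.
Proof.
apply: measurable_funD => //; apply: measurable_sum => k.
by apply: measurable_funX; exact: measurable_off.
Qed.

Lemma measurable_sqrt : measurable_fun setT (@Num.sqrt R).
Proof. by apply: continuous_measurable_fun; exact: sqrt_continuous. Qed.

(** Inversion is not continuous at 0. Writing it as x (x^2)^(-1) reduces it to a real power, and at
    0 both sides are 0. *)
Lemma measurable_inv : measurable_fun setT (@GRing.inv R).
Proof.
have -> : @GRing.inv R = fun x : R => x * (x ^+ 2) `^ (-1).
  apply/funext => x; have [->|x0] := eqVneq x 0; first by rewrite invr0 mul0r.
  by rewrite powR_inv1 ?sqr_ge0// expr2 invfM mulrA mulfV// mul1r.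
have m2 : measurable_fun setT (fun x : R => x ^+ 2) by exact: exprn_measurable.
apply: measurable_funM => //; exact: (measurableT_comp (measurable_powR (-1)) m2).
Qed.

Lemma regular_off k : regular (off k).
Proof.
split; first exact: measurable_off.
- move=> l r; exists (`|l k| + `|r k| + `|co k y|) => x /(_ k) /andP[lx xr].
  rewrite /off (le_trans (ler_normB _ _))// lerD2r ler_norml; apply/andP; split.
    rewrite (le_trans _ lx)// lerNl (le_trans (ler_norm _))// normrN lerDl//.
  by rewrite (le_trans xr)// (le_trans (ler_norm _))// lerDr.
- by move=> i x; exact: derive_continuous (is_derive_off i k x).
Qed.

Lemma regular_ri : regular ri.
Proof.
split.
- apply: (measurableT_comp measurable_inv); apply: (measurableT_comp measurable_sqrt).
  exact: measurable_qd.
- by move=> l r; exists e^-1 => x _; rewrite gtr0_norm ?ri_gt0// ri_le.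
- by move=> i x; exact: derive_continuous (is_derive_ri i x).
Qed.

Lemma regular_rd : regular rd.
Proof.
(* As s = s^2 / s, regularity of s follows from that of the offsets and of 1 / s. *)
have -> : rd = fun x => (\sum_(k < 3) off k x ^+ 2 + e ^+ 2) * ri x.
  apply/funext => x; rewrite -/(qd x) /ri -[qd x]sqr_sqrtr ?(ltW (qd_gt0 x))// expr2 -/(rd x).
  by rewrite mulfK// gt_eqF// rd_gt0.
apply: regularM regular_ri; apply: regularD; last exact: regular_cst.
by apply: regular_sum => k; apply: regularX; exact: regular_off.
Qed.

End regularized_distance.

(** * The Lame operator applied to the regularized Kelvin tensor *)

Section regularized_identity.
Context {R : realType}.
Variables (a : 'I_3 -> nat -> R -> R) (l r : 'I_3 -> R).
Hypothesis ja : forall i, jet (a i).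
Hypothesis va : forall i, vanishes_off (l i) (r i) (a i).
Variables (y : R * R * R) (e : R).
Hypothesis e0 : 0 < e.
Implicit Types (K : R * R * R -> R) (m : 'I_3 -> nat) (i j k : 'I_3).

Local Notation leb3 := (@lebesgue3 R).
Local Notation T := (tensor a).
Local Notation ri := (ri y e).
Local Notation rd := (rd y e).
Local Notation off := (off y).
Local Notation "m .^ i" := (bump_index m i) (at level 20, left associativity).

(** Derivatives of K in the sense of distributions are encoded by the index: up to sign, this pairs
    the m-th derivative of K with the product function. *)
Definition pairing K m : R := \int[leb3]_x (K x * T m x).
Local Notation J := pairing.

Lemma bump_indexC m i j : m .^ i .^ j = m .^ j .^ i.
Proof. by apply/funext => k; rewrite /bump_index addnAC. Qed.

Lemma integrable_pairing K m : regular K ->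
  leb3.-integrable setT (fun x => (K x * T m x)%:E).
Proof. by move=> [mK bK cK]; exact: (integrable_tensorM ja va). Qed.

Lemma pairingD K K' m : regular K -> regular K' ->
  J (fun x => K x + K' x) m = J K m + J K' m.
Proof.
move=> rK rK'; rewrite /J -RintegralD//; [|exact: integrable_pairing..].
by apply: eq_Rintegral => x _; rewrite mulrDl.
Qed.

Lemma pairingZ (c : R) K m : regular K -> J (fun x => c * K x) m = c * J K m.
Proof.
move=> rK; rewrite /J -RintegralZl//; last exact: integrable_pairing.
by apply: eq_Rintegral => x _; rewrite mulrA.
Qed.

Lemma pairing_sum n (K : 'I_n -> R * R * R -> R) m : (forall p : 'I_n, regular (K p)) ->
  J (fun x => \sum_(p < n) K p x) m = \sum_(p < n) J (K p) m.
Proof.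
move=> rK; rewrite /J -Rintegral_sum; last by move=> p; exact: integrable_pairing.
by apply: eq_Rintegral => x _; rewrite mulr_suml.
Qed.

Lemma pairing_by_parts K K' m i : regular K -> regular K' ->
  (forall x t, is_derive t (1 : R) (fun t => K (upd i x t)) (K' (upd i x t))) ->
  J K' m = - J K (m .^ i).
Proof.
by move=> [mK bK cK] [mK' bK' cK'] dK; exact: (Rintegral_tensor_by_parts ja va).
Qed.

Lemma regular_offri k : regular (fun x => off k x * ri x).
Proof. by apply: regularM; [exact: regular_off|exact: regular_ri]. Qed.

Lemma regular_offri3 k : regular (fun x => off k x * ri x ^+ 3).
Proof. by apply: regularM; [exact: regular_off|apply: regularX; exact: regular_ri]. Qed.

Lemma regular_offoffri3 i k : regular (fun x => off k x * off i x * ri x ^+ 3).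
Proof.
by apply: regularM; [apply: regularM; exact: regular_off|apply: regularX; exact: regular_ri].
Qed.

(** The Hessian of s is delta_ki / s - (x - y)_k (x - y)_i / s^3; both derivatives of s are moved
    onto the tensor. *)
Lemma pairing_hessian_rd i k m :
  J (fun x => off k x * off i x * ri x ^+ 3) m = (k == i)%:R * J ri m - J rd (m .^ i .^ k).
Proof.
have rri := regular_ri y e0.
have E : J (fun x => (k == i)%:R * ri x + (-1) * (off k x * off i x * ri x ^+ 3)) m =
         J rd (m .^ i .^ k).
  have -> : J rd (m .^ i .^ k) = - J (fun x => off k x * ri x) (m .^ i).
    have dr x t := is_derive_rd y e0 k x t.
    by rewrite (pairing_by_parts (m .^ i) (regular_rd y e0) (regular_offri k) dr) opprK.
  apply: (@pairing_by_parts (fun x => off k x * ri x)).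
  - exact: regular_offri.
  - apply: regularD; first exact: regularZ.
    by apply: regularZ; exact: regular_offoffri3.
  - move=> x t; rewrite mulN1r; exact: is_derive_offri.
rewrite -E pairingD ?pairingZ//; first by ring.
- exact: regular_offoffri3.
- exact: regularZ.
- by apply: regularZ; exact: regular_offoffri3.
Qed.

Lemma sum_sqr_off x : \sum_(k < 3) off k x ^+ 2 = qd y e x - e ^+ 2.
Proof. by rewrite /qd addrK. Qed.

(** Trace of the Hessian of s: as |x - y|^2 = s^2 - e^2, it is 3 / s - (s^2 - e^2) / s^3 = 2 / s +
    e^2 / s^3. *)
Lemma pairing_laplace_rd m :
  \sum_(i < 3) J rd (m .^ i .^ i) = 2 * J ri m + e ^+ 2 * J (fun x => ri x ^+ 3) m.
Proof.
have rri := regular_ri y e0.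
have -> : \sum_(i < 3) J rd (m .^ i .^ i) =
    3 * J ri m - \sum_(i < 3) J (fun x => off i x * off i x * ri x ^+ 3) m.
  under [in RHS]eq_bigr => i _ do rewrite pairing_hessian_rd eqxx mul1r.
  by rewrite sumrB sumr_const card_ord -[J ri m *+ 3]mulr_natl subKr.
rewrite -pairing_sum; last by move=> i; exact: regular_offoffri3.
have -> : (fun x => \sum_(i < 3) off i x * off i x * ri x ^+ 3) =
          (fun x => ri x + - e ^+ 2 * ri x ^+ 3).
  apply/funext => x; rewrite -mulr_suml; under eq_bigr do rewrite -expr2.
  rewrite sum_sqr_off mulrBl mulNr; congr (_ - _).
  by rewrite exprS mulrCA qdri2// mulr1.
rewrite pairingD// ?pairingZ//; try exact: regularX; last by apply: regularZ; exact: regularX.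
by ring.
Qed.

(** The gradient of 1 / s is -(x - y) / s^3, whose divergence is -3 / s^3 + 3 (s^2 - e^2) / s^5 = -3
    e^2 / s^5. *)
Lemma pairing_laplace_ri m :
  \sum_(i < 3) J ri (m .^ i .^ i) = - (3 * e ^+ 2) * J (fun x => ri x ^+ 5) m.
Proof.
have rri := regular_ri y e0.
have rri3 := regularX 3 rri.
have rri5 := regularX 5 rri.
have r5 i : regular (fun x => off i x ^+ 2 * ri x ^+ 5).
  by apply: regularM => //; apply: regularX; exact: regular_off.
have E i : J ri (m .^ i .^ i) = - J (fun x => ri x ^+ 3 + (-3) * (off i x ^+ 2 * ri x ^+ 5)) m.
  have d3 x t : is_derive t (1 : R) (fun t => off i (upd i x t) * ri (upd i x t) ^+ 3)
      (ri (upd i x t) ^+ 3 + (-3) * (off i (upd i x t) ^+ 2 * ri (upd i x t) ^+ 5)).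
    by rewrite mulNr; exact: is_derive_offri3.
  have d1 x t : is_derive t (1 : R) (fun t => ri (upd i x t))
      ((-1) * (off i (upd i x t) * ri (upd i x t) ^+ 3)).
    by rewrite mulN1r; exact: is_derive_ri.
  have r3 := regular_offri3 i.
  have r3' : regular (fun x => ri x ^+ 3 + (-3) * (off i x ^+ 2 * ri x ^+ 5)).
    by apply: regularD => //; exact: regularZ.
  rewrite (pairing_by_parts m r3 r3' d3) opprK.
  have := pairing_by_parts (m .^ i) rri (regularZ (-1) r3) d1.
  by rewrite pairingZ// mulN1r => /oppr_inj.
under eq_bigr do rewrite E.
rewrite sumrN -pairing_sum; last first.
  by move=> i; apply: regularD => //; apply: regularZ.
rewrite -pairingZ// -[LHS]mulN1r -pairingZ; last first.
  by apply: regular_sum => i; apply: regularD => //; exact: regularZ.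
congr J; apply/funext => x.
rewrite big_split/= sumr_const card_ord -mulr_sumr -mulr_suml sum_sqr_off mulrBl.
have -> : qd y e x * ri x ^+ 5 = ri x ^+ 3.
  by rewrite -[5%N]/(2 + 3)%N exprD mulrA qdri2// mul1r.
by ring.
Qed.

(* [Kelvin (x - y)] with general coefficients and [|x - y|] replaced by [rd x]. *)
Definition Kelvin_reg (al be : R) k i x : R :=
  al * (k == i)%:R * ri x + be * (off k x * off i x * ri x ^+ 3).

Lemma regular_Kelvin_reg al be k i : regular (Kelvin_reg al be k i).
Proof.
apply: regularD; apply: regularZ; last exact: regular_offoffri3.
exact: regular_ri.
Qed.

(* The [i]-th component of the Lame operator applied to [T m e_j], where [e_j] is
   the [j]-th basis vector. *)
Definition lame (lambda mu : R) j m i x : R :=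
  mu * (i == j)%:R * (\sum_(p < 3) T (m .^ p .^ p) x) + (lambda + mu) * T (m .^ i .^ j) x.

Lemma pairing_lame K lambda mu j m i : regular K ->
  \int[leb3]_x (K x * lame lambda mu j m i x) =
  mu * (i == j)%:R * \sum_(p < 3) J K (m .^ p .^ p) + (lambda + mu) * J K (m .^ i .^ j).
Proof.
move=> rK.
have iK p : leb3.-integrable setT (EFin \o (fun x => K x * T (m .^ p .^ p) x)).
  exact: integrable_pairing.
have i1 := integrable_Rsum iK.
rewrite -(Rintegral_sum iK).
have i2 := integrable_pairing (m .^ i .^ j) rK.
rewrite -!RintegralZl// -RintegralD//.
- apply: eq_Rintegral => x _.
  by rewrite /lame mulrDr mulrCA (mulrCA (K x) (lambda + mu)) mulr_sumr.
- exact: (integrableZl _ (mu * (i == j)%:R) i1).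
- exact: (integrableZl _ (lambda + mu) i2).
Qed.

(** The hypothesis says that the coefficient of d_j d_k (1 / s) is 0: the grad-div part contributes
    (al + be) (lambda + mu), and the Laplacian of s, met in both parts of the operator, -2 be
    (lambda + 2 mu). *)
Lemma regularized_fundamental_solution (lambda mu al be : R) j k m :
  (al + be) * (lambda + mu) = 2 * be * (lambda + 2 * mu) ->
  \sum_(i < 3) \int[leb3]_x (Kelvin_reg al be k i x * lame lambda mu j m i x) =
  - ((al + be) * mu * (k == j)%:R * (3 * e ^+ 2)) * J (fun x => ri x ^+ 5) m
  - be * (lambda + 2 * mu) * e ^+ 2 * J (fun x => ri x ^+ 3) (m .^ j .^ k).
Proof.
move=> ab.
rewrite (eq_bigr _ (fun i _ => pairing_lame lambda mu j m i (regular_Kelvin_reg al be k i))).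
(* Trading the term in 1 / s^3 for the Hessian of s shifts its weight be onto delta_ki / s. *)
have JK i m' : J (Kelvin_reg al be k i) m' =
    (al + be) * (k == i)%:R * J ri m' - be * J rd (m' .^ i .^ k).
  have rri := regular_ri y e0.
  have r3 := regular_offoffri3 i k.
  have r1 := regularZ (al * (k == i)%:R) rri.
  rewrite /Kelvin_reg (pairingD m' r1 (regularZ be r3)) (pairingZ _ _ rri).
  by rewrite (pairingZ _ _ r3) pairing_hessian_rd; ring.
rewrite big_split/=.
have -> : \sum_(i < 3) mu * (i == j)%:R * (\sum_(p < 3) J (Kelvin_reg al be k i) (m .^ p .^ p)) =
   mu * \sum_(p < 3) J (Kelvin_reg al be k j) (m .^ p .^ p).
  rewrite (bigD1 j)//= eqxx mulr1 [X in _ + X]big1 ?addr0// => i /negPf ->.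
  by rewrite mulr0 mul0r.
have -> : \sum_(p < 3) J (Kelvin_reg al be k j) (m .^ p .^ p) =
    (al + be) * (k == j)%:R * (- (3 * e ^+ 2) * J (fun x => ri x ^+ 5) m) -
    be * (2 * J ri (m .^ j .^ k) + e ^+ 2 * J (fun x => ri x ^+ 3) (m .^ j .^ k)).
  under eq_bigr do rewrite JK.
  rewrite sumrB -!mulr_sumr pairing_laplace_ri -pairing_laplace_rd.
  congr (_ - _ * _); apply: eq_bigr => i _; congr J.
  by rewrite (bump_indexC _ i j) (bump_indexC _ i k) (bump_indexC m i j) (bump_indexC _ i k).
have -> : \sum_(i < 3) (lambda + mu) * J (Kelvin_reg al be k i) (m .^ i .^ j) =
  (lambda + mu) * ((al + be) * J ri (m .^ j .^ k) - be * (2 * J ri (m .^ j .^ k)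
     + e ^+ 2 * J (fun x => ri x ^+ 3) (m .^ j .^ k))).
  rewrite -mulr_sumr; congr (_ * _).
  under eq_bigr do rewrite JK.
  rewrite sumrB -mulr_sumr; congr (_ - _ * _).
    rewrite (bigD1 k)//= eqxx mulr1 [X in _ + X]big1 ?addr0 ?(bump_indexC _ j k)// => i.
    by rewrite eq_sym => /negPf ->; rewrite mulr0 mul0r.
  rewrite -pairing_laplace_rd; apply: eq_bigr => i _; congr J.
  by rewrite (bump_indexC _ i k) (bump_indexC _ i j) (bump_indexC _ i k).
set N := J ri _; set S3 := J _ (m .^ j .^ k); set S5 := J _ m.
transitivity (- ((al + be) * mu * (k == j)%:R * (3 * e ^+ 2)) * S5
  + ((al + be) * (lambda + mu) - 2 * be * (lambda + 2 * mu)) * N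
  - be * (lambda + 2 * mu) * e ^+ 2 * S3); first by ring.
by rewrite ab subrr mul0r addr0.
Qed.

End regularized_identity.

(** * Lebesgue measure under dilations *)

Section affine.
Context {R : realType}.
Local Notation leb := (@lebesgue_measure R).
Local Notation leb2 := (@lebesgue2 R).
Local Notation leb3 := (@lebesgue3 R).
Variable e : R.
Hypothesis e0 : 0 < e.

Lemma measurable_affine1 (c : R) : measurable_fun setT (fun t : R => c + e * t).
Proof. by apply: measurable_funD => //; exact: mulrl_measurable. Qed.

(** Uniqueness of Lebesgue measure: the scaled pushforward agrees with it on the intervals ]a,
    b]. *)
Lemma lebesgue_affine (c : R) (A : set R) : measurable A ->
  leb A = (e%:E * leb ((fun t => (c + e * t)%R) @^-1` A))%E.
Proof.
move=> mA.
pose f : measurableTypeR R -> measurableTypeR R := fun t => c + e * t.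
have mf : measurable_fun setT f by exact: measurable_affine1.
pose p := measure_function_pushforward__canonical__measure_function_Measure leb mf.
pose m : {measure set (measurableTypeR R) -> \bar R} := mscale (NngNum (ltW e0)) p.
apply: (@lebesgue_measure_unique R m) => // _ [[a b]] _ <-.
change (leb `]a, b] = (e%:E * leb (f @^-1` `]a, b]))%E).
have -> : f @^-1` `]a, b] = `](a - c) / e, (b - c) / e]%classic.
  apply/seteqP; split=> t; rewrite /f /= !in_itv/= ltr_pdivrMr// ler_pdivlMr//.
    by move=> /andP[? ?]; apply/andP; split; lra.
  by move=> /andP[? ?]; apply/andP; split; lra.
rewrite !lebesgue_measure_itv/= !lte_fin ltr_pM2r ?invr_gt0// ltrD2r.
case: ifP => _; last by rewrite mule0.
by rewrite -!EFinB -EFinM; congr EFin; field; rewrite gt_eqF.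
Qed.

End affine.

Section affine3.
Context {R : realType}.
Local Notation leb := (@lebesgue_measure R).
Local Notation leb2 := (@lebesgue2 R).
Local Notation leb3 := (@lebesgue3 R).
Variables (y : R * R * R) (e : R).
Hypothesis e0 : 0 < e.

Definition dilate2 (w : R * R) : R * R := (y.1.1 + e * w.1, y.1.2 + e * w.2).
Definition dilate (w : R * R * R) : R * R * R := (dilate2 w.1, y.2 + e * w.2).

Lemma co_dilate i w : co i (dilate w) = co i y + e * co i w.
Proof. by elim/ord3P: i. Qed.

Lemma measurable_dilate2 : measurable_fun setT dilate2.
Proof.
by apply: measurable_fun_pair; apply: (measurableT_comp (measurable_affine1 _ _));
  [exact: measurable_fst|exact: measurable_snd].
Qed.

Lemma measurable_dilate : measurable_fun setT dilate.
Proof.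
apply: measurable_fun_pair.
  by apply: (measurableT_comp measurable_dilate2); exact: measurable_fst.
by apply: (measurableT_comp (measurable_affine1 _ _)); exact: measurable_snd.
Qed.

(** Uniqueness of the product measure: rectangles pull back to rectangles, and each side contributes
    a factor e. *)
Lemma lebesgue2_dilate (A : set (R * R)) : measurable A ->
  leb2 A = ((e ^+ 2)%:E * leb2 (dilate2 @^-1` A))%E.
Proof.
move=> mA.
have md : measurable_fun (T := (measurableTypeR R * measurableTypeR R)%type)
    (U := (measurableTypeR R * measurableTypeR R)%type) setT dilate2 by exact: measurable_dilate2.
pose p := measure_function_pushforward__canonical__measure_function_Measure leb2 md.
pose m : {measure set (measurableTypeR R * measurableTypeR R) -> \bar R} := mscale (NngNum (exprn_ge0 2 (ltW e0))) p.
suff H : (leb \x leb)%E A = m A by exact: H.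
apply: (@product_measure_unique _ _ _ _ R leb leb m) => // B C mB mC.
change ((e ^+ 2)%:E * leb2 (dilate2 @^-1` (B `*` C)) = leb B * leb C)%E.
rewrite (lebesgue_affine e0 y.1.1 mB) (lebesgue_affine e0 y.1.2 mC).
have -> : dilate2 @^-1` (B `*` C) =
  ((fun t => y.1.1 + e * t) @^-1` B) `*` ((fun t => y.1.2 + e * t) @^-1` C) by [].
rewrite lebesgue2X; first by rewrite muleACA -EFinM.
- by rewrite -[X in measurable X]setTI; exact: measurable_affine1.
- by rewrite -[X in measurable X]setTI; exact: measurable_affine1.
Qed.

Lemma lebesgue3_dilate (A : set (R * R * R)) : measurable A ->
  leb3 A = ((e ^+ 3)%:E * leb3 (dilate @^-1` A))%E.
Proof.
move=> mA.
have md : measurable_fun (T := (measurableTypeR R * measurableTypeR R * measurableTypeR R)%type)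
    (U := (measurableTypeR R * measurableTypeR R * measurableTypeR R)%type) setT dilate.
  exact: measurable_dilate.
pose p := measure_function_pushforward__canonical__measure_function_Measure leb3 md.
pose m : {measure set (measurableTypeR R * measurableTypeR R * measurableTypeR R) -> \bar R} := mscale (NngNum (exprn_ge0 3 (ltW e0))) p.
suff H : (leb2 \x leb)%E A = m A by exact: H.
apply: product_measure_unique => // B C mB mC.
change ((e ^+ 3)%:E * leb3 (dilate @^-1` (B `*` C)) = leb2 B * leb C)%E.
rewrite (lebesgue2_dilate mB) (lebesgue_affine e0 y.2 mC).
have -> : dilate @^-1` (B `*` C) = (dilate2 @^-1` B) `*` ((fun t => y.2 + e * t) @^-1` C) by [].
rewrite lebesgue3X; first by rewrite muleACA -EFinM -exprSr.
- by rewrite -[X in measurable X]setTI; exact: measurable_dilate2.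
- by rewrite -[X in measurable X]setTI; exact: measurable_affine1.
Qed.

Lemma ge0_integral_dilate (f : R * R * R -> \bar R) : measurable_fun setT f ->
  (forall x, (0 <= f x)%E) ->
  (\int[leb3]_x f x = (e ^+ 3)%:E * \int[leb3]_w f (dilate w))%E.
Proof.
move=> mf f0.
have md : measurable_fun (T := (measurableTypeR R * measurableTypeR R * measurableTypeR R)%type)
    (U := (measurableTypeR R * measurableTypeR R * measurableTypeR R)%type) setT dilate.
  exact: measurable_dilate.
have mf' : measurable_fun (T := (measurableTypeR R * measurableTypeR R * measurableTypeR R)%type)
    setT f by exact: mf.
pose p := measure_function_pushforward__canonical__measure_function_Measure leb3 md.
have Hd : forall A, measurable A -> leb3 A = ((e ^+ 3)%:E * leb3 (dilate @^-1` A))%E.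
  exact: lebesgue3_dilate.
move: (e ^+ 3) (exprn_ge0 3 (ltW e0)) Hd => c3 c30 Hd.
pose k := NngNum c30.
have H1 : (\int[leb3]_x f x = \int[mscale k p]_x f x)%E.
  by apply: eq_measure_integral => A mA _; exact (Hd A mA).
have E2 := @ge0_integral_mscale _ _ R p setT measurableT k f mf' (fun x _ => f0 x).
have E := ge0_integral_pushforward md leb3 measurableT mf' (fun y _ => f0 y).
rewrite preimage_setT in E.
rewrite H1.
refine (etrans E2 _).
exact (congr1 (fun z => (c3%:E * z)%E) E).
Qed.

Lemma Rintegral_dilate (f : R * R * R -> R) : measurable_fun setT f ->
  \int[leb3]_x f x = e ^+ 3 * \int[leb3]_w f (dilate w).
Proof.
move=> mf; rewrite /Rintegral.
have mfE : measurable_fun setT (EFin \o f) by exact/measurable_EFinP.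
have -> : (\int[leb3]_x (f x)%:E = (e ^+ 3)%:E * \int[leb3]_w (f (dilate w))%:E)%E.
  rewrite integralE (ge0_integral_dilate (measurable_funepos mfE))//.
  rewrite (ge0_integral_dilate (measurable_funeneg mfE))//.
  rewrite [in RHS]integralE.
  (* The integrals of the positive and negative parts may be infinite, so distributivity goes by
     cases, +oo - +oo included. *)
  have mulB (u v : \bar R) : (0 <= u -> 0 <= v ->
      (e ^+ 3)%:E * u - (e ^+ 3)%:E * v = (e ^+ 3)%:E * (u - v))%E.
    move: u v => [u| |] [v| |]// _ _.
    - exact: (congr1 EFin (esym (mulrBr _ _ _))).
    - by rewrite gt0_muley ?lte_fin ?exprn_gt0// gt0_muleNy ?lte_fin ?exprn_gt0.
    - by rewrite gt0_muley ?lte_fin ?exprn_gt0.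
    - by rewrite gt0_muley ?lte_fin ?exprn_gt0//= gt0_muleNy ?lte_fin ?exprn_gt0.
  rewrite mulB.
  - congr (_ * (_ - _))%E; apply: eq_integral => w _; by rewrite ?funeposE ?funenegE.
  - by apply: integral_ge0 => w _; exact: funepos_ge0.
  - by apply: integral_ge0 => w _; exact: funeneg_ge0.
(* When the integral is infinite, both sides take the value 0 of [fine]. *)
case: (\int[leb3]_w (f (dilate w))%:E)%E => [s|/=|/=]; first by rewrite -EFinM.
  by rewrite gt0_muley ?lte_fin ?exprn_gt0//= mulr0.
by rewrite gt0_muleNy ?lte_fin ?exprn_gt0//= mulr0.
Qed.

End affine3.

(** * Smooth trapezoids and cutoff functions *)

Section trapezoid.
Context {R : realType}.

(** Difference of two steps of width 1 / n starting at p and at q. As n grows it tends to the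
    indicator function of ]p, q], which is why half-open boxes appear later. *)
Lemma smooth_trapezoid : exists t : R -> R -> R -> nat -> R -> R, forall n p q,
  0 < n -> p <= q ->
  [/\ jet (t n p q), vanishes_off p (q + n^-1) (t n p q),
      forall x, 0 <= t n p q 0%N x <= 1,
      forall x, p + n^-1 <= x -> x <= q -> t n p q 0%N x = 1 &
      (forall x, x <= p -> t n p q 0%N x = 0) /\
      (forall x, q + n^-1 <= x -> t n p q 0%N x = 0)].
Proof.
have [a [ja a0 a1 mono_a bnd_a]] := @smooth_step R.
exists (fun n p q k x => n ^+ k * a k (n * (x - p)) - n ^+ k * a k (n * (x - q))).
move=> n p q n0 pq.
have nV x c : c + n^-1 <= x -> 1 <= n * (x - c).
  by move=> h; rewrite -ler_pdivrMl// mulr1 lerBrDl.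
have t0 x : x <= p -> a 0%N (n * (x - p)) - a 0%N (n * (x - q)) = 0.
  by move=> xp; rewrite !a0 ?subrr// pmulr_rle0// subr_le0// (le_trans xp).
have t1 x : q + n^-1 <= x -> a 0%N (n * (x - p)) - a 0%N (n * (x - q)) = 0.
  by move=> xq; rewrite !a1 ?subrr//; apply: nV => //; rewrite (le_trans _ xq)// lerD2r.
have jt : jet (fun k x => n ^+ k * a k (n * (x - p)) - n ^+ k * a k (n * (x - q))).
  by apply: jetB; exact: jet_affine.
split => //=.
- apply: jet_vanishes => // x; rewrite expr0 !mul1r => /orP[/ltW/t0//|/ltW/t1//].
- move=> x; rewrite expr0 !mul1r subr_ge0; apply/andP; split.
    by apply: mono_a; rewrite ler_pM2l// lerD2l lerN2.
  have /andP[_] := bnd_a (n * (x - p)); have /andP[] := bnd_a (n * (x - q)); lra.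
- move=> x px xq; rewrite expr0 !mul1r a1 ?nV// a0 ?subr0//.
  by rewrite pmulr_rle0// subr_le0.
- by split=> x; rewrite expr0 !mul1r; [exact: t0|exact: t1].
Qed.

Lemma smooth_bump3 (l r : 'I_3 -> R) : (forall i, l i <= r i) ->
  exists a : 'I_3 -> nat -> R -> R,
  [/\ forall i, jet (a i), forall i, vanishes_off (l i - 1) (r i + 1) (a i),
      forall x, 0 <= tensor a (fun=> 0%N) x <= 1 &
      forall x, box3 l r x -> tensor a (fun=> 0%N) x = 1].
Proof.
move=> lr; have [t Ht] := smooth_trapezoid.
(* With parameter 1 the ramps have length 1 and fill [l - 1, l] and [r, r + 1]. *)
have {}Ht i := Ht 1 (l i - 1) (r i) ltr01 (le_trans (lerB (lexx _) ler01) (eq_ind_r (fun z => z <= r i) (lr i) (subr0 _))).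
exists (fun i => t 1 (l i - 1) (r i)); split.
- by move=> i; have [] := Ht i.
- by move=> i; have [_] := Ht i; rewrite invr1.
- move=> x; rewrite /tensor prodr_ge0/=; last by move=> i _; have [_ _ /(_ (co i x))/andP[]] := Ht i.
  by apply: prodr_ile1 => i _; have [_ _ /(_ (co i x))] := Ht i.
- move=> x bx; rewrite /tensor big1// => i _; have [_ _ _ + _] := Ht i; apply.
    by rewrite invr1 subrK; have /andP[] := bx i.
  by have /andP[] := bx i.
Qed.

End trapezoid.

(** * Limit theorems for integrals *)

Section convergence.
Context d (T : measurableType d) (R : realType) (mu : {measure set T -> \bar R}).

(** Convergence is required only where f is nonzero. This matters at x = y, where 1 / s blows up as
    e tends to 0 while [(dist y x)^-1] has the default value 0. *)
Lemma fatou_le (f_ : nat -> T -> R) (f : T -> R) (C : \bar R) :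
  (forall n, measurable_fun setT (f_ n)) -> measurable_fun setT f ->
  (forall n x, 0 <= f_ n x) ->
  (forall x, f x != 0 -> f_ ^~ x @ \oo --> f x) ->
  (forall n, (\int[mu]_x (f_ n x)%:E <= C)%E) ->
  (\int[mu]_x (f x)%:E <= C)%E.
Proof.
move=> mf_ mf f0 ff fC.
pose A := [set x | f x != 0].
have mA : measurable A.
  rewrite (_ : A = f @^-1` ~` [set 0]); last first.
    by apply/seteqP; split => x /= => [/eqP//|/eqP].
  by rewrite -[X in measurable X]setTI; apply: mf => //; apply: measurableC; exact: measurable_set1.
(* Restricting to the set where f is nonzero forces convergence everywhere and only lowers the
   integrals. *)
pose g_ n x := f_ n x * \1_A x.
have mg n : measurable_fun setT (EFin \o g_ n).
  by apply/measurable_EFinP; apply: measurable_funM => //; exact: measurable_indic.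
have g0 n x : setT x -> (0 <= (EFin \o g_ n) x)%E.
  by move=> _; rewrite /= lee_fin mulr_ge0// indicE.
have gf x : (g_ n x)%:E @[n --> \oo] --> (f x)%:E.
  apply: cvg_EFin; first exact: nearW.
  have [fx0|fx0] := eqVneq (f x) 0.
    rewrite fx0 (_ : (fine \o _) = cst 0); first exact: cvg_cst.
    by apply/funext => n; rewrite /= /g_ indicE memNset ?mulr0// /A /= fx0 eqxx.
  rewrite (_ : (fine \o _) = f_^~ x); first exact: ff.
  by apply/funext => n; rewrite /= /g_ indicE mem_set ?mulr1.
have := fatou mu measurableT mg g0.
rewrite (eq_integral (fun x => (f x)%:E)); last first.
  move=> x _; rewrite is_cvg_limn_einfE; last by apply/cvg_ex; eexists; exact: gf.
  by apply/cvg_lim => //; exact: gf.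
move=> /le_trans; apply.
rewrite limn_einf_lim; apply: lime_le; first exact: is_cvg_einfs.
apply: nearW => n; apply: le_trans (fC n).
apply: (@le_trans _ _ (\int[mu]_x (g_ n x)%:E)%E).
  by apply: ereal_inf_lbound; exists n => /=.
apply: ge0_le_integral => //.
- by move=> x _; exact: g0.
- exact: mg.
- exact/measurable_EFinP.
- move=> x _; rewrite lee_fin /g_ -[leRHS]mulr1 ler_wpM2l//.
Qed.

Lemma cvg_Rintegral_dominated (f_ : nat -> T -> R) (f g : T -> R) :
  (forall n, measurable_fun setT (f_ n)) -> measurable_fun setT f ->
  mu.-integrable setT (EFin \o g) ->
  {ae mu, forall x, (forall n, `|f_ n x| <= g x) /\ f_ ^~ x @ \oo --> f x} ->
  (fun n => \int[mu]_x f_ n x) @ \oo --> \int[mu]_x f x.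
Proof.
move=> mf_ mf ig fg.
have [] := @dominated_convergence _ T R mu setT measurableT (fun n => EFin \o f_ n) (EFin \o f) (EFin \o g).
- by move=> n; exact/measurable_EFinP.
- exact/measurable_EFinP.
- apply: filterS fg => x [_ fx] _; exact: cvg_EFin (nearW _ _) fx.
- exact: ig.
- by apply: filterS fg => x [gx _] n _; rewrite lee_fin.
move=> fi _ h; apply: fine_cvg; rewrite /Rintegral fineK//.
exact: integrable_fin_num.
Qed.
End convergence.

(** * Local integrability of 1 / |x - y| *)

Section local_integrability.
Context {R : realType}.
Implicit Types (x y : R * R * R) (l r : 'I_3 -> R).
Local Notation leb3 := (@lebesgue3 R).

Definition dist y x : R := Num.sqrt (\sum_(k < 3) off y k x ^+ 2).

Lemma dist_ge0 y x : 0 <= dist y x. Proof. exact: sqrtr_ge0. Qed.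

Lemma dist_eq0 y x : (dist y x == 0) = (x == y).
Proof.
apply/idP/eqP => [|->]; last first.
  by rewrite /dist big1 ?sqrtr0// => k _; rewrite /off subrr expr0n.
rewrite sqrtr_eq0 => le0.
have h k : co k x = co k y.
  apply/eqP; rewrite -subr_eq0 -sqrf_eq0 -/(off y k x); apply/eqP.
  have := psumr_eq0P (P := predT) (F := fun k => off y k x ^+ 2) (fun k _ => sqr_ge0 _).
  move=> /(_ _ k isT); apply; apply/eqP; rewrite eq_le le0/=.
  by apply: sumr_ge0 => i _; exact: sqr_ge0.
move: x y h {le0} => [[x0 x1] x2] [[y0 y1] y2] h.
by have := (h ord0, h (@Ordinal 3 1 isT), h (@Ordinal 3 2 isT)); rewrite /co/= => -[[-> ->] ->].
Qed.

Lemma dist_gt0 y x : x <> y -> 0 < dist y x.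
Proof. by move=> xy; rewrite lt_neqAle dist_ge0 andbT eq_sym dist_eq0; apply/eqP. Qed.

Lemma measurable_dist y : measurable_fun setT (dist y).
Proof.
apply: (measurableT_comp (@measurable_sqrt R)); apply: measurable_sum => k.
by apply: measurable_funX; exact: measurable_off.
Qed.

Lemma measurable_dist_inv y : measurable_fun setT (fun x => (dist y x)^-1).
Proof. by apply: (measurableT_comp (@measurable_inv R)); exact: measurable_dist. Qed.

Lemma ri_le_dist y e x : 0 < e -> x <> y -> ri y e x <= (dist y x)^-1.
Proof.
move=> e0 xy; rewrite lef_pV2 ?posrE ?dist_gt0 ?rd_gt0//.
by rewrite ler_wsqrtr// lerDl sqr_ge0.
Qed.

Definition eps (n : nat) : R := n.+1%:R^-1.

Lemma eps_gt0 n : 0 < eps n. Proof. by rewrite invr_gt0. Qed.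

Lemma eps_cvg0 : eps @ \oo --> 0. Proof. exact: cvg_harmonic. Qed.

Lemma ri_cvg y x : x <> y -> ri y (eps n) x @[n --> \oo] --> (dist y x)^-1.
Proof.
move=> xy; apply: cvgV; first by rewrite gt_eqF// dist_gt0.
apply: (continuous_cvg _ (@sqrt_continuous R _)).
rewrite -[X in _ --> X]addr0; apply: cvgD; first exact: cvg_cst.
by rewrite -[X in _ --> X](mulr0 (0 : R)); exact: cvgM eps_cvg0 eps_cvg0.
Qed.

Lemma ri_norm y e x : 0 < e -> `|ri y e x| = ri y e x.
Proof. by move=> e0; rewrite gtr0_norm// ri_gt0. Qed.

(* With [s := sqrt (|x - y|^2 + e^2)], the Laplacian of [s] is
   [2 / s + e^2 / s^3]; integrating it by parts once against a cutoff function
   bounds the integral of [1 / s] uniformly in [y] and [e], since the gradient of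
   [s] is bounded by 1. *)
Lemma integral_dist_inv_bounded l r : (forall i, l i <= r i) ->
  exists C : R, forall y,
    (\int[leb3]_x ((dist y x)^-1 * \1_(box3 l r) x)%:E <= C%:E)%E.
Proof.
move=> lr; have [a [ja va a01 a1]] := smooth_bump3 lr.
pose m0 : 'I_3 -> nat := fun=> 0%N.
pose C := \sum_(i < 3) \int[leb3]_x `|tensor a (bump_index m0 i) x|.
have iT m : leb3.-integrable setT (EFin \o (tensor a m)).
  have := @integrable_pairing _ _ _ _ ja va (fun=> 1) m (regular_cst 1).
  by under [X in leb3.-integrable _ X]eq_fun do rewrite mul1r.
have NC y e : 0 < e -> pairing a (ri y e) m0 <= C.
  move=> e0.
  have bp i : pairing a (rd y e) (bump_index (bump_index m0 i) i) =
      - pairing a (fun x => off y i x * ri y e x) (bump_index m0 i).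
    have dr x t := is_derive_rd y e0 i x t.
    have rr := regular_rd y e0.
    by rewrite (pairing_by_parts ja va _ rr (regular_offri y e0 i) dr) opprK.
  have := pairing_laplace_rd ja va y e0 m0.
  under eq_bigr do rewrite bp.
  rewrite sumrN => E.
  (* By E, minus the sum of the gradient terms is twice the wanted pairing plus this term. Both are
     nonnegative, so the gradient terms bound the pairing. *)
  have S0 : 0 <= e ^+ 2 * pairing a (fun x => ri y e x ^+ 3) m0.
    rewrite mulr_ge0 ?sqr_ge0//; apply: Rintegral_ge0 => x _.
    by rewrite mulr_ge0 ?exprn_ge0 ?(ltW (ri_gt0 _ _ _))//; have /andP[] := a01 x.
  have N0 : 0 <= pairing a (ri y e) m0.
    apply: Rintegral_ge0 => x _.
    by rewrite mulr_ge0 ?(ltW (ri_gt0 _ _ _))//; have /andP[] := a01 x.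
  suff : `|\sum_(i < 3) pairing a (fun x => off y i x * ri y e x) (bump_index m0 i)| <= C.
    by rewrite ler_norml => /andP[]; lra.
  apply: (le_trans (ler_norm_sum _ _ _)); apply: ler_sum => i _.
  have io := integrable_pairing ja va (bump_index m0 i) (regular_offri y e0 i).
  apply: (le_trans (le_normr_Rintegral measurableT io)).
  apply: le_Rintegral => //.
  - by apply: (integrable_norm io).
  - by apply: (integrable_norm (iT _)).
  - by move=> x _; rewrite normrM ler_piMl// norm_offri.
exists C => y.
apply: (@fatou_le _ _ _ leb3 (fun n x => ri y (eps n) x * tensor a m0 x)).
- move=> n; apply: measurable_funM; last exact: measurable_tensor.
  by have [] := regular_ri y (eps_gt0 n).
- apply: measurable_funM; first exact: measurable_dist_inv.
  by apply: measurable_indic; exact: measurable_box3.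
- move=> n x; rewrite mulr_ge0 ?(ltW (ri_gt0 _ (eps_gt0 _) _))//; by have /andP[] := a01 x.
- move=> x; rewrite mulf_eq0 negb_or invr_eq0 dist_eq0 indicE => /andP[/eqP xy].
  have [xb _|//] := boolP (x \in box3 l r); last by rewrite eqxx.
  have E : tensor a m0 x = true%:R by exact: a1 (set_mem xb).
  by rewrite -E; apply: cvgM; [exact: ri_cvg|exact: cvg_cst].
- move=> n.
  have := integrable_pairing ja va m0 (regular_ri y (eps_gt0 n)).
  move=> /(integrable_fin_num measurableT) h.
  by rewrite -[leLHS]fineK// lee_fin; apply: NC; exact: eps_gt0.
Qed.

End local_integrability.

(** * The approximate identity 3 e^2 / s^5 *)

Section fundamental_solution.
Context {R : realType}.
Implicit Types (x y w : R * R * R) (l r : 'I_3 -> R) (m : 'I_3 -> nat).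
Local Notation leb3 := (@lebesgue3 R).

Lemma ae3S (P P' : R * R * R -> Prop) : (forall x, P x -> P' x) ->
  {ae leb3, forall x, P x} -> {ae leb3, forall x, P' x}.
Proof. by move=> PP'; apply: (@filterS _ _ (ae_filter_ringOfSetsType leb3)). Qed.

(** The singleton is a degenerate box, of measure 0. *)
Lemma ae_neq y : {ae leb3, forall x, x <> y}.
Proof.
exists (box3 (co^~ y) (co^~ y)); split.
- exact: measurable_box3.
- rewrite box3E lebesgue3X//; last exact: measurableX.
  by rewrite [X in (_ * X)%E]lebesgue_measure_itv/= ltxx mule0.
- by move=> x /= /contrapT -> i; rewrite lexx.
Qed.

Lemma measurable_dist_inv_box y l r :
  measurable_fun setT (fun x => (dist y x)^-1 * \1_(box3 l r) x).
Proof.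
apply: measurable_funM; first exact: measurable_dist_inv.
by apply: measurable_indic; exact: measurable_box3.
Qed.

Lemma dist_inv_box_ge0 y l r x : 0 <= (dist y x)^-1 * \1_(box3 l r) x.
Proof. by rewrite mulr_ge0 ?invr_ge0 ?dist_ge0// indicE. Qed.

Lemma integrable_dist_inv y l r : (forall i, l i <= r i) ->
  leb3.-integrable setT (EFin \o (fun x => (dist y x)^-1 * \1_(box3 l r) x)).
Proof.
move=> lr; have [C HC] := integral_dist_inv_bounded lr.
apply/integrableP; split; first by apply/measurable_EFinP; exact: measurable_dist_inv_box.
apply: le_lt_trans (ltry C); apply: le_trans (HC y).
rewrite le_eqVlt; apply/orP; left; apply/eqP; apply: eq_integral => x _ /=.
by rewrite ger0_norm// dist_inv_box_ge0.
Qed.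

(** Dominated convergence, with a multiple of 1 / |x - y| on the box as majorant. *)
Lemma cvg_kernel_pairing (K_ : nat -> R * R * R -> R) (K phi : R * R * R -> R) y l r (C B : R) :
  (forall i, l i <= r i) ->
  (forall n, measurable_fun setT (K_ n)) -> measurable_fun setT K ->
  measurable_fun setT phi -> (forall x, `|phi x| <= B) ->
  (forall x, ~ box3 l r x -> phi x = 0) ->
  (forall n x, x <> y -> `|K_ n x| <= C * (dist y x)^-1) ->
  (forall x, x <> y -> K_ ^~ x @ \oo --> K x) ->
  (fun n => \int[leb3]_x (K_ n x * phi x)) @ \oo --> \int[leb3]_x (K x * phi x).
Proof.
move=> lr mK_ mK mphi phiB phi0 KC KK.
apply: (@cvg_Rintegral_dominated _ _ _ leb3 (fun n x => K_ n x * phi x) (fun x => K x * phi x)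
  (fun x => (C * B) * ((dist y x)^-1 * \1_(box3 l r) x))).
- by move=> n; exact: (measurable_funM (mK_ n) mphi).
- exact: (measurable_funM mK mphi).
- have := integrableZl measurableT (C * B) (integrable_dist_inv y lr); exact.
- apply: ae3S (ae_neq y) => x xy; split.
    move=> n; have [bx|bx] := pselect (box3 l r x); last first.
      by rewrite phi0// mulr0 normr0 indicE memNset// !mulr0.
    rewrite indicE mem_set// mulr1 normrM mulrAC.
    by rewrite ler_pM//; exact: KC.
  by apply: cvgM; [exact: KK|exact: cvg_cst].
Qed.

Section bounds.
Variables (a : 'I_3 -> nat -> R -> R) (l r : 'I_3 -> R).
Hypothesis lr : forall i, l i <= r i.
Hypothesis ja : forall i, jet (a i).
Hypothesis va : forall i, vanishes_off (l i) (r i) (a i).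

Lemma pairing_ri_bounded m : exists C : R, forall y e, 0 < e ->
  `|pairing a (ri y e) m| <= C.
Proof.
have [B B0 TB] := tensor_bounded ja va m.
have [C HC] := integral_dist_inv_bounded lr.
exists (B * C) => y e e0.
have iT := integrable_pairing ja va m (regular_ri y e0).
have mT : measurable_fun setT (fun x => ri y e x * tensor a m x).
  by apply: measurable_funM; [have [] := regular_ri y e0|exact: measurable_tensor].
apply: (le_trans (le_normr_Rintegral measurableT iT)).
have h : (\int[leb3]_x (`|ri y e x * tensor a m x|)%:E <= (B * C)%:E)%E.
  apply: (@le_trans _ _ (\int[leb3]_x (B * ((dist y x)^-1 * \1_(box3 l r) x))%:E)%E).
    apply: ae_ge0_le_integral => //.
    - by apply/measurable_EFinP; apply: measurableT_comp.
    - by move=> x _; rewrite lee_fin mulr_ge0// dist_inv_box_ge0.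
    - by apply/measurable_EFinP; apply: measurable_funM => //; exact: measurable_dist_inv_box.
    - apply: ae3S (ae_neq y) => x xy _; rewrite lee_fin.
      have [bx|bx] := pselect (box3 l r x); last first.
        by rewrite (tensor_off va m bx) mulr0 normr0 indicE memNset// !mulr0.
      rewrite indicE mem_set// mulr1 normrM mulrC ler_pM// ri_norm//.
      exact: ri_le_dist.
  under eq_integral do rewrite EFinM.
  rewrite ge0_integralZl//.
  - by rewrite EFinM lee_wpmul2l ?lee_fin.
  - by apply/measurable_EFinP; exact: measurable_dist_inv_box.
  - by move=> x _; rewrite lee_fin dist_inv_box_ge0.
rewrite -lee_fin /Rintegral fineK//.
by have := integrable_fin_num measurableT (integrable_norm iT).
Qed.

End bounds.

(** 3 (|w|^2 + 1)^(-5/2), the profile of the approximate identity. *)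
Definition rho w : R := 3 * ri 0 1 w ^+ 5.

Lemma rho_gt0 w : 0 < rho w.
Proof. by rewrite mulr_gt0// exprn_gt0// ri_gt0. Qed.

Lemma measurable_rho : measurable_fun setT rho.
Proof.
by have [] := regularZ 3 (regularX 5 (regular_ri (0 : R * R * R) (@ltr01 R))).
Qed.

Lemma co0 i : co i (0 : R * R * R) = 0. Proof. by elim/ord3P: i. Qed.

Lemma ri_dilate y e w : 0 < e -> ri y e (dilate y e w) = e^-1 * ri 0 1 w.
Proof.
move=> e0; rewrite /ri -invfM; congr (_^-1).
rewrite /rd -[X in X * _](gtr0_norm e0) -sqrtr_sqr -sqrtrM ?sqr_ge0//; congr Num.sqrt.
rewrite /qd mulrDr expr1n mulr1 mulr_sumr; congr (_ + _); apply: eq_bigr => k _.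
by rewrite /off co_dilate co0 subr0 addrC addKr exprMn.
Qed.

(** One of the positive and negative parts has infinite integral, so their difference is infinite
    and [fine] sends it to 0. *)
Lemma Rintegral_not_integrable d (S : measurableType d) (mu : {measure set S -> \bar R})
    (f : S -> R) : measurable_fun setT f -> ~ mu.-integrable setT (EFin \o f) ->
  \int[mu]_s f s = 0.
Proof.
move=> mf nf; rewrite /Rintegral integralE.
have mfE : measurable_fun setT (EFin \o f) by exact/measurable_EFinP.
set P := (\int[mu]_s (fun s => (f s)%:E)^\+ s)%E.
set N := (\int[mu]_s (fun s => (f s)%:E)^\- s)%E.
have P0 : (0 <= P)%E by apply: integral_ge0 => s _; exact: funepos_ge0.
have N0 : (0 <= N)%E by apply: integral_ge0 => s _; exact: funeneg_ge0.
have PN : ~ ((P < +oo) /\ (N < +oo))%E.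
  case=> Poo Noo; apply: nf; apply/integrableP; split => //.
  have -> : (\int[mu]_s `|(EFin \o f) s| = P + N)%E.
    rewrite /P /N -ge0_integralD//.
    - by apply: eq_integral => s _; rewrite -[LHS]/((abse \o (EFin \o f)) s) fune_abse.
    - exact: measurable_funepos.
    - exact: measurable_funeneg.
  by rewrite lte_add_pinfty.
move: P N P0 N0 PN => [P| |] [N| |]//= _ _ PN.
by exfalso; apply: PN; rewrite !ltry.
Qed.

(* Holds without integrability because both sides are then 0, the junk value of
   [Rintegral]. *)
Lemma measurable_RintegralZl d (S : measurableType d) (mu : {measure set S -> \bar R})
    (f : S -> R) (c : R) : measurable_fun setT f ->
  \int[mu]_s (c * f s) = c * \int[mu]_s f s.
Proof.
move=> mf; have [->|c0] := eqVneq c 0.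
  by rewrite mul0r; apply: Rintegral0_eq => s _; rewrite mul0r.
have [fi|nf] := pselect (mu.-integrable setT (EFin \o f)); first exact: RintegralZl.
rewrite (Rintegral_not_integrable mf nf) mulr0; apply: Rintegral_not_integrable.
  exact: measurable_funM.
move=> cfi; apply: nf; have := integrableZl measurableT c^-1 cfi.
congr (mu.-integrable _ _); apply/funext => s /=.
by rewrite -EFinM mulrA mulVf// mul1r.
Qed.

(** Substituting x = y + e w turns s into e sqrt (|w|^2 + 1); the powers e^2 and e^-5 and the
    Jacobian e^3 cancel. *)
Lemma pairing_rho (a : 'I_3 -> nat -> R -> R) m y e : 0 < e -> (forall i, jet (a i)) ->
  3 * e ^+ 2 * pairing a (fun x => ri y e x ^+ 5) m =
  \int[leb3]_w (rho w * tensor a m (dilate y e w)).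
Proof.
move=> e0 ja.
have mf : measurable_fun setT (fun x => ri y e x ^+ 5 * tensor a m x).
  apply: measurable_funM; last exact: measurable_tensor.
  by have [] := regularX 5 (regular_ri y e0).
rewrite /pairing (Rintegral_dilate y e0 mf) mulrA -measurable_RintegralZl; last first.
  by apply: (measurableT_comp mf); exact: measurable_dilate.
apply: eq_Rintegral => w _; rewrite ri_dilate// /rho.
by field; rewrite gt_eqF.
Qed.

(* Up to a factor, [rho] is the Laplacian of [(|w|^2 + 1)^(-1/2)]: pairing it with a
   cutoff dilated by [1 / e] gives the bounded quantity of [pairing_ri_bounded]. *)
Lemma integrable_rho : leb3.-integrable setT (EFin \o rho).
Proof.
have N11 : (-1 : R) <= 1 by lra.
have N12 : (-1 : R) - 1 <= 1 + 1 by lra.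
have lr1 : forall i : 'I_3, (fun=> -1 : R) i <= (fun=> 1) i by move=> i.
have lr2 : forall i : 'I_3, ((fun=> -1 : R) i - 1) <= ((fun=> 1) i + 1) by move=> i.
have [a [ja va a01 a1]] := smooth_bump3 lr1.
pose m0 : 'I_3 -> nat := fun=> 0%N.
have [C HC] : exists C : R, forall e, 0 < e ->
    \int[leb3]_w (rho w * tensor a m0 (dilate 0 e w)) <= C.
  have /boolp.choice[C HC] : forall i, exists C : R, forall y e, 0 < e ->
      `|pairing a (ri y e) (bump_index (bump_index m0 i) i)| <= C.
    by move=> i; exact: (pairing_ri_bounded lr2 ja va).
  exists (\sum_(i < 3) C i) => e e0; rewrite -pairing_rho//.
  rewrite -[leLHS]opprK -mulNr -(pairing_laplace_ri ja va)//.
  rewrite -sumrN; apply: ler_sum => i _; apply: le_trans (HC i 0 e e0).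
  by rewrite -normrN ler_norm.
have mT n : measurable_fun setT (fun w => rho w * tensor a m0 (dilate 0 (eps n) w)).
  apply: measurable_funM; first exact: measurable_rho.
  by apply: (measurableT_comp (measurable_tensor ja m0)); exact: measurable_dilate.
apply/integrableP; split; first by apply/measurable_EFinP; exact: measurable_rho.
apply: le_lt_trans (ltry C).
have -> : (\int[leb3]_x `|(EFin \o rho) x| = \int[leb3]_x (rho x)%:E)%E.
  by apply: eq_integral => x _ /=; rewrite gtr0_norm// rho_gt0.
apply: (@fatou_le _ _ _ leb3 _ _ _ mT measurable_rho).
- by move=> n w; rewrite mulr_ge0 ?(ltW (rho_gt0 w))//; have /andP[] := a01 (dilate 0 (eps n) w).
- move=> w _; apply: cvg_near_cst.
  (* For fixed w the dilated point eventually lies in the cube where the cutoff is 1. *)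
  have hk (i : 'I_3) : \forall n \near \oo, `|eps n * co i w| < 1.
    have h : (fun n => eps n * co i w) @ \oo --> (0 : R).
      by rewrite -[X in _ --> X](mul0r (co i w)); apply: cvgMl; exact: eps_cvg0.
    by move/cvgr0Pnorm_lt : h; apply; exact: ltr01.
  near=> n.
  have bn : forall i, `|eps n * co i w| < 1 by near: n; exact: filter_forall.
  have bx : box3 (fun=> -1) (fun=> 1) (dilate 0 (eps n) w).
    by move=> i; rewrite co_dilate co0 add0r -ler_norml ltW.
  by rewrite (a1 _ bx) mulr1.
- move=> n; rewrite -[leLHS]fineK ?lee_fin; first exact: HC (eps_gt0 n).
  apply: integrable_fin_num => //.
  (* The cutoff vanishes outside [-2, 2]^3, so its dilate vanishes outside the cube of half-side 2 /
     eps n. *)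
  pose s : R := (1 + 1) / eps n.
  apply: (@integrable_box3 _ (fun=> - s) (fun=> s) (fun w => rho w * tensor a m0 (dilate 0 (eps n) w)) 3).
  - exact: mT.
  - move=> w; have /andP[T0 T1] := a01 (dilate 0 (eps n) w).
    have w0 := ltW (rho_gt0 w).
    have w3 : rho w <= 3.
      rewrite /rho -[leRHS]mulr1 ler_pM2l// exprn_ile1//; first exact/ltW/ri_gt0.
      by rewrite -[leRHS]invr1 ri_le.
    by rewrite normrM (ger0_norm w0) (ger0_norm T0) -[leRHS]mulr1 ler_pM.
  - move=> w nw; rewrite (tensor_off va) ?mulr0// => bw; apply: nw => i.
    have := bw i; rewrite co_dilate co0 add0r => /andP[h1 h2].
    rewrite /s ler_pdivlMr ?eps_gt0// -mulNr ler_pdivrMr ?eps_gt0// ![co i w * _]mulrC h2.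
    by rewrite opprD h1.
Unshelve. all: by end_near. Qed.

(* Equal to [4 * pi], but only its positivity is needed. *)
Definition kappa : R := \int[leb3]_w rho w.

Lemma kappa_gt0 : 0 < kappa.
Proof.
(* On the unit cube |w|^2 + 1 <= 4, so [ri 0 1 w] is at least 1 / 2. *)
have c0 : (0 : R) < 3 * (2^-1) ^+ 5 by rewrite mulr_gt0// exprn_gt0.
pose B := @box3 R (fun=> 0) (fun=> 1).
have B1 : leb3 B = 1%E.
  rewrite /B box3E lebesgue3X//; last exact: measurableX.
  by rewrite lebesgue2X// !lebesgue_measure_itv/= lte_fin ltr01 sube0 !mule1.
have ic : leb3.-integrable setT (EFin \o (fun w => 3 * (2^-1) ^+ 5 * \1_B w)).
  apply: (@integrable_box3 _ (fun=> 0) (fun=> 1) _ (3 * (2^-1) ^+ 5)).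
  - by apply: measurable_funM => //; apply: measurable_indic; exact: measurable_box3.
  - move=> w; rewrite normrM (gtr0_norm c0) ler_piMr ?(ltW c0)// indicE.
    by case: (w \in B); rewrite ?normr0 ?normr1.
  - by move=> w bw; rewrite indicE memNset ?mulr0.
apply: (lt_le_trans c0).
have -> : 3 * (2^-1) ^+ 5 = \int[leb3]_w (3 * (2^-1) ^+ 5 * \1_B w).
  rewrite measurable_RintegralZl; last by apply: measurable_indic; exact: measurable_box3.
  rewrite /Rintegral integral_indic//; last exact: measurable_box3.
  by rewrite setIT [X in fine X]B1 mulr1.
apply: le_Rintegral => //; first exact: integrable_rho.
move=> w _; rewrite indicE; have [wB|_] := boolP (w \in B); last first.
  by rewrite mulr0 ltW// rho_gt0.
rewrite mulr1 /rho ler_pM2l// lerXn2r ?nnegrE// ?(ltW (ri_gt0 _ _ _))// ?ltr01//.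
rewrite /ri lef_pV2 ?posrE ?rd_gt0//.
rewrite -[leRHS]ger0_norm// -sqrtr_sqr ler_wsqrtr// /qd.
have h i : off 0 i w ^+ 2 <= 1.
  have /set_mem/(_ i)/andP[w0 w1] := wB.
  by rewrite /off co0 subr0 expr_le1.
rewrite !big_ord_recl big_ord0 expr1n.
have := h ord0; have := h (lift ord0 ord0); have := h (lift ord0 (lift ord0 ord0)).
have -> : (2 : R) ^+ 2 = 4 by rewrite expr2 -natrM.
by lra.
Qed.

Lemma tensor_continuous_ray (a : 'I_3 -> nat -> R -> R) m y w : (forall i, jet (a i)) ->
  tensor a m (dilate y (eps n) w) @[n --> \oo] --> tensor a m y.
Proof.
move=> ja.
have h i : a i (m i) (co i (dilate y (eps n) w)) @[n --> \oo] --> a i (m i) (co i y).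
  have h0 : (fun n => co i y + eps n * co i w) @ \oo --> co i y + 0 * co i w.
    by apply: cvgD; [exact: cvg_cst|apply: cvgMl; exact: eps_cvg0].
  under eq_fun do rewrite co_dilate.
  rewrite mul0r addr0 in h0.
  exact: (continuous_cvg _ (@jet_continuous _ _ (m i) (ja i) _) h0).
have E x : tensor a m x = a ord0 (m ord0) (co ord0 x) *
   (a (lift ord0 ord0) (m (lift ord0 ord0)) (co (lift ord0 ord0) x) *
   a (lift ord0 (lift ord0 ord0)) (m (lift ord0 (lift ord0 ord0))) (co (lift ord0 (lift ord0 ord0)) x)).
  by rewrite /tensor !big_ord_recl big_ord0 mulr1.
under eq_fun do rewrite E; rewrite E.
by apply: cvgM => //; exact: cvgM.
Qed.

(** Dominated convergence in the variable w: the tensor is bounded and continuous along rays from y,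
    and [rho] is integrable. *)
Lemma cvg_pairing_ri5 (a : 'I_3 -> nat -> R -> R) l r m y :
  (forall i, jet (a i)) -> (forall i, vanishes_off (l i) (r i) (a i)) ->
  (fun n => 3 * eps n ^+ 2 * pairing a (fun x => ri y (eps n) x ^+ 5) m) @ \oo -->
  kappa * tensor a m y.
Proof.
move=> ja va.
have [B B0 TB] := tensor_bounded ja va m.
under eq_fun do rewrite (pairing_rho _ _ (eps_gt0 _) ja).
rewrite /kappa mulrC -measurable_RintegralZl; last exact: measurable_rho.
apply: (@cvg_Rintegral_dominated _ _ _ leb3 (fun n w => rho w * tensor a m (dilate y (eps n) w))
  _ (fun w => B * rho w)).
- move=> n; apply: measurable_funM; first exact: measurable_rho.
  by apply: (measurableT_comp (measurable_tensor ja m)); exact: measurable_dilate.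
- by apply: measurable_funM => //; exact: measurable_rho.
- exact: (integrableZl measurableT B integrable_rho).
- apply: (@aeW _ _ _ leb3) => w; split.
    by move=> n; rewrite normrM (gtr0_norm (rho_gt0 w)) mulrC ler_wpM2r ?(ltW (rho_gt0 w)).
  by rewrite mulrC; apply: cvgMr; exact: tensor_continuous_ray.
Qed.

End fundamental_solution.

(** * The Kelvin tensor as a fundamental solution *)

Section kernel.
Context {R : realType}.
Implicit Types (x y w : R * R * R) (m : 'I_3 -> nat).
Local Notation leb3 := (@lebesgue3 R).
Variables (a : 'I_3 -> nat -> R -> R) (l r : 'I_3 -> R).
Hypothesis lr : forall i, l i <= r i.
Hypothesis ja : forall i, jet (a i).
Hypothesis va : forall i, vanishes_off (l i) (r i) (a i).

Lemma cvg_sum_ord n (f : 'I_n -> nat -> R) (c : 'I_n -> R) :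
  (forall i, f i @ \oo --> c i) -> (fun p => \sum_(i < n) f i p) @ \oo --> \sum_(i < n) c i.
Proof.
elim: n f c => [|n IH] f c fc.
  by under eq_fun do rewrite big_ord0; rewrite big_ord0; exact: cvg_cst.
under eq_fun do rewrite big_ord_recl; rewrite big_ord_recl.
by apply: cvgD; [exact: fc|apply: IH => i; exact: fc].
Qed.

Definition Kelvin_kernel (al be : R) y (k i : 'I_3) x : R :=
  al * (k == i)%:R * (dist y x)^-1 +
  be * (off y k x * off y i x * (dist y x)^-1 ^+ 3).

Lemma measurable_Kelvin_kernel al be y k i :
  measurable_fun setT (Kelvin_kernel al be y k i).
Proof.
have md := @measurable_dist_inv R y.
apply: measurable_funD; first exact: measurable_funM.
apply: measurable_funM => //; apply: measurable_funM; last exact: measurable_funX.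
by apply: measurable_funM; exact: measurable_off.
Qed.

Lemma Kelvin_reg_cvg al be y k i x : x <> y ->
  Kelvin_reg y (eps n) al be k i x @[n --> \oo] --> Kelvin_kernel al be y k i x.
Proof.
move=> xy; have h := ri_cvg xy.
have h3 : ri y (eps n) x ^+ 3 @[n --> \oo] --> (dist y x)^-1 ^+ 3.
  by apply: (cvgM h); exact: cvgM.
apply: cvgD; first by apply: cvgMr.
by apply: cvgMr; apply: cvgMr.
Qed.

(** In the second term two factors 1 / s absorb the offsets, which leaves a single 1 / s, at most 1
    / |x - y|. *)
Lemma Kelvin_reg_bound al be y e k i x : 0 < e -> x <> y ->
  `|Kelvin_reg y e al be k i x| <= (`|al| + `|be|) * (dist y x)^-1.
Proof.
move=> e0 xy; have rle := ri_le_dist e0 xy.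
rewrite mulrDl (le_trans (ler_normD _ _))// lerD//.
  rewrite !normrM -mulrA ler_wpM2l// ri_norm//.
  by case: (k == i); rewrite ?normr1 ?mul1r// normr0 mul0r invr_ge0 dist_ge0.
rewrite normrM ler_wpM2l//.
have -> : off y k x * off y i x * ri y e x ^+ 3 =
  (off y k x * ri y e x) * (off y i x * ri y e x) * ri y e x by ring.
rewrite normrM ri_norm// -[leRHS]mul1r ler_pM// ?(ltW (ri_gt0 y e0 x))//.
by rewrite normrM -[leRHS]mul1r ler_pM// norm_offri.
Qed.

Lemma measurable_lame lambda mu j m i : measurable_fun setT (lame a lambda mu j m i).
Proof.
apply: measurable_funD; apply: measurable_funM => //; last exact: measurable_tensor.
by apply: measurable_sum => p; exact: measurable_tensor.
Qed.

Lemma lame_off lambda mu j m i x : ~ box3 l r x -> lame a lambda mu j m i x = 0.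
Proof.
move=> bx; rewrite /lame (tensor_off va _ bx) mulr0 addr0 big1 ?mulr0// => p _.
exact: (tensor_off va).
Qed.

Lemma lame_bounded lambda mu j m i : exists2 C : R, 0 <= C &
  forall x, `|lame a lambda mu j m i x| <= C.
Proof.
have [B B0 TB] := tensor_bounded ja va (bump_index (bump_index m i) j).
have /boolp.choice[C HC] : forall p, exists C : R, forall x,
    `|tensor a (bump_index (bump_index m p) p) x| <= C.
  by move=> p; have [C _ HC] := tensor_bounded ja va (bump_index (bump_index m p) p); exists C.
exists (`|mu * (i == j)%:R| * (\sum_(p < 3) `|C p|) + `|lambda + mu| * B).
  by rewrite addr_ge0 ?mulr_ge0// sumr_ge0.
move=> x; rewrite (le_trans (ler_normD _ _))// !(normrM (_ + _)) normrM lerD ?ler_wpM2l//.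
rewrite (le_trans (ler_norm_sum _ _ _))// ler_sum// => p _.
by rewrite (le_trans (HC p x))// ler_norm.
Qed.

(** The kernel tends to 0 for x <> y, and e^2 / s^3 = (e / s)^2 / s is at most 1 / |x - y|. *)
Lemma cvg_pairing_ri3 m y :
  (fun n => eps n ^+ 2 * pairing a (fun x => ri y (eps n) x ^+ 3) m) @ \oo --> (0 : R).
Proof.
have [B B0 TB] := tensor_bounded ja va m.
have mri n : measurable_fun setT (fun x => ri y (eps n) x ^+ 3).
  by have [] := regularX 3 (regular_ri y (@eps_gt0 R n)).
have -> : (fun n => eps n ^+ 2 * pairing a (fun x => ri y (eps n) x ^+ 3) m) =
   (fun n => \int[leb3]_x (eps n ^+ 2 * ri y (eps n) x ^+ 3 * tensor a m x)).
  apply/funext => n; rewrite /pairing -measurable_RintegralZl; last first.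
    exact: (measurable_funM (mri n) (measurable_tensor ja m)).
  by apply: eq_Rintegral => x _; rewrite mulrA.
have <- : \int[leb3]_x (0 * tensor a m x) = 0.
  by apply: Rintegral0_eq => x _; rewrite mul0r.
apply: (@cvg_kernel_pairing _ (fun n x => eps n ^+ 2 * ri y (eps n) x ^+ 3) (fun=> 0)
  (tensor a m) y l r 1 B lr) => //.
- by move=> n; exact: measurable_funM.
- exact: measurable_tensor.
- by move=> x; exact: tensor_off.
- move=> n x xy; rewrite mul1r; have e0 := @eps_gt0 R n.
  have rp := ri_gt0 y e0 x.
  apply: le_trans (ri_le_dist e0 xy).
  have -> : eps n ^+ 2 * ri y (eps n) x ^+ 3 = (eps n * ri y (eps n) x) ^+ 2 * ri y (eps n) x by ring.
  have er0 : 0 <= eps n * ri y (eps n) x by rewrite mulr_ge0 ?ltW.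
  rewrite normrM ri_norm// -[leRHS]mul1r ler_wpM2r ?(ltW rp)// ger0_norm ?exprn_ge0//.
  by rewrite exprn_ile1// -ler_pdivlMl// mulr1; exact: ri_le.
- move=> x xy; have h := ri_cvg xy.
  rewrite -[X in _ --> X](mul0r ((dist y x)^-1 ^+ 3)); apply: cvgM.
    by rewrite -[X in _ --> X](mul0r (0 : R)); apply: cvgM; exact: eps_cvg0.
  by apply: (cvgM h); exact: cvgM.
Qed.

(** Both sides are limits of [regularized_fundamental_solution] as e tends to 0: the left one by
    domination, the right one by the approximate identity. *)
Lemma Kelvin_fundamental_solution lambda mu al be j k m y :
  (al + be) * (lambda + mu) = 2 * be * (lambda + 2 * mu) ->
  \sum_(i < 3) \int[leb3]_x (Kelvin_kernel al be y k i x * lame a lambda mu j m i x) =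
  - ((al + be) * mu * kappa * (k == j)%:R * tensor a m y).
Proof.
move=> ab.
have h1 : (fun n => \sum_(i < 3) \int[leb3]_x
      (Kelvin_reg y (eps n) al be k i x * lame a lambda mu j m i x)) @ \oo -->
    \sum_(i < 3) \int[leb3]_x (Kelvin_kernel al be y k i x * lame a lambda mu j m i x).
  apply: cvg_sum_ord => i.
  have [B B0 HB] := lame_bounded lambda mu j m i.
  apply: (@cvg_kernel_pairing _ _ _ _ y l r (`|al| + `|be|) B lr).
  - by move=> n; have [] := regular_Kelvin_reg y (eps_gt0 n) al be k i.
  - exact: measurable_Kelvin_kernel.
  - exact: measurable_lame.
  - exact: HB.
  - exact: lame_off.
  - by move=> n x; apply: Kelvin_reg_bound; exact: eps_gt0.
  - by move=> x; exact: Kelvin_reg_cvg.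
have h2 : (fun n => \sum_(i < 3) \int[leb3]_x
      (Kelvin_reg y (eps n) al be k i x * lame a lambda mu j m i x)) @ \oo -->
    - ((al + be) * mu * kappa * (k == j)%:R * tensor a m y).
  under eq_fun do rewrite (regularized_fundamental_solution ja va _ (eps_gt0 _) _ _ _ ab).
  have -> : - ((al + be) * mu * kappa * (k == j)%:R * tensor a m y) =
      - ((al + be) * mu * (k == j)%:R) * (kappa * tensor a m y) -
      be * (lambda + 2 * mu) * 0 by ring.
  have -> : (fun n => - ((al + be) * mu * (k == j)%:R * (3 * eps n ^+ 2)) *
      pairing a (fun x => ri y (eps n) x ^+ 5) m -
      be * (lambda + 2 * mu) * eps n ^+ 2 *
      pairing a (fun x => ri y (eps n) x ^+ 3) (bump_index (bump_index m j) k)) =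
    (fun n => - ((al + be) * mu * (k == j)%:R) * (3 * eps n ^+ 2 *
      pairing a (fun x => ri y (eps n) x ^+ 5) m) -
      be * (lambda + 2 * mu) * (eps n ^+ 2 *
      pairing a (fun x => ri y (eps n) x ^+ 3) (bump_index (bump_index m j) k))).
    by apply/funext => n; ring.
  apply: cvgB; apply: cvgMr; first exact: (@cvg_pairing_ri5 _ a l r m y ja va).
  exact: cvg_pairing_ri3.
by rewrite -(cvg_lim _ h1)// (cvg_lim _ h2).
Qed.

End kernel.

(** * Iterated integrals of real-valued functions *)

Section Rfubini.
Context d1 d2 (T1 : measurableType d1) (T2 : measurableType d2) (R : realType).
Variables (m1 : {sigma_finite_measure set T1 -> \bar R})
  (m2 : {sigma_finite_measure set T2 -> \bar R}) (f : T1 * T2 -> R).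
Hypothesis fi : (m1 \x m2)%E.-integrable setT (EFin \o f).

Let G y := (\int[m1]_x (f (x, y))%:E)%E.

Lemma integrable_fubini_G : m2.-integrable setT G.
Proof.
have mf := measurable_int _ fi.
apply/integrableP; split; first exact: (measurable_fubini_G fi).
apply: le_lt_trans ((integrable21ltyP m1 m2 mf).1 fi).
apply: ge0_le_integral => //.
- by apply: measurableT_comp => //; exact: (measurable_fubini_G fi).
- apply: (@measurable_fun_fubini_tonelli_G _ _ _ _ _ m1 (abse \o (EFin \o f))).
    exact: measurableT_comp.
  by move=> z; exact: abse_ge0.
- move=> y _; apply: le_abse_integral => //.
  apply: (measurableT_comp mf); exact: measurable_fun_pair.
Qed.

(** The inner integral is finite for almost every x only; elsewhere [Rintegral] takes a default
    value, so it is identified with [fubini_F] almost everywhere. *)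
Lemma Rintegral_iterated12 :
  \int[m1]_x \int[m2]_y f (x, y) = fine (\int[(m1 \x m2)%E]_z (f z)%:E)%E /\
  m1.-integrable setT (EFin \o (fun x => \int[m2]_y f (x, y))).
Proof.
have iF := integrable_fubini_F fi.
have mfF : measurable_fun setT (EFin \o (fun x => \int[m2]_y f (x, y))).
  have := measurable_int _ iF => mF.
  by apply/measurable_EFinP; apply: (measurableT_comp _ mF) => //; exact: fine_measurable.
have E : {ae m1, forall x, setT x ->
    (EFin \o (fun x => \int[m2]_y f (x, y))) x = fubini_F m2 (EFin \o f) x}.
  have := integrable_ae measurableT iF; apply: filterS => x /(_ I) fx _ /=.
  by rewrite /Rintegral fineK.
split; first by rewrite -(integral12_prod_meas1 fi); congr fine; apply: ae_eq_integral => //; exact: measurable_int iF.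
apply/integrableP; split => //.
have /integrableP[_] := iF; apply: le_lt_trans.
rewrite le_eqVlt; apply/orP; left; apply/eqP; apply: ae_eq_integral => //.
- exact: measurableT_comp.
- by apply: measurableT_comp => //; exact: measurable_int iF.
- by apply: filterS E => x /(_ I) + _ => ->.
Qed.

Lemma Rintegral_iterated21 :
  \int[m2]_y \int[m1]_x f (x, y) = fine (\int[(m1 \x m2)%E]_z (f z)%:E)%E /\
  m2.-integrable setT (EFin \o (fun y => \int[m1]_x f (x, y))).
Proof.
have iF := integrable_fubini_G.
have mfF : measurable_fun setT (EFin \o (fun y => \int[m1]_x f (x, y))).
  have := measurable_int _ iF => mF.
  by apply/measurable_EFinP; apply: (measurableT_comp _ mF) => //; exact: fine_measurable.
have E : {ae m2, forall x, setT x ->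
    (EFin \o (fun y => \int[m1]_x f (x, y))) x = G x}.
  have := integrable_ae measurableT iF; apply: filterS => x /(_ I) fx _ /=.
  by rewrite /Rintegral fineK.
split; first by rewrite -(integral21_prod_meas1 fi); congr fine; apply: ae_eq_integral => //; exact: measurable_int iF.
apply/integrableP; split => //.
have /integrableP[_] := iF; apply: le_lt_trans.
rewrite le_eqVlt; apply/orP; left; apply/eqP; apply: ae_eq_integral => //.
- exact: measurableT_comp.
- by apply: measurableT_comp => //; exact: measurable_int iF.
- by apply: filterS E => x /(_ I) + _ => ->.
Qed.

End Rfubini.

(** * Testing a convolution with the Kelvin tensor *)

Section convolution.
Context {R : realType}.
Implicit Types (x y w : R * R * R) (m : 'I_3 -> nat).
Local Notation leb3 := (@lebesgue3 R).
Variables (lambda mu : R).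

Let al := (lambda + 3 * mu) / (8 * pi * mu * (lambda + 2 * mu)).
Let be := (lambda + mu) / (8 * pi * mu * (lambda + 2 * mu)).

Lemma Kelvin_kernelE x y i k : Kelvin lambda mu (x - y) i k = Kelvin_kernel al be y i k x.
Proof.
have E : euclid_norm (x - y) = dist y x.
  by congr Num.sqrt; apply: eq_bigr => p _; rewrite coordsE coB.
rewrite /Kelvin /Kelvin_kernel E !mxE -/al -/be exprVn; congr (_ + _).
  by rewrite -[LHS]mulr_natr mulrAC.
by rewrite big_ord1 [(_^T)%R _ _]mxE !coordsE !coB /off; ring.
Qed.

(** Limit of [Kelvin_reg_bound]; at x = y the kernel is 0 and so is the bound. *)
Lemma Kelvin_kernel_bound y k i x :
  `|Kelvin_kernel al be y k i x| <= (`|al| + `|be|) * (dist y x)^-1.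
Proof.
have [->|/eqP xy] := eqVneq x y.
  have -> : Kelvin_kernel al be y k i y = 0.
    by rewrite /Kelvin_kernel /off !subrr (eqP (_ : dist y y == 0)) ?dist_eq0// invr0; ring.
  by rewrite normr0 mulr_ge0 ?addr_ge0// invr_ge0 dist_ge0.
have h : `|Kelvin_reg y (eps n) al be k i x| @[n --> \oo] --> `|Kelvin_kernel al be y k i x|.
  by apply: cvg_norm; exact: Kelvin_reg_cvg.
rewrite -(cvg_lim _ h)//; apply: limr_le; first by apply/cvg_ex; eexists; exact: h.
by apply: nearW => n; apply: Kelvin_reg_bound => //; exact: eps_gt0.
Qed.

Variables (F : R * R * R -> 'cV[R]_3).
Hypothesis iF : forall k, leb3.-integrable setT (EFin \o (fun x => F x k 0)).

Lemma measurable_component k : measurable_fun setT (fun x => F x k 0).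
Proof. by apply/measurable_EFinP; exact: measurable_int (iF k). Qed.

Lemma convolutionE x i : convolution (Kelvin lambda mu) F x i 0 =
  \int[leb3]_y (\sum_(k < 3) Kelvin_kernel al be y i k x * F y k 0).
Proof.
rewrite /convolution /vector_integral mxE; apply: eq_Rintegral => y _.
by rewrite mxE; apply: eq_bigr => k _; rewrite Kelvin_kernelE.
Qed.

Lemma measurable_Kelvin_joint i k : measurable_fun setT
  (fun z : (R * R * R) * (R * R * R) => Kelvin_kernel al be z.1 i k z.2).
Proof.
have mo p : measurable_fun setT (fun z : (R * R * R) * (R * R * R) => off z.1 p z.2).
  apply: measurable_funB; apply: (measurableT_comp (measurable_co p)).
    exact: measurable_snd.
  exact: measurable_fst.
have md : measurable_fun setT (fun z : (R * R * R) * (R * R * R) => (dist z.1 z.2)^-1).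
  apply: (measurableT_comp (@measurable_inv R)).
  apply: (measurableT_comp (@measurable_sqrt R)); apply: measurable_sum => p.
  exact: measurable_funX.
apply: measurable_funD; first exact: measurable_funM.
apply: measurable_funM => //; apply: measurable_funM; last exact: measurable_funX.
exact: measurable_funM.
Qed.

Variables (phi : R * R * R -> R) (l r : 'I_3 -> R) (B : R).
Hypothesis lr : forall i, l i <= r i.
Hypothesis mphi : measurable_fun setT phi.
Hypothesis phiB : forall x, `|phi x| <= B.
Hypothesis phi0 : forall x, ~ box3 l r x -> phi x = 0.

Lemma Kelvin_phi_bound y i k x :
  `|Kelvin_kernel al be y i k x * phi x| <=
  ((`|al| + `|be|) * B) * ((dist y x)^-1 * \1_(box3 l r) x).
Proof.
have [bx|bx] := pselect (box3 l r x); last first.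
  by rewrite phi0// mulr0 normr0 indicE memNset// !mulr0.
rewrite indicE mem_set// mulr1 normrM mulrAC ler_pM//.
exact: Kelvin_kernel_bound.
Qed.

Lemma integrable_Kelvin_phi y i k :
  leb3.-integrable setT (EFin \o (fun x => Kelvin_kernel al be y i k x * phi x)).
Proof.
have g := integrableZl measurableT ((`|al| + `|be|) * B) (integrable_dist_inv y lr).
apply: (le_integrable measurableT _ _ g).
  by apply/measurable_EFinP; apply: measurable_funM => //; exact: measurable_Kelvin_kernel.
by move=> x _; rewrite /= lee_fin (le_trans (Kelvin_phi_bound _ _ _ _))// ler_norm.
Qed.

(** Tonelli: the integral over x is at most a constant times |F_k(y)|. The constant does not depend
    on y by [integral_dist_inv_bounded], and F_k is integrable. *)
Lemma integrable_Kelvin_joint i : (leb3 \x leb3)%E.-integrable setT (EFin \o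
  (fun z : (R * R * R) * (R * R * R) =>
     \sum_(k < 3) Kelvin_kernel al be z.1 i k z.2 * phi z.2 * F z.1 k 0)).
Proof.
apply: integrable_Rsum => k.
have mh : measurable_fun setT (EFin \o (fun z : (R * R * R) * (R * R * R) =>
    Kelvin_kernel al be z.1 i k z.2 * phi z.2 * F z.1 k 0)).
  apply/measurable_EFinP; apply: measurable_funM.
    apply: measurable_funM; first exact: measurable_Kelvin_joint.
    by apply: (measurableT_comp mphi); exact: measurable_snd.
  by apply: (measurableT_comp (measurable_component k)); exact: measurable_fst.
apply/(integrable12ltyP leb3 leb3 mh).
have [C HC] := integral_dist_inv_bounded lr.
pose c := (`|al| + `|be|) * B.
have B0 : 0 <= B by exact: le_trans (phiB 0).
have c0 : 0 <= c by rewrite mulr_ge0 ?addr_ge0.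
have C0 : 0 <= C.
  rewrite -lee_fin; apply: le_trans (HC 0); apply: integral_ge0 => x _.
  by rewrite lee_fin dist_inv_box_ge0.
apply: (@le_lt_trans _ _ (\int[leb3]_y ((c * C)%:E * `|(F y k 0)%:E|))%E).
  apply: ge0_le_integral => //.
  - by move=> y _; apply: integral_ge0.
  - apply: (@measurable_fun_fubini_tonelli_F _ _ _ _ _ leb3 (fun z => `|((Kelvin_kernel al be z.1 i k z.2 * phi z.2 * F z.1 k 0)%:E)|)%E).
      exact: measurableT_comp.
    by move=> z; exact: abse_ge0.
  - apply: measurable_funeM; apply: measurableT_comp => //.
    exact: measurable_int (iF k).
  move=> y _.
  apply: (@le_trans _ _ (\int[leb3]_x ((c * `|F y k 0|)%:E * ((dist y x)^-1 * \1_(box3 l r) x)%:E))%E).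
    apply: ge0_le_integral => //.
    - apply: measurableT_comp => //; apply/measurable_EFinP; apply: measurable_funM; last exact: (measurable_cst (F y k 0)).
      apply: measurable_funM => //; exact: measurable_Kelvin_kernel.
    - apply: measurable_funeM; apply/measurable_EFinP; exact: measurable_dist_inv_box.
    - move=> x _; rewrite -EFinM /= lee_fin normrM mulrAC ler_wpM2r//.
      exact: Kelvin_phi_bound.
  rewrite ge0_integralZl//.
  - by rewrite !EFinM [leRHS]muleAC lee_wpmul2l// lee_fin mulr_ge0.
  - apply/measurable_EFinP; exact: measurable_dist_inv_box.
  - by move=> x _; rewrite lee_fin dist_inv_box_ge0.
  - by rewrite lee_fin mulr_ge0.
rewrite ge0_integralZl//.
- rewrite lte_mul_pinfty ?lee_fin ?mulr_ge0//.
  by have /integrableP[] := iF k.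
- by apply: measurableT_comp => //; exact: measurable_int (iF k).
- by rewrite lee_fin mulr_ge0.
Qed.

(** Valid at every x, even where the convolution integral diverges, since both sides are then 0. *)
Lemma convolution_phiE i x : convolution (Kelvin lambda mu) F x i 0 * phi x =
  \int[leb3]_y (\sum_(k < 3) Kelvin_kernel al be y i k x * phi x * F y k 0).
Proof.
rewrite convolutionE mulrC -measurable_RintegralZl; last first.
  apply: measurable_sum => k; apply: measurable_funM; last exact: measurable_component.
  apply: (measurableT_comp (measurable_Kelvin_joint i k) (pair2_measurable x)).
apply: eq_Rintegral => y _; rewrite mulr_sumr; apply: eq_bigr => k _.
by rewrite mulrA (mulrC (phi x)).
Qed.

Lemma integrable_convolution_phi i :
  leb3.-integrable setT (EFin \o (fun x => convolution (Kelvin lambda mu) F x i 0 * phi x)).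
Proof.
have [_] := Rintegral_iterated21 (integrable_Kelvin_joint i).
by congr (leb3.-integrable _ _); apply/funext => x /=; rewrite convolution_phiE.
Qed.

(** Exchanging the integrals lets the kernel act on phi for fixed y, where the fundamental solution
    property applies. *)
Lemma Rintegral_convolution_phi i :
  \int[leb3]_x (convolution (Kelvin lambda mu) F x i 0 * phi x) =
  \int[leb3]_y (\sum_(k < 3) (\int[leb3]_x (Kelvin_kernel al be y i k x * phi x)) * F y k 0) /\
  leb3.-integrable setT (EFin \o (fun y =>
    \sum_(k < 3) (\int[leb3]_x (Kelvin_kernel al be y i k x * phi x)) * F y k 0)).
Proof.
have E y : \sum_(k < 3) (\int[leb3]_x (Kelvin_kernel al be y i k x * phi x)) * F y k 0 =
    \int[leb3]_x (\sum_(k < 3) Kelvin_kernel al be y i k x * phi x * F y k 0).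
  have ik k : leb3.-integrable setT (EFin \o (fun x => Kelvin_kernel al be y i k x * phi x * F y k 0)).
    exact: (integrableZr measurableT (F y k 0) (integrable_Kelvin_phi y i k)).
  rewrite (Rintegral_sum ik); apply: eq_bigr => k _.
  by rewrite RintegralZr//; exact: integrable_Kelvin_phi.
have [e1 i1] := Rintegral_iterated12 (integrable_Kelvin_joint i).
have [e2 _] := Rintegral_iterated21 (integrable_Kelvin_joint i).
split; last by move: i1; congr (leb3.-integrable _ _); apply/funext => y /=; rewrite E.
under eq_Rintegral do rewrite convolution_phiE.
under [RHS]eq_Rintegral do rewrite E.
by rewrite e1 e2.
Qed.

End convolution.

Section convolution_lame.
Context {R : realType}.
Implicit Types (x y w : R * R * R) (m : 'I_3 -> nat).
Local Notation leb3 := (@lebesgue3 R).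
Variables (lambda mu : R) (a : 'I_3 -> nat -> R -> R) (l r : 'I_3 -> R).
Hypothesis lr : forall i, l i <= r i.
Hypothesis ja : forall i, jet (a i).
Hypothesis va : forall i, vanishes_off (l i) (r i) (a i).
Hypothesis mu0 : 0 < mu.
Hypothesis la0 : 0 < lambda + 2 * mu.
Variables (F : R * R * R -> 'cV[R]_3).
Hypothesis iF : forall k, leb3.-integrable setT (EFin \o (fun x => F x k 0)).

(** With [kappa] equal to 4 * pi, this is the equation L (Gamma_0 * F) = -F, tested with the tensor
    times e_j. *)
Lemma convolution_lame m j :
  \sum_(i < 3) \int[leb3]_x (convolution (Kelvin lambda mu) F x i 0 * lame a lambda mu j m i x) =
  - (kappa / (4 * pi)) * \int[leb3]_y (tensor a m y * F y j 0).
Proof.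
pose al := (lambda + 3 * mu) / (8 * pi * mu * (lambda + 2 * mu)).
pose be := (lambda + mu) / (8 * pi * mu * (lambda + 2 * mu)).
have pi0 : (pi : R) != 0 by rewrite gt_eqF// pi_gt0.
have nz : (lambda + 2 * mu != 0) /\ (mu != 0) by rewrite !gt_eqF.
have ab : (al + be) * (lambda + mu) = 2 * be * (lambda + 2 * mu).
  by rewrite /al /be; move: (@pi R) pi0 => P P0; field; rewrite P0; case: nz => -> ->.
have abmu : (al + be) * mu = (4 * pi)^-1.
  by rewrite /al /be; move: (@pi R) pi0 => P P0; field; rewrite P0; case: nz => -> ->.
have H i : exists B : R, forall x, `|lame a lambda mu j m i x| <= B.
  by have [B _ HB] := lame_bounded ja va lambda mu j m i; exists B.
have E i : \int[leb3]_x (convolution (Kelvin lambda mu) F x i 0 * lame a lambda mu j m i x) =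
  \int[leb3]_y (\sum_(k < 3) (\int[leb3]_x (Kelvin_kernel al be y i k x * lame a lambda mu j m i x)) * F y k 0) /\
  leb3.-integrable setT (EFin \o (fun y =>
    \sum_(k < 3) (\int[leb3]_x (Kelvin_kernel al be y i k x * lame a lambda mu j m i x)) * F y k 0)).
  have [B HB] := H i.
  apply: (Rintegral_convolution_phi lambda mu iF lr _ HB).
    exact: measurable_lame.
  exact: lame_off.
under eq_bigr do rewrite (E _).1.
rewrite -Rintegral_sum; last by move=> i; exact: (E i).2.
have mT : measurable_fun setT (fun y => tensor a m y * F y j 0).
  by apply: measurable_funM; [exact: measurable_tensor|exact: measurable_component].
rewrite -measurable_RintegralZl//; apply: eq_Rintegral => y _.
rewrite exchange_big/=.
under eq_bigr => k _.
  rewrite -mulr_suml.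
  have -> : \sum_(i < 3) \int[leb3]_x (Kelvin_kernel al be y i k x * lame a lambda mu j m i x) =
    - ((al + be) * mu * kappa * (k == j)%:R * tensor a m y).
    rewrite -(Kelvin_fundamental_solution lr ja va j k m y ab); apply: eq_bigr => i _.
    apply: eq_Rintegral => x _; congr (_ * _).
    by rewrite /Kelvin_kernel eq_sym (mulrC (off y k x)).
  over.
rewrite (bigD1 j)//= eqxx [X in _ + X]big1 ?addr0; last first.
  by move=> k /negPf ->; rewrite mulr0 mul0r oppr0 mul0r.
by rewrite abmu mulr1; ring.
Qed.

End convolution_lame.

(** * Essential support and integrability of the data *)

Section essential_support.
Context {R : realType}.
Implicit Types (x y w : R * R * R).
Local Notation leb3 := (@lebesgue3 R).

Lemma normr_co i x : `|co i x| <= `|x|.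
Proof.
have n1 (u : R * R * R) : `|u.1| <= `|u| by rewrite [leRHS]prod_normE le_max lexx.
have n2 (u : R * R * R) : `|u.2| <= `|u| by rewrite [leRHS]prod_normE le_max lexx orbT.
have n3 (u : R * R) : `|u.1| <= `|u| /\ `|u.2| <= `|u|.
  by rewrite prod_normE !le_max !lexx orbT.
elim/ord3P: i.
- exact: le_trans (n3 x.1).1 (n1 x).
- exact: le_trans (n3 x.1).2 (n1 x).
- exact: n2.
Qed.

Lemma ball_co x e y : (forall i, `|co i x - co i y| < e) -> ball x e y.
Proof.
move=> h; split; first split.
- exact: (h ord0).
- exact: (h (@Ordinal 3 1 isT)).
- exact: (h (@Ordinal 3 2 isT)).
Qed.

(** Lindelof argument: each point outside the essential support lies in a box with rational centre
    and half-side 1 / (n + 1) on which F is 0 almost everywhere, and there are countably many such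
    boxes. *)
Lemma ae_ess_support (F : R * R * R -> 'cV[R]_3) :
  {ae leb3, forall x, ~ ess_support F x -> F x = 0}.
Proof.
pose B (c : rat * rat * rat * nat) : set (R * R * R) :=
  box3 (fun i => co i (ratr c.1.1.1, ratr c.1.1.2, ratr c.1.2) - eps c.2)
       (fun i => co i (ratr c.1.1.1, ratr c.1.1.2, ratr c.1.2) + eps c.2).
pose Z := [set y | F y != 0].
pose N (k : nat) : set (R * R * R) :=
  if unpickle k is Some c then
    if `[< leb3.-negligible (B c `&` Z) >] then B c `&` Z else set0
  else set0.
have N0 : leb3.-negligible (\bigcup_k N k).
  apply: negligible_bigcup => k; rewrite /N.
  case: unpickle => [c|]; last exact: negligible_set0.
  by case: asboolP => // _; exact: negligible_set0.
apply: negligibleS N0 => x /= /not_implyP[+ Fx] => /existsNP[U /not_implyP[Ux /contrapT UZ]].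
have [e /= e0 eU] := (nbhs_ballP x U).1 Ux.
(* The distance from x to the centre and the half-side, each at most eps n, add up to less than e,
   so the box stays in the ball. *)
have [n ne] : exists n, 2 * eps n < e.
  have : \forall n \near \oo, `|eps n| < e / 2 :> R.
    by move/cvgr0Pnorm_lt : (@eps_cvg0 R); apply; rewrite divr_gt0.
  move=> [n _ /(_ n (leqnn n))/=]; rewrite gtr0_norm ?eps_gt0// => h; exists n.
  by rewrite mulrC -ltr_pdivlMr.
have ep := @eps_gt0 R n.
have hq (i : 'I_3) : exists q : rat, co i x - eps n < ratr q < co i x + eps n.
  have : co i x - eps n < co i x + eps n by lra.
  by move=> /rat_in_itvoo[q]; rewrite in_itv/= => h; exists q.
have /boolp.choice[q Hq] := hq.
pose c : rat * rat * rat * nat := (q ord0, q (@Ordinal 3 1 isT), q (@Ordinal 3 2 isT), n).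
have cq i : co i ((ratr c.1.1.1, ratr c.1.1.2, ratr c.1.2) : R * R * R) = ratr (q i).
  by elim/ord3P: i.
have BU : B c `<=` U.
  move=> y By; apply: eU; apply: ball_co => i.
  have /andP[y1 y2] := By i; have /andP[q1 q2] := Hq i.
  rewrite cq in y1 y2; rewrite ltr_norml.
  by rewrite /= in y1 y2; apply/andP; split; lra.
have Bx : B c x.
  move=> i; rewrite cq; have /andP[q1 q2] := Hq i.
  by apply/andP; split => /=; lra.
exists (pickle c); first exact: I.
rewrite /N pickleK; case: asboolP => [_|nn].
  by split => //; apply/eqP.
exfalso; apply: nn; apply: negligibleS UZ => y [/BU Uy Zy]; by split.
Qed.

Lemma compact_box3 (K : set (R * R * R)) : compact K ->
  exists2 L : R, 0 <= L & K `<=` box3 (fun=> - L) (fun=> L).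
Proof.
move=> /compact_bounded[M [_ HM]]; exists (`|M| + 1); first by rewrite addr_ge0.
move=> x Kx i; rewrite -ler_norml (le_trans (normr_co i x))//.
by apply: (HM (`|M| + 1)) => //; rewrite (le_lt_trans (ler_norm _))// ltrDl.
Qed.

(** |t| <= 1 + t^2 on a box containing the essential support; outside it F is 0 almost
    everywhere. *)
Lemma L2c_integrable (Q : set (R * R * R)) (F : R * R * R -> 'cV[R]_3) k : L2c Q F ->
  leb3.-integrable setT (EFin \o (fun x => F x k 0)).
Proof.
move=> [F2 cF _].
have [L L0 KL] := compact_box3 cF.
pose B := @box3 R (fun=> - L) (fun=> L).
have i2 := Lfun2_integrable_sqr (F2 k).
have mF : measurable_fun setT (fun x => F x k 0).
  by have := F2 k; rewrite inE => /andP[]; rewrite inE.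
have i1 : leb3.-integrable setT (EFin \o (\1_B : R * R * R -> R)).
  apply: (@integrable_box3 _ (fun=> - L) (fun=> L) _ 1).
  - by apply: measurable_indic; exact: measurable_box3.
  - by move=> x; rewrite indicE; case: (x \in B); rewrite ?normr0 ?normr1.
  - by move=> x bx; rewrite indicE memNset.
have i3 := integrableD measurableT i1 i2.
apply/integrableP; split; first exact/measurable_EFinP.
apply: le_lt_trans (integrableP _ _ _ i3).2.
apply: ae_ge0_le_integral => //.
- by apply: measurableT_comp => //; exact/measurable_EFinP.
- by apply: measurableT_comp => //; exact: measurable_int i3.
- apply: ae3S (ae_ess_support F) => x Fx _ /=.
  have g0 : 0 <= \1_B x + F x k 0 ^+ 2 by rewrite addr_ge0 ?sqr_ge0// indicE.
  rewrite lee_fin (ger0_norm g0).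
  have [xB|xB] := pselect (B x).
    rewrite indicE mem_set//=.
    have := sqr_ge0 (`|F x k 0| - 1); rewrite sqrrB1 real_normK ?num_real//.
    have := normr_ge0 (F x k 0); have := sqr_ge0 (F x k 0); lra.
  rewrite Fx; first by rewrite mxE normr0 expr0n addr0 indicE.
  by move=> /KL.
Qed.

End essential_support.

(** * Product functions and their Lame images as test functions *)

Section test_functions.
Context {R : realType}.
Implicit Types (x y w : R * R * R) (m : 'I_3 -> nat).

Lemma continuous_co i : continuous (co i : R * R * R -> R).
Proof.
move=> x; apply/cvgrPdist_lt => e e0.
apply: (nbhs_ballP x [set y | `|co i x - co i y| < e]).2.
exists e => // y [[h0 h1] h2].
by elim/ord3P: i.
Qed.

Lemma is_derive_co i (f : R -> R) (f' : R) x v : is_derive (co i x) (1 : R) f f' ->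
  is_derive x v (fun x => f (co i x)) (co i v * f').
Proof.
move=> /(is_deriveZdir (co i v))[df Df].
have E : (fun h : R => h^-1 *: (f (co i (h *: v + x)) - f (co i x))) =
    (fun h : R => h^-1 *: (f (h *: co i v + co i x) - f (co i x))).
  by apply/funext => h; elim/ord3P: i {df Df}.
by split; [rewrite /derivable E|rewrite /derive E].
Qed.

Lemma Ck_comp_co n i (a : nat -> R -> R) k : jet a -> Ck n (fun x : R * R * R => a k (co i x)).
Proof.
move=> ja; have cc p : continuous (fun x : R * R * R => a p (co i x)).
  by move=> x; apply: continuous_comp; [exact: continuous_co|exact: jet_continuous].
elim: n k => [|n IH] k; first by split => //; exact: cc.
split; first exact: cc.
move=> v; exists (fun x => co i v * a k.+1 (co i x)).
  by move=> x; apply: is_derive_co; exact: ja.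
by apply: CkM => //; exact: Ck_cst.
Qed.

Variables (a : 'I_3 -> nat -> R -> R) (l r : 'I_3 -> R).
Hypothesis ja : forall i, jet (a i).
Hypothesis va : forall i, vanishes_off (l i) (r i) (a i).

Lemma Ck_tensor n m : Ck n (tensor a m).
Proof.
have -> : tensor a m = fun x => a ord0 (m ord0) (co ord0 x) *
   (a (lift ord0 ord0) (m (lift ord0 ord0)) (co (lift ord0 ord0) x) *
   a (lift ord0 (lift ord0 ord0)) (m (lift ord0 (lift ord0 ord0))) (co (lift ord0 (lift ord0 ord0)) x)).
  by apply/funext => x; rewrite /tensor !big_ord_recl big_ord0 mulr1.
apply: CkM; first exact: Ck_comp_co.
by apply: CkM; exact: Ck_comp_co.
Qed.

Lemma Ck_lame n lambda mu j m i : Ck n (lame a lambda mu j m i).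
Proof.
apply: CkD; last by apply: CkM; [exact: Ck_cst|exact: Ck_tensor].
apply: CkM; first exact: Ck_cst.
have -> : (fun x => \sum_(p < 3) tensor a (bump_index (bump_index m p) p) x) =
  fun x => tensor a (bump_index (bump_index m ord0) ord0) x +
  (tensor a (bump_index (bump_index m (lift ord0 ord0)) (lift ord0 ord0)) x +
   tensor a (bump_index (bump_index m (lift ord0 (lift ord0 ord0))) (lift ord0 (lift ord0 ord0))) x).
  by apply/funext => x; rewrite !big_ord_recl big_ord0 addr0.
by apply: CkD; [exact: Ck_tensor|apply: CkD; exact: Ck_tensor].
Qed.

Lemma compact_box3_set : compact (box3 l r).
Proof.
by rewrite box3E; apply: compact_setX; [apply: compact_setX|]; exact: segment_compact.
Qed.

Lemma test_function_of_Ck (Q : set (R * R * R)) phi : (forall n, Ck n phi) ->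
  (forall x, ~ box3 l r x -> phi x = 0) -> box3 l r `<=` Q -> test_function Q phi.
Proof.
move=> Cphi phi0 bQ.
have cb := compact_box3_set.
have clb : closed (box3 l r).
  by apply: compact_closed cb; exact: norm_hausdorff.
have sb : tsupport phi `<=` box3 l r.
  rewrite [X in _ `<=` X]((closure_id _).1 clb).
  apply: closureS => x /eqP phix; apply: contrapT => /phi0; exact: phix.
split; first exact: Ck_smooth.
- by apply: (subclosed_compact _ cb) => //; exact: closed_closure.
- exact: subset_trans bQ.
Qed.

End test_functions.

(** * Vanishing integrals over lines, horizontal slices and the space *)

Section slices.
Context {R : realType}.
Implicit Types (x y w : R * R * R) (m : 'I_3 -> nat).
Local Notation leb := (@lebesgue_measure R).
Local Notation leb2 := (@lebesgue2 R).
Local Notation leb3 := (@lebesgue3 R).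
Variables (a : 'I_3 -> nat -> R -> R) (l r : 'I_3 -> R).
Hypothesis ja : forall i, jet (a i).
Hypothesis va : forall i, vanishes_off (l i) (r i) (a i).
Variables lambda mu : R.

(** The Lame operator has constant coefficients, so it commutes with d_p, and a derivative again
    amounts to raising the index. *)
Lemma is_derive_lame j m i p x t :
  is_derive t (1 : R) (fun t => lame a lambda mu j m i (upd p x t))
    (lame a lambda mu j (bump_index m p) i (upd p x t)).
Proof.
have dT q q' : is_derive t (1 : R)
    (fun t => tensor a (bump_index (bump_index m q) q') (upd p x t))
    (tensor a (bump_index (bump_index (bump_index m p) q) q') (upd p x t)).
  have := is_derive_tensor ja (bump_index (bump_index m q) q') p x t.
  by rewrite (bump_indexC _ q' p) (bump_indexC m q p).
have dS : is_derive t (1 : R)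
    (fun t => \sum_(q < 3) tensor a (bump_index (bump_index m q) q) (upd p x t))
    (\sum_(q < 3) tensor a (bump_index (bump_index (bump_index m p) q) q) (upd p x t)).
  rewrite !big_ord_recl !big_ord0.
  under eq_fun do rewrite !big_ord_recl big_ord0.
  exact: is_deriveD.
exact: (is_deriveD (is_deriveZ (mu * (i == j)%:R) dS) (is_deriveZ (lambda + mu) (dT i j))).
Qed.

Lemma Rintegral_lame_line j m i p x :
  \int[leb]_t lame a lambda mu j (bump_index m p) i (upd p x t) = 0.
Proof.
apply: (@Rintegral_derive0 _ (fun t => lame a lambda mu j m i (upd p x t)) _ (l p) (r p)).
- by apply: derive_continuous => t; exact: is_derive_lame.
- by move=> t; exact: is_derive_lame.
- move=> t tlr; apply: (lame_off va) => /(_ p); rewrite co_upd eqxx.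
  by apply/negP; rewrite negb_and -!ltNge.
Qed.

Lemma Rintegral_lame0 j m i p : \int[leb3]_x lame a lambda mu j (bump_index m p) i x = 0.
Proof.
have [C _ HC] := lame_bounded ja va lambda mu j (bump_index m p) i.
apply: (@Rintegral_slice0 _ l r _ C p).
- exact: measurable_lame.
- exact: HC.
- exact: lame_off.
- by move=> x; exact: Rintegral_lame_line.
Qed.

(** The raised direction [ord0] lies in the slice; this is what makes [chi] invisible. *)
Lemma Rintegral_lame_slice j m i t :
  \int[leb2]_z lame a lambda mu j (bump_index m ord0) i (z, t) = 0.
Proof.
have [C _ HC] := lame_bounded ja va lambda mu j (bump_index m ord0) i.
have fi : leb2.-integrable setT
    (EFin \o (fun z => lame a lambda mu j (bump_index m ord0) i (z, t))).
  apply: (@integrable_bounded _ _ _ leb2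
    (`[l ord0, r ord0] `*` `[l (@Ordinal 3 1 isT), r (@Ordinal 3 1 isT)]) _ C) => //.
  - exact: measurableX.
  - exact: box2_lty.
  - apply: (measurableT_comp (measurable_lame ja _ _ _ _ _)); exact: measurable_fun_pair.
  - move=> z nz; apply: (lame_off va); rewrite box3E => -[h12 _]; exact: nz h12.
have [E _] := @Rintegral_iterated21 _ _ _ _ R leb leb _ fi.
refine (etrans (esym E) _).
by apply: Rintegral0_eq => z _; exact: (Rintegral_lame_line j m i ord0 (0, z, t)).
Qed.

End slices.

(** * Elimination of the distribution *)

Section orthogonality.
Context {R : realType}.
Implicit Types (x y w : R * R * R) (m : 'I_3 -> nat).
Local Notation leb2 := (@lebesgue2 R).
Local Notation leb3 := (@lebesgue3 R).

Lemma distribution0 (V : normedModType R) (Omega : set V) (T : (V -> R) -> R) :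
  is_distribution Omega T -> T (fun=> 0) = 0.
Proof.
have t0 : test_function Omega (fun=> 0).
  have E : tsupport (fun=> 0 : R) = set0 :> set V.
    rewrite /tsupport (_ : [set x | _] = set0) ?closure0//.
    by apply/seteqP; split => x //=; rewrite eqxx.
  split; first by apply: Ck_smooth => n; exact: Ck_cst.
  - by rewrite E; exact: compact0.
  - by rewrite E.
move=> [/(_ 1 _ _ t0 t0) + _].
rewrite (_ : (fun x : V => 1 * 0 + 0) = fun=> 0); last by apply/funext => x; rewrite mulr0 addr0.
by rewrite mul1r => /eqP; rewrite -subr_eq0 opprD addrA subrr sub0r oppr_eq0 => /eqP.
Qed.

Lemma Rintegral_vanishing (Q : set (R * R * R)) (f : R * R * R -> R) :
  (forall x, ~ Q x -> f x = 0) -> \int[leb3]_(x in Q) f x = \int[leb3]_x f x.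
Proof.
move=> f0; rewrite Rintegral_mkcond; apply: eq_Rintegral => x _.
by rewrite patchE; case: ifPn => // /negP xQ; rewrite f0// => Qx; apply: xQ; rewrite inE.
Qed.

Variables (lambda mu : R) (D : set (R * R)) (I : set R).
Hypothesis mu_gt0 : 0 < mu.
Hypothesis la_gt0 : 0 < lambda + 2 * mu.
Let Q : set (R * R * R) := D `*` I.
Variables (F G : R * R * R -> 'cV[R]_3) (c : R) (v M : 'cV[R]_3) (chi : (R -> R) -> R).
Hypothesis iF : forall k, leb3.-integrable setT (EFin \o (fun x => F x k 0)).
Hypothesis iG : forall k, leb3.-integrable setT (EFin \o (fun x => G x k 0)).
Hypothesis chiI : is_distribution I chi.
Hypothesis eqU : forall i : 'I_3, eq_distribution Q
  (regular_distribution Q (fun x => (convolution (Kelvin lambda mu) F x - v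
     - c *: convolution (Kelvin lambda mu) G x) i 0))
  (fun phi => M i 0 * tensor1 D chi phi).

(** Summing over i the components of the equation, tested with [phi i], makes [convolution_lame]
    apply to both convolutions, with the same nonzero factor. *)
Lemma density_orthogonal (a : 'I_3 -> nat -> R -> R) (l r : 'I_3 -> R) m j :
  (forall i, l i <= r i) -> (forall i, jet (a i)) ->
  (forall i, vanishes_off (l i) (r i) (a i)) -> box3 l r `<=` Q ->
  \int[leb3]_y ((F y j 0 - c * G y j 0) * tensor a (bump_index m ord0) y) = 0.
Proof.
move=> lr ja va bQ.
pose phi := lame a lambda mu j (bump_index m ord0).
have phi0 i x : ~ box3 l r x -> phi i x = 0 by exact: lame_off.
have E i : \int[leb3]_x (convolution (Kelvin lambda mu) F x i 0 * phi i x) =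
    c * \int[leb3]_x (convolution (Kelvin lambda mu) G x i 0 * phi i x).
  have tphi : test_function Q (phi i).
    apply: (@test_function_of_Ck R l r) => //; last exact: phi0.
    by move=> n; exact: Ck_lame.
  have := eqU i tphi.
  (* [tensor1] feeds [chi] the integrals over D of the slices, which equal those over the plane
     since [phi i] vanishes outside Q. *)
  have -> : tensor1 D chi (phi i) = 0.
    rewrite /tensor1 -[RHS](distribution0 chiI); congr chi; apply/funext => t.
    rewrite -[RHS](Rintegral_lame_slice ja va lambda mu j m i t) Rintegral_mkcond.
    apply: eq_Rintegral => z _; rewrite patchE; case: ifPn => // /negP zD.
    rewrite -/(phi i (z, t)) phi0// => /bQ[/= Dz _]; apply: zD; by rewrite inE.
  rewrite mulr0 /regular_distribution Rintegral_vanishing; last first.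
    by move=> x Qx; rewrite phi0 ?mulr0// => /bQ.
  have [B _ HB] := lame_bounded ja va lambda mu j (bump_index m ord0) i.
  have mphi : measurable_fun setT (phi i) by exact: measurable_lame.
  have i1 := integrable_convolution_phi lambda mu iF lr mphi HB (phi0 i) i.
  have i2 := integrable_convolution_phi lambda mu iG lr mphi HB (phi0 i) i.
  have i3 : leb3.-integrable setT (EFin \o phi i) by exact: integrable_box3 mphi HB (phi0 i).
  have -> : (fun x => (convolution (Kelvin lambda mu) F x - v
     - c *: convolution (Kelvin lambda mu) G x) i 0 * phi i x) =
    (fun x => convolution (Kelvin lambda mu) F x i 0 * phi i x - v i 0 * phi i x -
      c * (convolution (Kelvin lambda mu) G x i 0 * phi i x)).
    by apply/funext => x; rewrite !mxE; ring.
  rewrite RintegralB//; last 2 first.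
  - exact: (integrableB measurableT i1 (integrableZl measurableT (v i 0) i3)).
  - exact: (integrableZl measurableT c i2).
  rewrite RintegralB//; last exact: (integrableZl measurableT (v i 0) i3).
  rewrite RintegralZl// RintegralZl// (Rintegral_lame0 ja va lambda mu j m i ord0).
  by rewrite mulr0 subr0 => /eqP; rewrite subr_eq0 => /eqP.
have /eqP := convolution_lame lr ja va mu_gt0 la_gt0 iF (bump_index m ord0) j.
under eq_bigr do rewrite E.
rewrite -mulr_sumr (convolution_lame lr ja va mu_gt0 la_gt0 iG (bump_index m ord0) j).
rewrite -subr_eq0 => /eqP H.
have iT (K : R * R * R -> 'cV[R]_3) : (forall k, leb3.-integrable setT (EFin \o (fun x => K x k 0))) ->
    leb3.-integrable setT (EFin \o (fun y => tensor a (bump_index m ord0) y * K y j 0)).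
  move=> iK; have [C C0 HC] := tensor_bounded ja va (bump_index m ord0).
  apply: (le_integrable measurableT _ _ (integrableZl measurableT C (iK j))).
    apply/measurable_EFinP; apply: measurable_funM; first exact: measurable_tensor.
    exact: measurable_component.
  by move=> x _; rewrite /= lee_fin !normrM ler_wpM2r// (le_trans (HC x))// ler_norm.
have kp : kappa / (4 * pi) != 0 :> R.
  by rewrite mulf_neq0 ?gt_eqF ?kappa_gt0// invr_gt0 mulr_gt0// pi_gt0.
have -> : (fun y => (F y j 0 - c * G y j 0) * tensor a (bump_index m ord0) y) =
  (fun y => tensor a (bump_index m ord0) y * F y j 0 - c * (tensor a (bump_index m ord0) y * G y j 0)).
  by apply/funext => y; ring.
rewrite RintegralB//; [|exact: iT|exact: (integrableZl measurableT c (iT _ iG))].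
rewrite RintegralZl//; last exact: iT.
apply: (mulfI kp); rewrite mulr0; move: H; move: (\int[leb3]_x _) (\int[leb3]_x _) => p q H.
by rewrite -[RHS]H; ring.
Qed.

End orthogonality.

(** * Functions whose integrals over small boxes vanish *)

Section dynkin.
Context {R : realType}.
Implicit Types (x y w : R * R * R).
Local Notation leb3 := (@lebesgue3 R).
Variable H : R * R * R -> R.
Hypothesis iH : leb3.-integrable setT (EFin \o H).

(** Pi-lambda theorem for preimages under h, relative to a fixed set E. The set E carries the
    constraints on the other coordinates, so that they can be treated one at a time. *)
Lemma integral_preimage0 d (T : measurableType d) (h : R * R * R -> T) (E : set (R * R * R))
    (S : set (set T)) : measurable_fun setT h -> measurable E ->
  @measurable d T = <<s S >> -> setI_closed S ->
  (\int[leb3]_(x in E) (H x)%:E = 0)%E ->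
  (forall A, S A -> (\int[leb3]_(x in E `&` h @^-1` A) (H x)%:E = 0)%E) ->
  forall A, measurable A -> (\int[leb3]_(x in E `&` h @^-1` A) (H x)%:E = 0)%E.
Proof.
move=> mh mE mS SI E0 S0 A mA.
have mp B : measurable B -> measurable (E `&` h @^-1` B).
  by move=> mB; apply: measurableI => //; rewrite -[X in measurable X]setTI; exact: mh.
have iHS B : measurable B -> leb3.-integrable B (EFin \o H).
  by move=> mB; apply: integrableS iH.
apply: (@dynkin_induction _ T S (fun A => (\int[leb3]_(x in E `&` h @^-1` A) (H x)%:E = 0)%E)) => //.
- by rewrite preimage_setT setIT.
- move=> B mB B0.
  have : (\int[leb3]_(x in (E `&` h @^-1` B) `|` (E `&` h @^-1` (~` B))) (H x)%:E = 0)%E.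
    by rewrite -setIUr -preimage_setU setUv preimage_setT setIT.
  rewrite integral_setU//.
  - by rewrite B0 add0e.
  - exact: mp.
  - by apply: mp; exact: measurableC.
  - by apply: (measurable_int leb3); apply: iHS; apply: measurableU; apply: mp => //; exact: measurableC.
  - apply/disj_setPS => x [[_ Bx] [_ nBx]]; exact: nBx.
- move=> F mF tF F0.
  rewrite preimage_bigcup setI_bigcupr integral_bigcup.
  + by apply: eseries0 => i _ _; exact: F0.
  + apply/trivIsetP => i j _ _ ij; rewrite setIACA setIid -preimage_setI.
    by move/trivIsetP : tF => /(_ i j I I ij) ->; rewrite preimage_set0 setI0.
  + by move=> k; exact: mp.
  + by apply: iHS; apply: bigcup_measurable => k _; exact: mp.
- by rewrite -mS.
Qed.

Lemma integral_indicE A : (\int[leb3]_(x in A) (H x)%:E = \int[leb3]_x (H x * \1_A x)%:E)%E.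
Proof.
rewrite integral_mkcond; apply: eq_integral => x _; rewrite patchE indicE.
by case: ifPn => _; rewrite ?mulr1 ?mulr0.
Qed.

Lemma integrableM_indic A : measurable A ->
  leb3.-integrable setT (EFin \o (fun x => H x * \1_A x)).
Proof.
move=> mA; apply: (le_integrable measurableT _ _ iH).
  apply/measurable_EFinP; apply: measurable_funM; last exact: measurable_indic.
  by apply/measurable_EFinP; exact: measurable_int iH.
move=> x _; rewrite /= lee_fin indicE.
by case: (x \in A); rewrite ?mulr1 // mulr0 normr0.
Qed.

(** Long intervals are cut into pieces of length at most [del]; Borel sets follow because half-open
    intervals form a generating pi-system. *)
Lemma integral_co_preimage0 (del : R) (E : set (R * R * R)) i : 0 < del -> measurable E ->
  (forall p q, p <= q -> q <= p + del ->
    (\int[leb3]_(x in E `&` co i @^-1` `]p, q]) (H x)%:E = 0)%E) ->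
  forall B : set R, measurable B -> (\int[leb3]_(x in E `&` co i @^-1` B) (H x)%:E = 0)%E.
Proof.
move=> del0 mE small.
have mp (B : set R) : measurable B -> measurable (E `&` co i @^-1` B).
  move=> mB; apply: measurableI => //; rewrite -[X in measurable X]setTI.
  exact: measurable_co.
have step n : forall p q, q <= p + n%:R * del ->
    (\int[leb3]_(x in E `&` co i @^-1` `]p, q]) (H x)%:E = 0)%E.
  elim: n => [|n IH] p q.
    rewrite mul0r addr0 => qp; rewrite set_itv_ge ?bnd_simp -?leNgt//.
    by rewrite preimage_set0 setI0 integral_set0.
  move=> qpn; have [qp|pq] := leP q p.
    rewrite set_itv_ge ?bnd_simp -?leNgt//.
    by rewrite preimage_set0 setI0 integral_set0.
  have [qd|dq] := leP q (p + del); first by apply: small => //; exact: ltW.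
  have -> : `]p, q]%classic = `]p, p + del] `|` `]p + del, q] :> set R.
    by rewrite -itv_bndbnd_setU// bnd_simp ?lerDl ltW.
  rewrite preimage_setU setIUr integral_setU.
  - have pd : p <= p + del by rewrite lerDl ltW.
    rewrite (small _ _ pd (lexx _)) add0e; apply: IH.
    by rewrite (le_trans qpn)// -addn1 natrD mulrDl mul1r; lra.
  - exact: mp.
  - exact: mp.
  - apply: (measurable_int leb3); apply: integrableS iH => //.
    by apply: measurableU; exact: mp.
  - apply/disj_setPS => x [[_ /=]]; rewrite in_itv/= => /andP[_ h1] [_ /=].
    by rewrite in_itv/= => /andP[]; rewrite ltNge h1.
have all p q : (\int[leb3]_(x in E `&` co i @^-1` `]p, q]) (H x)%:E = 0)%E.
  apply: (step (Num.truncn (`|q - p| / del)).+1); rewrite -lerBlDl.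
  rewrite (le_trans (ler_norm _))// -ler_pdivrMr// ltW//.
  by rewrite truncnS_gt.
suff : forall B : set (measurableTypeR R), measurable B ->
    (\int[leb3]_(x in E `&` co i @^-1` B) (H x)%:E = 0)%E by exact.
have HH := @integral_preimage0 _ (measurableTypeR R) (co i) E (@ocitv R).
apply: HH => //.
- exact: measurable_co.
- exact: ocitvI.
- pose A k := E `&` co i @^-1` `](- k%:R : R), k%:R].
  have iA k := integrableM_indic (mp _ (measurable_itv `](- k%:R : R), k%:R])).
  (* The case of the whole line, needed to start the pi-lambda argument, comes from exhausting it by
     ]-k, k]. *)
  have h : (fun k => \int[leb3]_x (H x * \1_(A k) x)) @ \oo --> \int[leb3]_x (H x * \1_E x).
    apply: (@cvg_Rintegral_dominated _ _ _ leb3 _ _ (fun x => `|H x|)).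
    - by move=> k; apply/measurable_EFinP; exact: measurable_int (iA k).
    - by apply/measurable_EFinP; exact: measurable_int (integrableM_indic mE).
    - exact: (integrable_norm iH).
    - apply: (@aeW _ _ _ leb3) => x; split.
        move=> k; rewrite normrM indicE; case: (x \in A k); by rewrite ?normr1 ?mulr1// normr0 mulr0.
      apply: cvg_near_cst; exists (Num.truncn `|co i x|).+1 => // k /= kx.
      congr (_ * _); rewrite !indicE; congr (nat_of_bool _)%:R.
      apply/idP/idP => /set_mem h; apply/mem_set; first by case: h.
      split => //=; rewrite in_itv/=.
      have : `|co i x| < k%:R by rewrite (lt_le_trans (truncnS_gt _))// ler_nat.
      by rewrite ltr_norml => /andP[-> /ltW].
  have h0 : (fun k => \int[leb3]_x (H x * \1_(A k) x)) = cst 0.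
    by apply/funext => k; rewrite /Rintegral -integral_indicE all.
  have E1 : \int[leb3]_x (H x * \1_E x) = 0.
    by move: h; rewrite h0 => h; rewrite -(cvg_lim (@Rhausdorff R) h) (lim_cst (@Rhausdorff R)).
  rewrite integral_indicE -[LHS]fineK; first by congr EFin; exact: E1.
  by have := integrable_fin_num measurableT (integrableM_indic mE).
- by move=> _ [[p q] _ <-]; exact: all.
Qed.

Lemma ae_eq0_of_small_boxes (del : R) : 0 < del ->
  (forall p q : 'I_3 -> R, (forall i, p i <= q i) -> (forall i, q i <= p i + del) ->
    \int[leb3]_x (H x * \1_[set x | forall i, p i < co i x <= q i] x) = 0) ->
  {ae leb3, forall x, H x = 0}.
Proof.
move=> del0 small.
pose i0 : 'I_3 := ord0; pose i1 : 'I_3 := @Ordinal 3 1 isT; pose i2 : 'I_3 := @Ordinal 3 2 isT.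
have mco i (B : set R) : measurable B -> measurable (co i @^-1` B : set (R * R * R)).
  by move=> mB; rewrite -[X in measurable X]setTI; exact: measurable_co.
(* From [s3] to [s0] the short intervals are replaced by Borel sets, one coordinate at a time; [t1]
   and [t0] pass from products to measurable sets of the plane and of the space. *)
have s3 p0 q0 p1 q1 p2 q2 : p0 <= q0 -> q0 <= p0 + del -> p1 <= q1 -> q1 <= p1 + del ->
    p2 <= q2 -> q2 <= p2 + del ->
    (\int[leb3]_(x in (co i0 @^-1` `]p0, q0] `&` co i1 @^-1` `]p1, q1]) `&` co i2 @^-1` `]p2, q2]) (H x)%:E = 0)%E.
  move=> *; set A := _ `&` _.
  have mA : measurable A by apply: measurableI; [apply: measurableI|]; exact: mco.
  rewrite integral_indicE -[LHS]fineK; last first.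
    by have := integrable_fin_num measurableT (integrableM_indic mA).
  congr EFin.
  rewrite -[RHS](small (fun i => [:: p0; p1; p2]`_i) (fun i => [:: q0; q1; q2]`_i)).
  - apply: eq_Rintegral => x _; congr (_ * \1__ x); apply/seteqP; split => y /=.
      by rewrite /A /= !in_itv/= => -[[h0 h1] h2]; elim/ord3P.
    by move=> h; rewrite /A/= !in_itv/=; split; [split; [exact: (h i0)|exact: (h i1)]|exact: (h i2)].
  - by elim/ord3P.
  - by elim/ord3P.
have s2 p0 q0 p1 q1 (C : set R) : p0 <= q0 -> q0 <= p0 + del -> p1 <= q1 -> q1 <= p1 + del ->
    measurable C ->
    (\int[leb3]_(x in (co i0 @^-1` `]p0, q0] `&` co i1 @^-1` `]p1, q1]) `&` co i2 @^-1` C) (H x)%:E = 0)%E.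
  move=> h1 h2 h3 h4; apply: (integral_co_preimage0 del0).
    by apply: measurableI; exact: mco.
  by move=> p q h5 h6; exact: s3.
have s1 p0 q0 (B C : set R) : p0 <= q0 -> q0 <= p0 + del -> measurable B -> measurable C ->
    (\int[leb3]_(x in (co i0 @^-1` `]p0, q0] `&` co i2 @^-1` C) `&` co i1 @^-1` B) (H x)%:E = 0)%E.
  move=> h1 h2 mB mC; move: B mB; apply: (integral_co_preimage0 del0).
    by apply: measurableI; exact: mco.
  by move=> p q h5 h6; rewrite setIAC; exact: s2.
have s0 (A B C : set R) : measurable A -> measurable B -> measurable C ->
    (\int[leb3]_(x in (co i1 @^-1` B `&` co i2 @^-1` C) `&` co i0 @^-1` A) (H x)%:E = 0)%E.
  move=> mA mB mC; move: A mA; apply: (integral_co_preimage0 del0).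
    by apply: measurableI; exact: mco.
  by move=> p q h5 h6; rewrite setIC setIA setIAC; exact: s1.
have t1 (C : set R) : measurable C -> forall A : set (R * R), measurable A ->
    (\int[leb3]_(x in co i2 @^-1` C `&` fst @^-1` A) (H x)%:E = 0)%E.
  move=> mC.
  have HH := @integral_preimage0 _ (measurableTypeR R * measurableTypeR R)%type fst
    (co i2 @^-1` C) [set A `*` B | A in measurable & B in measurable].
  apply: HH.
  - exact: measurable_fst.
  - exact: mco.
  - exact: measurable_prod_measurableType.
  - move=> _ _ [A mA [B mB <-]] [A' mA' [B' mB' <-]].
    by exists (A `&` A'); [exact: measurableI|exists (B `&` B'); [exact: measurableI|rewrite setXI]].
  - have := s0 setT setT C measurableT measurableT mC.
    by rewrite !preimage_setT setTI setIT.
  - move=> _ [A mA [B mB <-]]; have -> : co i2 @^-1` C `&` fst @^-1` (A `*` B) =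
        (co i1 @^-1` B `&` co i2 @^-1` C) `&` co i0 @^-1` A.
      by apply/seteqP; split => -[[x1 x2] x3]/= => [[? []]|[[]]].
    exact: s0.
have t0 (A : set (R * R * R)) : measurable A -> (\int[leb3]_(x in A) (H x)%:E = 0)%E.
  move=> mA; have : (\int[leb3]_(x in setT `&` id @^-1` A) (H x)%:E = 0)%E; last first.
    by rewrite preimage_id setTI.
  move: A mA.
  have HH := @integral_preimage0 _ (measurableTypeR R * measurableTypeR R * measurableTypeR R)%type
    id setT [set A `*` B | A in measurable & B in measurable].
  apply: HH.
  - exact: measurable_id.
  - exact: measurableT.
  - exact: measurable_prod_measurableType.
  - move=> _ _ [A mA [B mB <-]] [A' mA' [B' mB' <-]].
    by exists (A `&` A'); [exact: measurableI|exists (B `&` B'); [exact: measurableI|rewrite setXI]].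
  - have := t1 setT measurableT setT measurableT.
    by rewrite !preimage_setT setTI.
  - move=> _ [A mA [B mB <-]]; have -> : setT `&` id @^-1` (A `*` B) =
        co i2 @^-1` B `&` fst @^-1` A.
      by apply/seteqP; split => -[x1 x2]/= => [[_ []]|[]].
    exact: t1.
have : ae_eq leb3 setT (EFin \o H) (cst 0%E).
  apply: (integral_ae_eq measurableT iH) => [|E _ mE]; first exact: measurable_cst.
  by rewrite t0// integral0.
by apply: ae3S => x /(_ Logic.I) [].
Qed.

End dynkin.

(** * The translation argument *)

Lemma jet_shift (R : realType) (a : nat -> R -> R) (p : R) : jet a -> jet (fun k x => a k (x - p)).
Proof.
move=> ja; have := jet_affine 1 p ja.
by congr jet; apply/funext => k; apply/funext => x; rewrite expr1n !mul1r.
Qed.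

Section vanishing.
Context {R : realType}.
Implicit Types (x y w : R * R * R) (m : 'I_3 -> nat) (K Q : set (R * R * R)).
Local Notation leb := (@lebesgue_measure R).
Local Notation leb3 := (@lebesgue3 R).

Lemma compact_margin K Q : compact K -> open Q -> K `<=` Q ->
  exists2 del : R, 0 < del & forall x y, K x -> (forall i, `|co i x - co i y| <= del) -> Q y.
Proof.
move=> cK oQ KQ.
have : \forall e \near 0^'+, K `<=` [set x | ball x e `<=` Q].
  apply: (compact_near_coveringP _).1 => // x Kx.
  have /nbhs_ballP[e /= e0 eQ] : nbhs x Q by apply: open_nbhs_nbhs; split => //; exact: KQ.
  exists (ball x (e / 2), [set s | s < e / 2]) => /=.
    split; first by apply: nbhsx_ballx; rewrite divr_gt0.
    by apply: nbhs_right_lt; rewrite divr_gt0.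
  move=> [y s] [/= xy se] z yz; apply: eQ.
  by rewrite [e]splitr; apply: ball_triangle xy _; exact: le_ball (ltW se) _ yz.
rewrite near_withinE => -[e /= e0 He].
have e20 : 0 < e / 2 by rewrite divr_gt0.
have HK := He (e / 2) _ e20.
(* The ball is open and the margin condition is not strict, hence e / 4 for a ball of radius e /
   2. *)
exists (e / 4) => [|x y Kx xy]; first by rewrite divr_gt0.
apply: (HK _ x Kx).
  by rewrite /ball/= sub0r normrN gtr0_norm// ltr_pdivrMr// ltr_pMr// ltr1n.
apply: ball_co => i; rewrite (le_lt_trans (xy i))// ltr_pM2l// ltf_pV2 ?posrE// ltr_nat//.
Qed.

Variables (H : R * R * R -> R) (K Q : set (R * R * R)).
Hypothesis iH : leb3.-integrable setT (EFin \o H).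
Hypothesis cK : compact K.
Hypothesis H0 : {ae leb3, forall x, ~ K x -> H x = 0}.
Hypothesis orth : forall (a : 'I_3 -> nat -> R -> R) (l r : 'I_3 -> R) m,
  (forall i, l i <= r i) -> (forall i, jet (a i)) ->
  (forall i, vanishes_off (l i) (r i) (a i)) -> box3 l r `<=` Q ->
  \int[leb3]_y (H y * tensor a (bump_index m ord0) y) = 0.

Lemma Rintegral_tensor_disjoint a l r m : (forall i, jet (a i)) ->
  (forall i, vanishes_off (l i) (r i) (a i)) -> (forall x, K x -> ~ box3 l r x) ->
  \int[leb3]_y (H y * tensor a m y) = 0.
Proof.
move=> ja va Kb; rewrite /Rintegral; apply: (congr1 fine (y := 0%E)).
rewrite -(integral0 leb3 setT); apply: ae_eq_integral => //.
- apply/measurable_EFinP; apply: measurable_funM; last exact: measurable_tensor.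
  by apply/measurable_EFinP; exact: measurable_int iH.
- apply: ae3S H0 => x Hx _; have [Kx|/Hx ->] := pselect (K x).
    by rewrite (tensor_off va) ?mulr0//; exact: Kb.
  by rewrite mul0r.
Qed.

Lemma integrable_tensor a l r m : (forall i, jet (a i)) ->
  (forall i, vanishes_off (l i) (r i) (a i)) ->
  leb3.-integrable setT (EFin \o (fun y => H y * tensor a m y)).
Proof.
move=> ja va; have [C C0 HC] := tensor_bounded ja va m.
apply: (le_integrable measurableT _ _ (integrableZl measurableT C iH)).
  apply/measurable_EFinP; apply: measurable_funM; last exact: measurable_tensor.
  by apply/measurable_EFinP; exact: measurable_int iH.
move=> x _; rewrite /= lee_fin !normrM mulrC ler_wpM2r//.
by rewrite (le_trans (HC x))// ler_norm.
Qed.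

Variable d : R.
Hypothesis d_gt0 : 0 < d.
Hypothesis margin : forall x y, K x -> (forall i, `|co i x - co i y| <= d + d) -> Q y.

(** Sides not exceeding the margin leave two cases: a box that meets K lies in Q, where [orth]
    applies, and on any other box H is 0 almost everywhere. *)
Lemma orthogonal_small_box a l r m : (forall i, l i <= r i) ->
  (forall i, r i <= l i + (d + d)) -> (forall i, jet (a i)) ->
  (forall i, vanishes_off (l i) (r i) (a i)) ->
  \int[leb3]_y (H y * tensor a (bump_index m ord0) y) = 0.
Proof.
move=> lr rl ja va; have [[x [Kx bx]]|nK] := pselect (exists x, K x /\ box3 l r x).
  apply: (orth m lr ja va) => y bY; apply: margin Kx _ => i.
  have /andP[x1 x2] := bx i; have /andP[y1 y2] := bY i; have := rl i.
  move: x1 x2 y1 y2; move: (l i) (r i) (co i x) (co i y) (d + d) => *.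
  by rewrite ler_norml; apply/andP; split; lra.
apply: (Rintegral_tensor_disjoint _ ja va) => x Kx bx; apply: nK; by exists x.
Qed.

(* The difference of the tensor and its shift is the first partial derivative of a
   tensor supported in a slightly larger box. *)
Lemma Rintegral_tensor_shift (b : 'I_3 -> nat -> R -> R) (l r : 'I_3 -> R) : (forall i, l i <= r i) ->
  (forall i, r i <= l i + d) -> (forall i, jet (b i)) ->
  (forall i, vanishes_off (l i) (r i) (b i)) ->
  let b' := fun i => if i == ord0 then fun k (z : R) => b i k (z - d) else b i in
  \int[leb3]_y (H y * tensor b (fun=> 0%N) y) =
  \int[leb3]_y (H y * tensor b' (fun=> 0%N) y).
Proof.
move=> lr rl jb vb b'.
pose P n := if n is n'.+1 then b ord0 n' else primitive (b ord0 0%N).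
have jP : jet P by exact: jet_primitive (jb ord0) (vb ord0).
(* A has compact support although P need not: beyond r + d both terms equal the total integral of
   b_0. *)
pose A (k : nat) (z : R) := P k z - P k (z - d).
have jA : jet A by apply: jetB => //; exact: jet_shift.
have ib : leb.-integrable setT (EFin \o b ord0 0%N).
  apply: (integrable_continuous_vanishing _ (vb ord0 0%N)).
  exact: jet_continuous.
have PE (x : R) : r ord0 < x -> P 0%N x = P 0%N (r ord0).
  by move=> h; apply: primitive_cst => // z zr; rewrite vb// zr orbT.
have P0 (x : R) : x < l ord0 -> P 0%N x = 0.
  by apply: primitive_vanish => z zl; rewrite vb// zl.
have vA : vanishes_off (l ord0) (r ord0 + d) A.
  apply: jet_vanishes => // x /orP[xl|xr]; rewrite /A.
    by rewrite !P0 ?subrr// (lt_trans _ xl)// gtrBl.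
  by rewrite !PE ?subrr// ?ltrBrDr// (le_lt_trans _ xr)// lerDl ltW.
pose a i := if i == ord0 then A else b i.
have ja i : jet (a i) by rewrite /a; case: ifP.
(* The translation lengthens the first side by d; as the sides of b are at most d, the limit d + d
   of [orthogonal_small_box] is respected. *)
pose r' (i : 'I_3) : R := r i + (if i == ord0 then d else 0).
have va i : vanishes_off (l i) (r' i) (a i).
  by rewrite /a /r'; case: eqP => [->|_] //; rewrite addr0.
have := @orthogonal_small_box a l r' (fun=> 0%N) _ _ ja va.
have -> : (fun y => H y * tensor a (bump_index (fun=> 0%N) ord0) y) =
   (fun y => H y * tensor b (fun=> 0%N) y - H y * tensor b' (fun=> 0%N) y).
  apply/funext => y; rewrite -mulrBr; congr (_ * _).
  rewrite /tensor !big_ord_recl !big_ord0 /bump_index /a /b' /= /A /P /=.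
  by rewrite mulrBl.
rewrite RintegralB//; last 2 first.
- exact: integrable_tensor jb vb.
- pose s (i : 'I_3) : R := if i == ord0 then d else 0.
  apply: (@integrable_tensor _ (fun i => l i + s i) (fun i => r i + s i)).
    by move=> i; rewrite /b'; case: ifP => // _; exact: jet_shift.
  move=> i; rewrite /b' /s; case: ifP => _; last by rewrite !addr0.
  by move=> k x h; apply: vb; rewrite ltrBlDr ltrBrDr.
move=> h; apply/eqP; rewrite -subr_eq0; apply/eqP; apply: h => i; rewrite /r'.
  by rewrite (le_trans (lr i))// lerDl; case: ifP => // _; exact: ltW.
by rewrite addrA lerD ?rl//; case: ifP => // _; exact: ltW.
Qed.

Lemma Rintegral_tensor0 (b : 'I_3 -> nat -> R -> R) (l r : 'I_3 -> R) : (forall i, l i <= r i) ->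
  (forall i, r i <= l i + d) -> (forall i, jet (b i)) ->
  (forall i, vanishes_off (l i) (r i) (b i)) ->
  \int[leb3]_y (H y * tensor b (fun=> 0%N) y) = 0.
Proof.
have [L _ KL] := compact_box3 cK.
(* n counts the translations by d that bring the box to the right of [-L, L]^3, which contains K. *)
have key n : forall (b : 'I_3 -> nat -> R -> R) (l r : 'I_3 -> R), (forall i, l i <= r i) ->
  (forall i, r i <= l i + d) -> (forall i, jet (b i)) ->
  (forall i, vanishes_off (l i) (r i) (b i)) -> L < l ord0 + n%:R * d ->
  \int[leb3]_y (H y * tensor b (fun=> 0%N) y) = 0.
  elim: n => [|n IH] {}b {}l {}r lr rl jb vb.
    rewrite mul0r addr0 => Ll; apply: (Rintegral_tensor_disjoint _ jb vb).
    move=> x /KL /(_ ord0) /andP[_ xL] /(_ ord0) /andP[lx _].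
    by move: (lt_le_trans Ll lx); rewrite ltNge xL.
  have -> : n.+1%:R * d = n%:R * d + d by rewrite mulrSr mulrDl mul1r.
  move=> Ll.
  rewrite (Rintegral_tensor_shift lr rl jb vb).
  pose s i : R := if i == ord0 :> 'I_3 then d else 0.
  apply: (IH _ (fun i => l i + s i) (fun i => r i + s i)).
  - by move=> i; rewrite lerD2r.
  - by move=> i; rewrite addrAC lerD2r.
  - by move=> i; case: ifP => // _; exact: jet_shift.
  - move=> i; rewrite /s; case: ifP => _; last by rewrite !addr0.
    by move=> k x h; apply: vb; rewrite ltrBlDr ltrBrDr.
  - by rewrite /s eqxx -addrA [d + _]addrC.
move=> lr rl jb vb; apply: (key (Num.truncn (`|L - l ord0| / d)).+1 _ _ _ lr rl jb vb).
by rewrite -ltrBlDl (le_lt_trans (ler_norm _))// -ltr_pdivrMr// truncnS_gt.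
Qed.

Lemma ae_eq0_of_orthogonal : {ae leb3, forall x, H x = 0}.
Proof.
have d20 : 0 < d / 2 by rewrite divr_gt0.
apply: (ae_eq0_of_small_boxes iH d20) => p q pq qp.
have [t Ht] := @smooth_trapezoid R.
(* The constant term keeps the ramps 1 / N below d / 2, so that sides of at most d / 2 grow to at
   most d; the term k + 1 sends the ramps to 0. *)
pose N (k : nat) : R := k.+1%:R + (d / 2)^-1.
have N0 k : 0 < N k by rewrite addr_gt0// invr_gt0.
have NV1 k : (N k)^-1 <= d / 2.
  by rewrite -[leRHS]invrK lef_pV2 ?posrE// ?invr_gt0// lerDr.
have NV2 k : (N k)^-1 <= eps k.
  by rewrite /eps lef_pV2 ?posrE// lerDl invr_ge0 ltW.
pose b k i := t (N k) (p i) (q i).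
have Hb k i := Ht (N k) (p i) (q i) (N0 k) (pq i).
have I0 k : \int[leb3]_y (H y * tensor (b k) (fun=> 0%N) y) = 0.
  apply: (@Rintegral_tensor0 _ p (fun i => q i + (N k)^-1)) => i.
  - by rewrite (le_trans (pq i))// lerDl invr_ge0 ltW.
  - by rewrite [in leRHS](splitr d) addrA lerD.
  - by have [] := Hb k i.
  - by have [] := Hb k i.
pose B := [set x | forall i, p i < co i x <= q i].
have mB : measurable B.
  have -> : B = \bigcap_(i in [set: 'I_3]) (co i @^-1` `]p i, q i]).
    by apply/seteqP; split => x h i => [_|]; have := h i; rewrite /= ?in_itv//; exact.
  apply: fin_bigcap_measurable => // i _; rewrite -[X in measurable X]setTI; exact: measurable_co.
have iB := integrableM_indic iH mB.
have h : (fun k => \int[leb3]_y (H y * tensor (b k) (fun=> 0%N) y)) @ \oo -->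
    \int[leb3]_y (H y * \1_B y).
  apply: (@cvg_Rintegral_dominated _ _ _ leb3 _ _ (fun x => `|H x|)).
  - move=> k; apply: measurable_funM; last by apply: measurable_tensor => i; have [] := Hb k i.
    by apply/measurable_EFinP; exact: measurable_int iH.
  - by apply/measurable_EFinP; exact: measurable_int iB.
  - exact: (integrable_norm iH).
  - apply: (@aeW _ _ _ leb3) => x; split.
      move=> k; rewrite normrM ler_piMr// ger0_norm; last first.
        by apply: prodr_ge0 => i _; have [_ _ /(_ (co i x))/andP[]] := Hb k i.
      by apply: prodr_ile1 => i _; have [_ _ /(_ (co i x))] := Hb k i.
    apply: cvg_near_cst.
    (* Each factor is eventually constant in k: it is 0 up to p_i, 1 inside once the ramp is at most
       x_i - p_i, and 0 beyond q_i once it is at most x_i - q_i. *)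
    have E : \forall k \near \oo, forall i, b k i 0%N (co i x) = (p i < co i x <= q i)%R%:R.
      apply: filter_forall => i.
      have small e : 0 < e -> \forall k \near \oo, (N k)^-1 <= e.
        move=> e0; have : \forall k \near \oo, `|eps k| < e by move/cvgr0Pnorm_lt : (@eps_cvg0 R); exact.
        apply: filterS => k; rewrite gtr0_norm ?eps_gt0// => h.
        by rewrite (le_trans (NV2 k))// ltW.
      have [xp|px] := leP (co i x) (p i).
        by apply: nearW => k; rewrite /b; have [_ _ _ _ [-> //]] := Hb k i.
      have [xq|qx] := leP (co i x) (q i).
        have := small (co i x - p i); rewrite subr_gt0 => /(_ px); apply: filterS => k.
        by rewrite lerBrDl /b => h; have [_ _ _ -> //] := Hb k i.
      have := small (co i x - q i); rewrite subr_gt0 => /(_ qx); apply: filterS => k.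
      by rewrite lerBrDl /b => h; have [_ _ _ _ [_ ->//]] := Hb k i.
    apply: filterS E => k E; congr (_ * _); rewrite /tensor (eq_bigr _ (fun i _ => E i)) indicE.
    have [xB|xB] := pselect (B x).
      by rewrite mem_set// big1// => i _; rewrite xB.
    rewrite memNset//; have /existsNP[i /negP/negPf Hi] := xB.
    by rewrite (bigD1 i)//= Hi mul0r.
move: h; rewrite (_ : (fun k => _) = cst 0); last by apply/funext => k; exact: I0.
by move=> h; rewrite -(cvg_lim (@Rhausdorff R) h) (lim_cst (@Rhausdorff R)).
Qed.

End vanishing.

(** * From almost everywhere equality to the three claims *)

Section conclusion.
Context {R : realType}.
Implicit Types (x y : R * R * R).
Local Notation leb3 := (@lebesgue3 R).
Variables (lambda mu c : R) (F G : R * R * R -> 'cV[R]_3).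
Hypothesis iF : forall k, leb3.-integrable setT (EFin \o (fun x => F x k 0)).
Hypothesis iG : forall k, leb3.-integrable setT (EFin \o (fun x => G x k 0)).

Lemma ae_componentwise : (forall k, {ae leb3, forall x, F x k 0 - c * G x k 0 = 0}) ->
  {ae leb3, forall x, F x = c *: G x}.
Proof.
move=> h; have h2 := @filterI _ _ (ae_filter_ringOfSetsType leb3) _ _ (h ord0)
  (@filterI _ _ (ae_filter_ringOfSetsType leb3) _ _ (h (@Ordinal 3 1 isT)) (h (@Ordinal 3 2 isT))).
apply: ae3S h2 => x [x0 [x1 x2]].
apply/colP => i; rewrite !mxE; apply/eqP; rewrite -subr_eq0; apply/eqP.
by elim/ord3P: i.
Qed.

(** Equality at every x: the integrands agree for almost every y, and scaling respects the default
    value 0 of divergent integrals. *)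
Lemma convolution_ae_scale x : {ae leb3, forall y, F y = c *: G y} ->
  convolution (Kelvin lambda mu) F x = c *: convolution (Kelvin lambda mu) G x.
Proof.
move=> FG; apply/colP => i; rewrite [in RHS]mxE !convolutionE.
set f := fun y => _; set g := fun y => _.
have mK (K : R * R * R -> 'cV[R]_3) :
    (forall k, leb3.-integrable setT (EFin \o (fun x => K x k 0))) ->
    measurable_fun setT (fun y => \sum_(k < 3) Kelvin_kernel
      ((lambda + 3 * mu) / (8 * pi * mu * (lambda + 2 * mu)))
      ((lambda + mu) / (8 * pi * mu * (lambda + 2 * mu))) y i k x * K y k 0).
  move=> iK; apply: measurable_sum => k; apply: measurable_funM; last first.
    exact: measurable_component iK k.
  exact: (measurableT_comp (measurable_Kelvin_joint lambda mu i k) (pair2_measurable x)).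
have mg : measurable_fun setT g by exact: mK.
have mf : measurable_fun setT f by exact: mK.
rewrite -measurable_RintegralZl//.
apply: (congr1 fine); apply: ae_eq_integral => //.
- exact/measurable_EFinP.
- by apply/measurable_EFinP; exact: measurable_funM.
- apply: ae3S FG => y Fy _; congr EFin; rewrite /f /g mulr_sumr; apply: eq_bigr => k _.
  by rewrite Fy mxE mulrCA.
Qed.

End conclusion.

Theorem proposition2p7 (R : realType) (lambda mu rho0 : R)
    (mu_gt0 : 0 < mu) (lambda2mu_gt0 : 0 < lambda + 2 * mu) (rho0_gt0 : 0 < rho0)
    (D : set (R * R)) (bndD : bounded_set D) (openD : open D)
    (tmin tmax : R) (ltI : tmin < tmax)
    (F G : R * R * R -> 'cV[R]_3)
    (c : R) (M : 'cV[R]_3) (M_neq0 : M != 0) (chi : (R -> R) -> R) :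
  let I := `]tmin, tmax[%classic in
  let Q : set (R * R * R) := D `*` I in
  let U0 := convolution (Kelvin lambda mu) G in
  let U1 := fun x => convolution (Kelvin lambda mu) F x
                     - gamma1 lambda mu rho0 *: vector_integral Q G in
  L2c Q F -> L2c Q G -> is_distribution I chi ->
  (forall i : 'I_3,
     eq_distribution Q
       (regular_distribution Q (fun x => (U1 x - c *: U0 x) i 0))
       (fun phi => M i 0 * tensor1 D chi phi)) ->
  [/\ {ae lebesgue3, forall x, Q x -> F x = c *: G x},
      (forall x, Q x ->
        U1 x - c *: U0 x = - (gamma1 lambda mu rho0 *: vector_integral Q G))
    & (~ (forall i : 'I_3,
            eq_distribution Q (fun phi => M i 0 * tensor1 D chi phi) (fun=> 0)) ->
       vector_integral Q G != 0)].
Proof.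
move=> I Q U0 U1 LF LG chiI eqU.
have iF k : lebesgue3.-integrable setT (EFin \o (fun x => F x k 0)) by exact: L2c_integrable LF.
have iG k : lebesgue3.-integrable setT (EFin \o (fun x => G x k 0)) by exact: L2c_integrable LG.
have oQ : open Q.
  rewrite openE => -[z t] [/= Dz It]; exists (D, I) => //=; split; apply: open_nbhs_nbhs.
    by split.
  split => //; exact: (@itv_open _ R).
have [_ cF FQ] := LF; have [_ cG GQ] := LG.
pose K := ess_support F `|` ess_support G.
have cK : compact K by exact: compactU.
have KQ : K `<=` Q by rewrite subUset.
have [del del0 margin] := compact_margin cK oQ KQ.
have FG : {ae lebesgue3, forall x, F x = c *: G x}.
  apply: ae_componentwise => k.
  (* With d = del / 2 the required margin d + d is [del]. *)
  apply: (@ae_eq0_of_orthogonal R (fun x => F x k 0 - c * G x k 0) K Q _ cK _ _ (del / 2)).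
  - exact: (integrableB measurableT (iF k) (integrableZl measurableT c (iG k))).
  - have h := @filterI _ _ (ae_filter_ringOfSetsType lebesgue3) _ _ (ae_ess_support F) (ae_ess_support G).
    apply: ae3S h => x [Fx Gx] /not_orP[/Fx -> /Gx ->].
    by rewrite !mxE mulr0 subr0.
  - move=> a l r m; exact: (density_orthogonal mu_gt0 lambda2mu_gt0 iF iG chiI eqU).
  - by rewrite divr_gt0.
  - by move=> x y Kx; rewrite -splitr; exact: margin.
have UE x : U1 x - c *: U0 x = - (gamma1 lambda mu rho0 *: vector_integral Q G).
  by rewrite /U1 /U0 (convolution_ae_scale lambda mu iF iG x FG) addrAC subrr add0r.
split => //.
- by apply: ae3S FG => x ->.
(* If the integral of G is 0, so is U1 - c U0, and the equation makes M chi vanish on all test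
   functions. *)
- move=> nz; apply/eqP => G0; apply: nz => i phi tphi.
  rewrite -(eqU i phi tphi); apply: Rintegral0_eq => x _.
  by rewrite UE G0 scaler0 oppr0 mxE mul0r.
Qed.
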